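(* Let $u_\varepsilon$ be the Glimm approximate solution with step size $\varepsilon>0$ described in the context, with wave sets $\mathcal W(n\varepsilon)$ and wave speeds $\sigma(n\varepsilon,s)$. Then $$\sum_{n=1}^{+\infty}\int_{\mathcal W(n\varepsilon)}\big|\sigma(n\varepsilon,s)-\sigma((n-1)\varepsilon,s)\big|\,ds\ \le\ (3+2\log 2)\,\|f''\|_{L^\infty}\,\mathrm{Tot.Var.}(\bar u)^2 .$$
   Context: Standing assumptions: $f:\mathbb R\to\mathbb R$ is $C^2$ with $0<f'(u)<1$ for all $u$ and $f''$ bounded; $\bar u\in BV(\mathbb R)$ is right-continuous; $\log$ is the natural logarithm. For continuous $g:\mathbb R\to\mathbb R$, $\mathrm{conv}_{[a,b]}g$ is the largest convex function on $[a,b]$ which is $\le g$, and $\mathrm{conc}_{[a,b]}g$ the smallest concave function on $[a,b]$ which is $\ge g$ (for $f\in C^2$ these are $C^1$ on $[a,b]$, with one-sided derivatives at the endpoints). Glimm scheme. Fix $\varepsilon>0$, put $t_n=n\varepsilon$, $x_m=m\varepsilon$, and let $(\vartheta_n)_{n\ge1}\subset[0,1]$ be uniformly distributed, i.e. $\lim_{N}\frac1N\#\{1\le n\le N:\vartheta_n\in[0,\lambda]\}=\lambda$ for every $\lambda\in[0,1]$. Set $u_\varepsilon(0,x)=\bar u_\varepsilon(x):=\bar u(x_m)$ for $x\in[x_m,x_{m+1})$. On each $[t_n,t_{n+1})$, $u_\varepsilon$ is obtained by solving exactly (entropy solution of $u_t+f(u)_x=0$) the Riemann problems at the nodes $x_m$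 (they do not overlap since $0<f'<1$), and at $t_{n}$, $n\ge 1$, one resets $u_\varepsilon(t_n,x):=u_\varepsilon(t_n-,\vartheta_nx_m+(1-\vartheta_n)x_{m-1})$ for all $x\in[x_{m-1},x_m)$. $u_\varepsilon(t,\cdot)$ is right-continuous in $x$; $u_{n,m}:=u_\varepsilon(n\varepsilon,m\varepsilon)$. Waves. $\mathcal W:=(0,\mathrm{Tot.Var.}(\bar u_\varepsilon)]$, $U(x):=\mathrm{Tot.Var.}(\bar u_\varepsilon;(-\infty,x])$. Initial position: $\mathtt x(0,s):=\inf\{x\in(-\infty,+\infty]: s\le U(x)\}$; sign: $\mathcal S(s):=\mathrm{sign}[\bar u_\varepsilon(\mathtt x(0,s))-\bar u_\varepsilon(\mathtt x(0,s)-)]$; state: $\hat u(s):=\bar u_\varepsilon(\mathtt x(0,s)-)+\mathcal S(s)[s-U(\mathtt x(0,s)-)]$. (If $\mathtt x(0,s)=+\infty$, possible only for $s=\mathrm{Tot.Var.}(\bar u_\varepsilon)$, the values $\mathcal S(s),\hat u(s)$ are immaterial.) Given the positions $\mathtt x(n\varepsilon,\cdot):\mathcal W\to\varepsilon\mathbb Z\cup\{+\infty\}$, the speed of $s$ at time $n\varepsilon$ is: $\sigma(n\varepsilon,s)=+\infty$ if $\mathtt x(n\varepsilon,s)=+\infty$; otherwise, with $x=\mathtt x(n\varepsilon,s)$, $u^-=u_\varepsilon(n\varepsilon,x-)$, $u^+=u_\varepsilon(n\varepsilon,x)$, $\sigma(n\varepsilon,s)=\big(\tfrac{d}{du}\mathrm{conv}_{[u^-,u^+]}f\big)(\hat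 u(s))$ if $\mathcal S(s)=+1$ and $\sigma(n\varepsilon,s)=\big(\tfrac{d}{du}\mathrm{conc}_{[u^+,u^-]}f\big)(\hat u(s))$ if $\mathcal S(s)=-1$. Put $\mathcal W(n\varepsilon,m\varepsilon)=\{s:\mathtt x(n\varepsilon,s)=m\varepsilon\}$, and let $\mathcal W^{(0)}(n\varepsilon,m\varepsilon)$, $\mathcal W^{(1)}(n\varepsilon,m\varepsilon)$ be its subsets where $\sigma(n\varepsilon,s)\le\vartheta_{n+1}$, respectively $\sigma(n\varepsilon,s)>\vartheta_{n+1}$. Recursively, $\mathtt x((n+1)\varepsilon,s)=m\varepsilon$ if $s\in\mathcal W^{(1)}(n\varepsilon,(m-1)\varepsilon)\cup\mathcal W^{(0)}(n\varepsilon,m\varepsilon)$, $\mathcal S(s)=\mathrm{sign}(u_{n+1,m}-u_{n+1,m-1})$ and $\mathcal S(s)u_{n+1,m-1}<\mathcal S(s)\hat u(s)\le\mathcal S(s)u_{n+1,m}$; if no such $m$ exists, $\mathtt x((n+1)\varepsilon,s)=+\infty$ ($s$ is removed). Finally $\mathcal W(n\varepsilon):=\{s\in\mathcal W:\mathtt x(n\varepsilon,s)<+\infty\}$. *)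

(* Defs.v *)
From HB Require Import structures.
From mathcomp Require Import all_boot all_order all_algebra.
From mathcomp Require Import all_classical all_reals all_analysis.

Set Implicit Arguments.
Unset Strict Implicit.
Unset Printing Implicit Defensive.
Import Order.TTheory GRing.Theory Num.Theory.
Import numFieldNormedType.Exports.
Local Open Scope ring_scope.
Local Open Scope classical_set_scope.

Section Functions.
Context {R : realType}.
Implicit Types (f g h : R -> R) (a b x : R).

(* The library's [total_variation a b g] is the pointwise variation on [a, b]. *)
Definition total_variation_le x g : \bar R :=
  ereal_sup [set total_variation a x g | a in [set a | a <= x]].

Definition total_variation_line g : \bar R :=
  ereal_sup [set total_variation ab.1 ab.2 g
            | ab in [set ab : R * R | ab.1 <= ab.2]].

Definition right_continuous g := forall x, g y @[y --> x^'+] --> g x.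

Definition left_limit g x : R := lim (g y @[y --> x^'-]).

Definition C2 f :=
  [/\ forall x, derivable f x 1, forall x, derivable f^`() x 1
    & continuous f^`()^`()].

(* A pointwise supremum of convex functions is convex, so this is the largest
   convex minorant of [g] on [a, b]; dually for the concave envelope. *)
Definition conv_env a b g x : R :=
  sup [set h x | h in [set h | @convex_function R R^o `[a, b] h /\
                               {in `[a, b], forall y, h y <= g y}]].

Definition conc_env a b g x : R :=
  inf [set h x | h in [set h | @convex_function R R^o `[a, b] (\- h) /\
                               {in `[a, b], forall y, g y <= h y}]].

(* Derivative relative to [a, b]: one-sided at the endpoints. *)
Definition derive_itv a b g x : R :=
  lim ((g y - g x) / (y - x) @[y --> within `[a, b] x^']).

End Functions.

Section EntropySolution.
Context {R : realType}.
Local Notation mu := (@lebesgue_measure R).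

Definition partial_t (phi : R -> R -> R) (t x : R) : R := derive1 (phi ^~ x) t.
Definition partial_x (phi : R -> R -> R) (t x : R) : R := derive1 (phi t) x.

Definition L1_distance (M : R) (g h : R -> R) : \bar R :=
  \int[mu]_(x in `[- M, M]) (`|g x - h x|)%:E.

(* C^1 is expressed by the joint continuity of both partial derivatives. *)
Definition test_function (phi : R -> R -> R) :=
  [/\ forall t x, 0 <= phi t x,
      forall t x, derivable (phi ^~ x) t 1 /\ derivable (phi t) x 1,
      continuous (fun p : R * R => partial_t phi p.1 p.2) /\
        continuous (fun p : R * R => partial_x phi p.1 p.2)
    & exists2 K : set (R * R), compact K &
        K `<=` [set p | 0 < p.1] /\
        forall t x, ~ K (t, x) -> phi t x = 0].

(* The Kruzhkov entropy |v - k| and its flux tested against [phi]. *)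
Definition entropy_production (f : R -> R) (v : R -> R -> R) (k : R)
    (phi : R -> R -> R) : \bar R :=
  \int[(mu \x mu)%E]_(p in [set p : R * R | 0 < p.1])
    (`|v p.1 p.2 - k| * partial_t phi p.1 p.2 +
     Num.sg (v p.1 p.2 - k) * (f (v p.1 p.2) - f k) * partial_x phi p.1 p.2)%:E.

(* Kruzhkov entropy solution of v_t + f(v)_x = 0, v(0, .) = v0 on the
   half-plane 0 <= t.  Continuity in time with values in L^1_loc gives v(t, .)
   a meaning, up to null sets, for every t and not only for almost every t. *)
Definition entropy_solution (f v0 : R -> R) (v : R -> R -> R) :=
  [/\ exists M, forall t x, 0 <= t -> `|v t x| <= M,
      measurable_fun [set p : R * R | 0 <= p.1] (fun p => v p.1 p.2),
      v 0 = v0,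
      forall t0 M : R, 0 <= t0 ->
        L1_distance M (v t) (v t0)
          @[t --> within [set t | 0 <= t] (nbhs t0)] --> 0%E
    & forall (k : R) phi, test_function phi ->
        (0 <= entropy_production f v k phi)%E].

Definition riemann_data (ul ur x : R) : R := if x < 0 then ul else ur.

(* Right-continuity in x selects one representative of each v(t, .), so that
   the pointwise values of [v] are determined. *)
Definition riemann_solution (f : R -> R) (ul ur : R) (v : R -> R -> R) :=
  entropy_solution f (riemann_data ul ur) v /\
  forall t, 0 <= t -> right_continuous (v t).

End EntropySolution.

Section Glimm.
Context {R : realType}.
Local Notation mu := (@lebesgue_measure R).

(* Only the terms of index n >= 1 are relevant. *)
Definition uniformly_distributed (theta : nat -> R) :=
  (forall n, (0 < n)%N -> 0 <= theta n <= 1) /\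
  forall lambda, 0 <= lambda <= 1 ->
    (count (fun n => 0 <= theta n <= lambda) (iota 1 N))%:R / N%:R
      @[N --> \oo] --> lambda.

Context (f : R -> R) (eps : R) (theta : nat -> R) (ubar : R -> R).

Definition time (n : nat) : R := n%:R * eps.
Definition node (m : int) : R := m%:~R * eps.

Definition discretized_datum (x : R) : R := ubar (node (Num.floor (x / eps))).

(* Only the values of [u] for t >= 0 are constrained.  In the sampling clause
   the value u(t_n-, y) is the limit in time from the left; it is part of the
   clause that this limit exists. *)
Definition glimm_solution (u : R -> R -> R) :=
  [/\ u 0 = discretized_datum,
      forall (n : nat) (m : int), exists2 v,
        riemann_solution f (left_limit (u (time n)) (node m))
                           (u (time n) (node m)) v &
        forall t x, time n <= t < time n.+1 -> node m <= x < node (m + 1) ->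
          u t x = v (t - time n) (x - node m)
    & forall (n : nat) (m : int) x, (0 < n)%N -> node (m - 1) <= x < node m ->
        u t (theta n * node m + (1 - theta n) * node (m - 1))
          @[t --> (time n)^'-] --> u (time n) x].

Context (u : R -> R -> R).

Definition grid_value (n : nat) (m : int) : R := u (time n) (node m).

Definition waves : set R :=
  [set s | 0 < s /\ (s%:E <= total_variation_line discretized_datum)%E].

(* [total_variation_le] is finite here since the total variation of the datum
   is; [U] is the corresponding real-valued function. *)
Definition U (x : R) : R := fine (total_variation_le x discretized_datum).

(* The infimum of the empty set is +oo. *)
Definition position0 (s : R) : \bar R :=
  ereal_inf [set x%:E | x in [set x | s <= U x]].

Definition wave_sign (s : R) : R :=
  let x := fine (position0 s) in
  Num.sg (discretized_datum x - left_limit discretized_datum x).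

Definition wave_state (s : R) : R :=
  let x := fine (position0 s) in
  left_limit discretized_datum x + wave_sign s * (s - left_limit U x).

(* Speed at time n * eps of the wave [s], the positions at that time being
   given by [pos]. *)
Definition speed_at (n : nat) (pos : R -> \bar R) (s : R) : \bar R :=
  if pos s is x%:E then
    let ul := left_limit (u (time n)) x in
    let ur := u (time n) x in
    (if wave_sign s == 1
     then derive_itv ul ur (conv_env ul ur f) (wave_state s)
     else derive_itv ur ul (conc_env ur ul f) (wave_state s))%:E
  else +oo%E.

(* [slow_waves] and [fast_waves] are W^(0)(n eps, m eps) and
   W^(1)(n eps, m eps). *)
Definition slow_waves (n : nat) (pos : R -> \bar R) (m : int) : set R :=
  [set s | [/\ waves s, pos s = (node m)%:E &
               (speed_at n pos s <= (theta n.+1)%:E)%E]].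

Definition fast_waves (n : nat) (pos : R -> \bar R) (m : int) : set R :=
  [set s | [/\ waves s, pos s = (node m)%:E &
               ((theta n.+1)%:E < speed_at n pos s)%E]].

Definition moves_to (n : nat) (pos : R -> \bar R) (s : R) (m : int) : Prop :=
  [/\ (fast_waves n pos (m - 1) `|` slow_waves n pos m) s,
      wave_sign s = Num.sg (grid_value n.+1 m - grid_value n.+1 (m - 1)) &
      wave_sign s * grid_value n.+1 (m - 1) < wave_sign s * wave_state s
        <= wave_sign s * grid_value n.+1 m].

(* At most one [m] satisfies [moves_to], and the wave is removed (sent to +oo)
   if there is none. *)
Fixpoint position (n : nat) : R -> \bar R :=
  if n is n'.+1 then
    fun s => xget +oo%E [set (node m)%:E | m in moves_to n' (position n') s]
  else position0.

Definition speed (n : nat) : R -> \bar R := speed_at n (position n).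

Definition remaining_waves (n : nat) : set R :=
  [set s | waves s /\ (position n s < +oo)%E].

Definition speed_variation (n : nat) : \bar R :=
  (\int[mu]_(s in remaining_waves n) `|speed n s - speed n.-1 s|)%E.

End Glimm.

(* Main.v *)
Require Import Defs.
From HB Require Import structures.
From mathcomp Require Import all_boot all_order all_algebra.
From mathcomp Require Import all_classical all_reals all_analysis.
From mathcomp Require Import ess_sup_inf measurable_realfun zify ring lra.

Set Implicit Arguments.
Unset Strict Implicit.
Unset Printing Implicit Defensive.
Import Order.TTheory GRing.Theory Num.Theory.
Import numFieldNormedType.Exports.
Local Open Scope ring_scope.
Local Open Scope classical_set_scope.

(* For a sign S put g(w) = S f(S w) and y(n, m) = S u_{n,m}.  The waves of sign
   S at the node (n, m) fill the interval ]y(n, m-1), y(n, m)], and the speed of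
   a wave is the slope at its state of the convex hull of g on that interval.
   Sampling at height theta replaces y(n, m) by the largest minimizer of
   g - theta id on this interval (Kruzhkov's inequality in moving cones gives
   the one-sided comparison that identifies the sample), so it cuts the hull at
   a contact point, which changes no slope.

   Hence speeds change at a node only through cancellation or through the merging
   of two packets.  With K a Lipschitz constant of f' and v the measure of the
   waves of sign S:
   - if waves are cancelled, the total change of speed at the node is at most K v
     times the measure of the cancelled waves; a wave is cancelled only once;
   - if two packets merge, it is at most 2 K times the measure of the set of
     pairs of waves that meet there for the first time: waves that have already
     met are separated by a slope, so they contribute nothing to the gap between
     g and the new hull.
   The total is at most K v^2 + 2 K v^2 for each sign, and the measures of the
   two sets of initial waves add up to at most the total variation. *)

(** * Piecewise quadratic functions *)

(** A fan is known only as an entropy solution, without a formula. Comparison with constants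
    suffices: a line of slope th supporting g at p bounds the solution by p on one side of the ray x
    = th t. The sample is the largest minimizer because before time [eps] the point th eps lies on
    rays of slope slightly above th.

    When a packet is prolonged or shortened at one end, its slopes all change in the same direction,
    so the integral of the change telescopes to the gap between g and a hull at the junction. In a
    merge both packets see the same gap, whence 2 K. The gap times the length of the flat piece over
    the junction is the integral of g'(v) - g'(v') over pairs v, v' of states on its two sides,
    which is how areas of sets of pairs enter.

    The obstacle is that merged packets may be cut and merge again, so that a pair must not be
    charged twice. The separating slope is therefore attached to a boundary between nodes and serves
    all the pairs that have met across it. It persists because no jump of the opposite sign can lie
    between two waves that have met. *)

Section RampSquare.
Context {R : realType}.
Implicit Types (F : R -> R) (x y : R).

(** A quadratic remainder is at hand both for glued quadratics and for the hull, whose derivative is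
    only Lipschitz. *)
Lemma is_derive_quadratic F x (l C r : R) : 0 < r ->
  (forall h, `|h| < r -> `|F (x + h) - F x - l * h| <= C * (h * h)) ->
  is_derive x 1 F l.
Proof.
move=> r0 HC.
suff H : h^-1 *: (F (h + x) - F x) @[h --> 0^'] --> l.
  have H' : h^-1 *: ((F \o shift x) (h *: 1) - F x) @[h --> 0^'] --> l.
    by apply: cvg_trans H; apply: near_eq_cvg; near=> h; rewrite /= [h *: 1]mulr1.
  apply: DeriveDef; first by apply/cvg_ex; exists l.
  exact/cvg_lim.
apply/cvgrPdist_le => /= e e0; rewrite near_withinE.
have K1 : 0 < `|C| + 1 by rewrite ltr_wpDl.
have eK : 0 < e / (`|C| + 1) by exact: divr_gt0.
near=> h => /= h0.
have h1 : 0 < `|h| by rewrite normr_gt0.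
have hr : `|h| < r.
  by near: h; apply/nbhs_ballP; exists r => //= h; rewrite /ball/= sub0r normrN.
have -> : l - h^-1 *: (F (h + x) - F x) = - ((F (x + h) - F x - l * h) / h).
  by rewrite /GRing.scale /= (addrC x); field.
rewrite normrN normrM normfV ler_pdivrMr// (le_trans (HC h hr))//.
apply: (@le_trans _ _ ((`|C| + 1) * `|h| * `|h|)).
  rewrite -mulrA -normrM; apply: (@le_trans _ _ ((`|C| + 1) * (h * h))).
    rewrite ler_wpM2r//; first by rewrite -expr2 sqr_ge0.
    by have := ler_norm C; lra.
  by rewrite ler_wpM2l// ?ler_norm// ltW.
rewrite ler_pM2r// mulrC -ler_pdivlMr// ltW//.
Unshelve. all: end_near. Qed.

Definition ramp y : R := Num.max 0 y.
Definition ramp2 y : R := ramp y * ramp y.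

Lemma ramp_ge0 y : 0 <= ramp y. Proof. by rewrite /ramp le_max lexx. Qed.
Lemma ramp2_ge0 y : 0 <= ramp2 y. Proof. by rewrite mulr_ge0// ramp_ge0. Qed.
Lemma ramp_pos y : 0 <= y -> ramp y = y. Proof. by move=> /max_idPr. Qed.
Lemma ramp_neg y : y <= 0 -> ramp y = 0. Proof. by move=> /max_idPl. Qed.
Lemma ramp2_neg y : y <= 0 -> ramp2 y = 0.
Proof. by move=> y0; rewrite /ramp2 ramp_neg// mul0r. Qed.

Lemma is_derive_ramp2 x : is_derive x 1 ramp2 (2 * ramp x).
Proof.
apply: (@is_derive_quadratic _ _ _ 1 1) => // h _; rewrite mul1r /ramp2.
have [x0|x0] := leP 0 x; have [h0|h0] := leP 0 (x + h).
- rewrite !ramp_pos// (_ : _ - _ = h * h); last ring.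
  by rewrite ger0_norm// -expr2 sqr_ge0.
- rewrite (ramp_pos x0) (ramp_neg (ltW h0)).
  rewrite (_ : _ - _ = - (x * (x + h) + x * h)); last ring.
  rewrite normrN ler_norml; apply/andP; split; nra.
- rewrite (ramp_neg (ltW x0)) (ramp_pos h0).
  by rewrite ger0_norm; nra.
- rewrite (ramp_neg (ltW x0)) (ramp_neg (ltW h0)).
  by rewrite !mulr0 !mul0r !subr0 normr0; nra.
Qed.

Lemma is_derive_affine (a b t : R) : is_derive t 1 (fun s : R => a + b * s) b.
Proof.
apply: (@is_derive_quadratic _ _ _ 0 1) => // h _.
by rewrite (_ : _ - _ = 0) ?normr0 ?mul0r//; ring.
Qed.

Lemma is_derive_ramp2_affine (F : R -> R) (a b t : R) :
  (forall s, F s = a + b * s) ->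
  is_derive t 1 (fun s => ramp2 (F s)) (b * (2 * ramp (F t))).
Proof.
move=> /funext ->; rewrite mulrC.
exact: (@is_derive1_comp _ ramp2 (fun s => a + b * s) t _ _ (is_derive_ramp2 _)
  (is_derive_affine _ _ _)).
Qed.

Lemma continuous_ramp : continuous ramp.
Proof.
by move=> x; apply: continuous_max; [exact: cvg_cst|exact: cvg_id].
Qed.

Lemma continuous_ramp2 : continuous ramp2.
Proof. by move=> x; apply: cvgM; exact: continuous_ramp. Qed.

(* C^1 transition from 0 on ]-oo, tau] to 1 on [2 tau, +oo[ *)
Definition smoothstep (tau t : R) : R := 2 / (tau * tau) *
  (ramp2 (t - tau) - 2 * ramp2 (t - tau * (3 / 2)) + ramp2 (t - 2 * tau)).

(** A tent of height [2 / tau] and integral 1 carried by [tau, 2 tau]. *)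
Definition dsmoothstep (tau t : R) : R := 4 / (tau * tau) *
  (ramp (t - tau) - 2 * ramp (t - tau * (3 / 2)) + ramp (t - 2 * tau)).

Lemma is_derive_ramp2_shift (c t : R) :
  is_derive t 1 (fun s => ramp2 (s - c)) (2 * ramp (t - c)).
Proof.
rewrite -[2 * _]mul1r.
by apply: (@is_derive_ramp2_affine (fun s => s - c) (- c)) => s; ring.
Qed.

Lemma is_derive_smoothstep (tau t : R) :
  is_derive t 1 (smoothstep tau) (dsmoothstep tau t).
Proof.
rewrite /smoothstep /dsmoothstep.
have h1 := is_derive_ramp2_shift tau t.
have h2 := is_derive_ramp2_shift (tau * (3 / 2)) t.
have h3 := is_derive_ramp2_shift (2 * tau) t.
apply: is_derive_eq; rewrite /GRing.scale /=; ring.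
Qed.

Lemma smoothstep_le (tau t : R) : 0 < tau -> t <= tau -> smoothstep tau t = 0.
Proof.
by move=> tau0 tt; rewrite /smoothstep !ramp2_neg; [ring|lra..].
Qed.

Lemma dsmoothstep_le (tau t : R) : 0 < tau -> t <= tau -> dsmoothstep tau t = 0.
Proof.
by move=> tau0 tt; rewrite /dsmoothstep !ramp_neg; [ring|lra..].
Qed.

Lemma smoothstep_ge (tau t : R) : 0 < tau -> 2 * tau <= t -> smoothstep tau t = 1.
Proof.
move=> tau0 tt; rewrite /smoothstep /ramp2 !ramp_pos; [|lra..].
by field; lra.
Qed.

Lemma dsmoothstep_ge (tau t : R) : 0 < tau -> 2 * tau <= t -> dsmoothstep tau t = 0.
Proof.
by move=> tau0 tt; rewrite /dsmoothstep !ramp_pos; [field; lra|lra..].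
Qed.

Lemma dsmoothstep_bound (tau t : R) : 0 < tau -> 0 <= dsmoothstep tau t <= 2 / tau.
Proof.
move=> tau0; have tt0 : 0 < tau * tau by exact: mulr_gt0.
have E2 : 2 / tau = 4 / (tau * tau) * (tau / 2) by field; lra.
have c0 : 0 < 4 / (tau * tau) by exact: divr_gt0.
suff /andP[h1 h2] : 0 <= ramp (t - tau) - 2 * ramp (t - tau * (3 / 2)) +
    ramp (t - 2 * tau) <= tau / 2.
  rewrite E2 /dsmoothstep ler_pM2l// h2 andbT mulr_ge0//.
  exact: ltW.
have [t1|t1] := leP t tau.
  by rewrite !ramp_neg; [apply/andP; split; lra|lra..].
have r1 : ramp (t - tau) = t - tau by rewrite ramp_pos//; lra.
have [t2|t2] := leP t (tau * (3 / 2)).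
  by rewrite r1 !ramp_neg; [apply/andP; split; lra|lra..].
have r2 : ramp (t - tau * (3 / 2)) = t - tau * (3 / 2) by rewrite ramp_pos//; lra.
have [t3|t3] := leP t (2 * tau).
  by rewrite r1 r2 ramp_neg; [apply/andP; split; lra|lra].
by rewrite !ramp_pos; [apply/andP; split; lra|lra..].
Qed.

Lemma smoothstep_ge0 (tau t : R) : 0 < tau -> 0 <= smoothstep tau t.
Proof.
move=> tau0.
have [t0|t0] := leP t tau; first by rewrite smoothstep_le.
have cf : {within `[tau, t], continuous (smoothstep tau)}.
  apply: continuous_subspaceT => x; apply: differentiable_continuous.
  by apply/derivable1_diffP; have [] := is_derive_smoothstep tau x.
have [z zt] := MVT_segment (ltW t0) (fun z _ => is_derive_smoothstep tau z) cf.
rewrite (smoothstep_le tau0 (lexx _)) subr0 => ->.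
apply: mulr_ge0; last lra.
by have /andP[] := dsmoothstep_bound z tau0.
Qed.

Lemma continuous_dsmoothstep (tau : R) : continuous (dsmoothstep tau).
Proof.
move=> t; have shift c : {for t, continuous (fun s => ramp (s - c))}.
  apply: (@continuous_comp _ _ _ (fun s => s - c) ramp); last exact: continuous_ramp.
  by apply: cvgB; [exact: cvg_id|exact: cvg_cst].
apply: cvgM; first exact: cvg_cst.
apply: cvgD; last exact: shift.
by apply: cvgB; [exact: shift|apply: cvgM; [exact: cvg_cst|exact: shift]].
Qed.

Lemma continuous_smoothstep (tau : R) : continuous (smoothstep tau).
Proof.
move=> x; apply: differentiable_continuous.
by apply/derivable1_diffP; have [] := is_derive_smoothstep tau x.
Qed.

End RampSquare.

(** * Convex hulls of a flux *)

Section Envelope.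
Context {R : realType}.
Implicit Types (g dg : R -> R) (a b l w p q x y : R).

(** The bound is on the absolute value of [dg], without positivity, so that the class is stable
    under [v |-> g (- v)], which exchanges the endpoints of an interval. *)
Definition admissible_flux (K : R) g dg :=
  [/\ forall x, is_derive x 1 g (dg x), forall x, `|dg x| <= 1
    & forall x y, `|dg x - dg y| <= K * `|x - y|].

(* [p] minimizes [g - l id] on [a, b]. *)
Definition supports g a b l p :=
  a <= p <= b /\ forall v, a <= v <= b -> l * (v - p) <= g v - g p.

(* [l] is the slope at [w] of the convex hull of [g] on [a, b]: either [w] is a
   contact point or it lies on a flat piece [p, q]. *)
Definition env_slope g dg a b w l :=
  [/\ a <= w, w <= b & (supports g a b l w /\ dg w = l) \/
    exists p q, [/\ p < q, p <= w, w <= q, supports g a b l p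
                  & supports g a b l q]].

Section Flux.
Variables (K : R) (g dg : R -> R).
Hypothesis gK : admissible_flux K g dg.

Lemma flux_continuous : continuous g.
Proof.
case: gK => gd _ _ x; apply: differentiable_continuous.
by apply/derivable1_diffP; have [] := gd x.
Qed.

Lemma flux_within (A : set R) : {within A, continuous g}.
Proof. by apply: continuous_subspaceT; exact: flux_continuous. Qed.

Lemma flux_mvt x y : x <= y -> exists2 z, x <= z <= y & g y - g x = dg z * (y - x).
Proof.
move=> xy; case: gK => gd _ _.
have [z zxy h] := MVT_segment xy (fun z _ => gd z) (@flux_within _).
by exists z => //; rewrite in_itv in zxy.
Qed.

Lemma flux_lipschitz x y : `|g y - g x| <= `|y - x|.
Proof.
case: gK => _ b1 _.
wlog xy : x y / x <= y.
  move=> H; have [/H//|/ltW/H] := leP x y.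
  by rewrite distrC (distrC x).
have [z _ ->] := flux_mvt xy.
by rewrite normrM -[leRHS]mul1r ler_wpM2r.
Qed.

(** Testing each minimality at the other point and adding gives [(l2 - l1) * (p2 - p1) >= 0]. *)
Lemma supports_mono a b l1 l2 p1 p2 : supports g a b l1 p1 ->
  supports g a b l2 p2 -> l1 < l2 -> p1 <= p2.
Proof.
move=> [p1i h1] [p2i h2] l12.
have {}h1 := h1 _ p2i; have {}h2 := h2 _ p1i.
rewrite -subr_ge0 -(pmulr_rge0 _ (_ : 0 < l2 - l1)); last lra.
by nra.
Qed.

Lemma supports_eq a b l p q : supports g a b l p -> supports g a b l q ->
  g q - g p = l * (q - p).
Proof.
move=> [p1i h1] [p2i h2].
have {}h1 := h1 _ p2i; have {}h2 := h2 _ p1i.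
by apply/eqP; rewrite eq_le; apply/andP; split; lra.
Qed.

Lemma supports_dg_ge a b l p : supports g a b l p -> p < b -> l <= dg p.
Proof.
move=> [/andP[ap _] h1] pb; case: gK => gd _ Kl.
rewrite leNgt; apply/negP => dl.
have K0 : 0 <= K.
  by have := Kl 1 0; rewrite subr0 normr1 mulr1; exact: le_trans.
(* Within distance [d] the derivative is at most the mean of [dg p] and [l], since
   [K * d <= (l - dg p) / 2]; the graph would fall below the support line. *)
pose d := Num.min (b - p) ((l - dg p) / (2 * (K + 1))).
have d0 : 0 < d by rewrite lt_min; apply/andP; split; [lra|apply: divr_gt0; lra].
have db : d <= b - p by rewrite ge_min lexx.
have dK : (2 * (K + 1)) * d <= l - dg p.
  by rewrite mulrC -ler_pdivlMr ?ge_min ?lexx ?orbT//; lra.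
have [z /andP[z1 z2] h] := @flux_mvt p (p + d) ltac:(lra).
have := h1 (p + d) ltac:(apply/andP; split; lra).
rewrite h.
have zK := Kl z p; rewrite (ger0_norm (_ : 0 <= z - p)) in zK; last lra.
have {}zK := le_trans (ler_norm _) zK.
have : K * (z - p) <= K * d by apply: ler_wpM2l; lra.
nra.
Qed.

Lemma supports_dg_le a b l p : supports g a b l p -> a < p -> dg p <= l.
Proof.
move=> [/andP[_ pb] h1] pb'; case: gK => gd _ Kl.
rewrite leNgt; apply/negP => dl.
have K0 : 0 <= K.
  by have := Kl 1 0; rewrite subr0 normr1 mulr1; exact: le_trans.
pose d := Num.min (p - a) ((dg p - l) / (2 * (K + 1))).
have d0 : 0 < d by rewrite lt_min; apply/andP; split; [lra|apply: divr_gt0; lra].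
have db : d <= p - a by rewrite ge_min lexx.
have dK : (2 * (K + 1)) * d <= dg p - l.
  by rewrite mulrC -ler_pdivlMr ?ge_min ?lexx ?orbT//; lra.
have [z /andP[z1 z2] h] := @flux_mvt (p - d) p ltac:(lra).
have := h1 (p - d) ltac:(apply/andP; split; lra).
have -> : g (p - d) - g p = - (g p - g (p - d)) by ring.
rewrite h.
have zK := Kl p z; rewrite (ger0_norm (_ : 0 <= p - z)) in zK; last lra.
have {}zK := le_trans (ler_norm _) zK.
have : K * (p - z) <= K * d by apply: ler_wpM2l; lra.
nra.
Qed.

(** Only an inequality survives when [p] is the endpoint [a], where [g] may be steeper than its
    hull. With [env_slope_right] it is enough to compare two slopes. *)
Lemma env_slope_left a b w l : env_slope g dg a b w l ->
  exists p, [/\ supports g a b l p, p <= w & l <= dg p].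
Proof.
move=> [_ _ [[s E]|[p [q [pq pw wq sp sq]]]]]; first by exists w; rewrite E.
exists p; split => //; apply: supports_dg_ge sp _.
by case: sq => /andP[_ +] _; apply: lt_le_trans.
Qed.

Lemma env_slope_right a b w l : env_slope g dg a b w l ->
  exists q, [/\ supports g a b l q, w <= q & dg q <= l].
Proof.
move=> [_ _ [[s E]|[p [q [pq pw wq sp sq]]]]]; first by exists w; rewrite E.
exists q; split => //; apply: supports_dg_le sq _.
by case: sp => /andP[+ _] _ => /le_lt_trans; apply.
Qed.

(** If the slope increases, the contact points [q] right of [w1] and [p] left of [w2] satisfy
    [q <= p], and [l2 - l1 <= dg p - dg q]: the hull inherits the constant [K]. *)
Lemma env_slope_le a b w1 w2 l1 l2 : env_slope g dg a b w1 l1 ->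
  env_slope g dg a b w2 l2 -> w1 <= w2 -> l2 - l1 <= K * (w2 - w1).
Proof.
move=> s1 s2 w12; case: gK => _ _ Kl.
have K0 : 0 <= K.
  by have := Kl 1 0; rewrite subr0 normr1 mulr1; exact: le_trans.
have [l12|l12] := leP l2 l1.
  by rewrite (@le_trans _ _ 0)//; [lra|apply: mulr_ge0; lra].
have [q [Q1 Q2 Q3]] := env_slope_right s1.
have [p [P1 P2 P3]] := env_slope_left s2.
have qp := supports_mono Q1 P1 l12.
have := Kl p q; rewrite (ger0_norm (_ : 0 <= p - q)); last lra.
move=> /(le_trans (ler_norm _)) h.
have : K * (p - q) <= K * (w2 - w1) by apply: ler_wpM2l => //; lra.
lra.
Qed.

Lemma env_slope_mono a b w1 w2 l1 l2 : env_slope g dg a b w1 l1 ->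
  env_slope g dg a b w2 l2 -> w1 <= w2 -> l1 <= l2.
Proof.
move=> s1 s2 w12; have [//|l21] := leP l1 l2.
have [w12'|w12'] := eqVneq w1 w2.
  by have := env_slope_le s2 s1; rewrite w12' lexx => /(_ isT); lra.
have {w12'} w12 : w1 < w2 by rewrite lt_neqAle w12' w12.
have [p [P1 P2 _]] := env_slope_left s1.
have [q [Q1 Q2 _]] := env_slope_right s2.
have := supports_mono Q1 P1 l21; lra.
Qed.

Lemma env_slope_inj a b w l1 l2 : env_slope g dg a b w l1 ->
  env_slope g dg a b w l2 -> l1 = l2.
Proof.
by move=> s1 s2; apply/eqP; rewrite eq_le (env_slope_mono s1 s2)//
  (env_slope_mono s2 s1).
Qed.

Lemma exists_argmin l a b : a <= b -> exists2 p, a <= p <= b &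
  forall v, a <= v <= b -> g p - l * p <= g v - l * v.
Proof.
move=> ab.
have cf : {within `[a, b], continuous (fun v => g v - l * v)}.
  apply: continuous_subspaceT => x; apply: cvgB; first exact: flux_continuous.
  by apply: cvgM; [exact: cvg_cst|exact: cvg_id].
have [c + h] := EVT_min ab cf; rewrite in_itv => cab.
by exists c => // v vab; apply: h; rewrite in_itv.
Qed.

(** The slope is the critical one at which minimizers of [g - l id] cross [w]: the infimum of the
    slopes with a minimizer in [w, b]. There the minima over [a, w] and [w, b] coincide, so their
    minimizers bound a flat piece or are both [w]. *)
Lemma env_slope_exists_gt a b w : a < w <= b -> exists l, env_slope g dg a b w l.
Proof.
move=> /andP[aw wb]; have ab : a < b by exact: lt_le_trans wb.
pose T := [set th | exists2 q, w <= q <= b & supports g a b th q].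
have T1 : T 1.
  exists b; first by rewrite wb lexx.
  split; first by rewrite (ltW ab) lexx.
  move=> v /andP[av vb]; have := flux_lipschitz v b.
  rewrite (ger0_norm (_ : 0 <= b - v)); last lra.
  by move=> /(le_trans (ler_norm _)); lra.
have Tlb : lbound T (-1).
  move=> th [q /andP[wq qb] [_ h]].
  have := h a; rewrite lexx (ltW ab) => /(_ isT) {}h.
  have := flux_lipschitz a q; rewrite (ger0_norm (_ : 0 <= q - a)); last lra.
  rewrite distrC => /(le_trans (ler_norm _)) h'.
  have aq : 0 < q - a by lra.
  by rewrite -(ler_pM2r aq); lra.
have Tinf : has_inf T by split; [exists 1|exists (-1)].
pose l := inf T.
have lT th : T th -> l <= th by move=> Tth; apply: ge_inf => //; exists (-1).
have [q /andP[wq qb] qmin] := exists_argmin l wb.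
have [p /andP[ap pw] pmin] := exists_argmin l (ltW aw).
have pq : g q - l * q = g p - l * p.
  have [h|h|//] := ltgtP (g q - l * q) (g p - l * p).
  - (* all minimizers for slopes slightly below l lie right of w *)
    pose d := (g p - l * p - (g q - l * q)) / (b - a).
    have d0 : 0 < d by apply: divr_gt0; lra.
    have dE : d * (b - a) = g p - l * p - (g q - l * q).
      by rewrite divfK//; apply/eqP; lra.
    suff : T (l - d) by move=> /lT; lra.
    have [r /andP[wr rb] rmin] := exists_argmin (l - d) wb.
    exists r; first by rewrite wr.
    split; first by apply/andP; split; lra.
    move=> v /andP[av vb].
    have [wv|vw] := leP w v; first by have := rmin v; rewrite wv vb => /(_ isT); lra.
    have := rmin q; rewrite wq qb => /(_ isT).
    have := pmin v; rewrite av (ltW vw) => /(_ isT).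
    have : d * (q - v) <= d * (b - a) by rewrite ler_wpM2l//; lra.
    by lra.
  (* Here [p] beats all of [w, b] by a fixed amount, hence also for slopes slightly above [l]; but
     [T] has elements arbitrarily close to [l]. *)
  - pose d := (g q - l * q - (g p - l * p)) / (b - a).
    have d0 : 0 < d by apply: divr_gt0; lra.
    have dE : d * (b - a) = g q - l * q - (g p - l * p).
      by rewrite divfK//; apply/eqP; lra.
    have [th Tth thl] := inf_adherent d0 Tinf.
    have := lT _ Tth; move: Tth => [r /andP[wr rb] [_ rh]] lth.
    have := rh p; rewrite ap (le_trans pw wb) => /(_ isT).
    have := qmin r; rewrite wr rb => /(_ isT).
    rewrite -/l in thl.
    have : (th - l) * (r - p) <= (th - l) * (b - a) by rewrite ler_wpM2l//; lra.
    have : (th - l) * (b - a) < d * (b - a) by rewrite ltr_pM2r//; lra.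
    by lra.
have supp x : g x - l * x = g p - l * p -> a <= x <= b -> supports g a b l x.
  move=> xE xab; split => // v /andP[av vb].
  have [wv|vw] := leP w v; first by have := qmin v; rewrite wv vb => /(_ isT); lra.
  by have := pmin v; rewrite av (ltW vw) => /(_ isT); lra.
have sp : supports g a b l p by apply: supp => //; apply/andP; split; lra.
have sq : supports g a b l q by apply: supp => //; apply/andP; split; lra.
exists l; split; [lra|lra|].
have [pq'|qp] := ltP p q; first by right; exists p, q.
have wE : w = p by apply/eqP; rewrite eq_le; apply/andP; split; lra.
have {sq} sw : supports g a b l w by rewrite wE.
have [wb'|bw] := ltP w b.
  left; split => //; apply/eqP; rewrite eq_le (supports_dg_le sw)//=.
  exact: (supports_dg_ge sw).
have {bw wb} wb : w = b by apply/eqP; rewrite eq_le wb.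
(* At [w = b] the first-order condition gives only [dg b <= l]. If it is strict, either a second
   minimizer in [a, b - d] yields a flat piece ending at [b], or [b] remains a minimizer for some
   slope below [l], against the infimum. *)
have := supports_dg_le sw aw; rewrite le_eqVlt => /predU1P[|dl]; first by left.
right.
case: gK => _ _ Kl.
have K0 : 0 <= K.
  by have := Kl 1 0; rewrite subr0 normr1 mulr1; exact: le_trans.
pose d := Num.min (b - a) ((l - dg w) / (2 * (K + 1))).
have d0 : 0 < d by rewrite lt_min; apply/andP; split; [lra|apply: divr_gt0; lra].
have db : d <= b - a by rewrite ge_min lexx.
have dK : (2 * (K + 1)) * d <= l - dg w.
  by rewrite mulrC -ler_pdivlMr ?ge_min ?lexx ?orbT//; lra.
have abd : a <= b - d by lra.
have [r /andP[ar rb] rmin] := exists_argmin l abd.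
have [rE|rE] := leP (g r - l * r) (g b - l * b).
  exists r, b; split => //; [lra|lra|lra| |by move: sw; rewrite wb].
  apply: supp; last by apply/andP; split; lra.
  have := sw.2 r; rewrite wb ar => /(_ ltac:(lra)) => ?.
  rewrite -wE wb; apply/eqP; rewrite eq_le; apply/andP; split; lra.
exfalso.
(* The first entry handles [b - d, b] by the mean value theorem; the second spreads the gap
   available on [a, b - d] over the length b - a. *)
pose th := Num.max ((dg w + l) / 2) (l - (g r - l * r - (g b - l * b)) / (b - a)).
have ba : 0 < b - a by lra.
have thl : th < l.
  rewrite gt_max; apply/andP; split; first lra.
  by rewrite ltrBlDr ltrDl divr_gt0//; lra.
suff : T th by move=> /lT; lra.
exists b; first by rewrite wb lexx.
split; first by rewrite lexx (ltW ab).
move=> v /andP[av vb].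
have [vd|dv] := leP v (b - d).
  have := rmin v; rewrite av vd => /(_ isT) => h.
  have thE : l - (g r - l * r - (g b - l * b)) / (b - a) <= th.
    by rewrite le_max lexx orbT.
  have : (l - th) * (b - v) <= (g r - l * r - (g b - l * b)) / (b - a) * (b - a).
    apply: (@le_trans _ _ ((l - th) * (b - a))).
      by apply: ler_wpM2l; [rewrite subr_ge0 ltW|move: av; clear; lra].
    by apply: ler_wpM2r; [exact: ltW|move: thE; clear; lra].
  rewrite divfK ?gt_eqF//; lra.
have thE : (dg w + l) / 2 <= th by rewrite le_max lexx.
have [z /andP[z1 z2] zE] := flux_mvt vb.
have : `|dg z - dg w| <= K * d.
  apply: (le_trans (Kl _ _)); apply: ler_wpM2l => //.
  by rewrite wb ler0_norm ?subr_le0//; move: z1 dv; clear; lra.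
move=> /(le_trans (ler_norm _)) h.
have : dg z <= th by lra.
move=> /(ler_wpM2r (_ : 0 <= b - v)) => /(_ ltac:(lra)).
lra.
Qed.

End Flux.

End Envelope.

(** * Slopes as derivatives of the convex envelope *)

Section ConvexEnvelope.
Context {R : realType}.
Implicit Types (g dg : R -> R) (a b l w p q x y : R).

Lemma admissible_reflect K g dg : admissible_flux K g dg ->
  admissible_flux K (fun v => g (- v)) (fun v => - dg (- v)).
Proof.
case=> gd b1 Kl; split.
- move=> x.
  have := @is_derive1_comp _ g -%R x (dg (- x)) (-1) _ _.
  by rewrite mulrN1; apply.
- by move=> x; rewrite normrN.
- by move=> x y; rewrite -opprD normrN (le_trans (Kl _ _))// -opprD normrN.
Qed.

Lemma supports_reflect g a b l p : supports g a b l p ->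
  supports (fun v => g (- v)) (- b) (- a) (- l) (- p).
Proof.
move=> [/andP[ap pb] h]; split; first by apply/andP; split; lra.
move=> v /andP[bv va]; rewrite opprK.
by have := h (- v) ltac:(apply/andP; split; lra); lra.
Qed.

Lemma env_slope_reflect g dg a b w l : env_slope g dg a b w l ->
  env_slope (fun v => g (- v)) (fun v => - dg (- v)) (- b) (- a) (- w) (- l).
Proof.
move=> [aw wb h]; split; [lra|lra|].
case: h => [[s dgw]|[p [q [pq pw wq sp sq]]]].
  by left; rewrite opprK dgw; split => //; exact: supports_reflect.
right; exists (- q), (- p); split; [lra|lra|lra| |]; exact: supports_reflect.
Qed.

(** Only [w = a] is new; it is the right endpoint for the reflected flux. *)
Lemma env_slope_exists K g dg a b w : admissible_flux K g dg -> a < b ->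
  a <= w <= b -> exists l, env_slope g dg a b w l.
Proof.
move=> gK ab /andP[aw wb].
have [aw'|] := ltP a w; first by apply: (env_slope_exists_gt gK); rewrite aw'.
move=> wa; have {aw wa} -> : w = a by apply/eqP; rewrite eq_le wa.
have [|l /env_slope_reflect] :=
    env_slope_exists_gt (admissible_reflect gK) (a := - b) (b := - a) (w := - a).
  by apply/andP; split; lra.
rewrite !opprK => h; exists (- l).
have gE : (fun v => g (- - v)) = g by apply/funext => v; rewrite opprK.
have dE : (fun v => - - dg (- - v)) = dg by apply/funext => v; rewrite !opprK.
by rewrite gE dE in h.
Qed.

Lemma env_slope_norm K g dg a b w l : admissible_flux K g dg ->
  env_slope g dg a b w l -> `|l| <= 1.
Proof.
move=> gK [_ _ [[_ <-]|[p [q [pq _ _ sp sq]]]]]; first by case: gK.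
have h := supports_eq sp sq; have := flux_lipschitz gK p q.
by rewrite h normrM -[leRHS]mul1r ler_pM2r// normr_gt0 subr_eq0 gt_eqF.
Qed.

Lemma convex_affine (A : set R) (l c : R) :
  @convex_function R R^o A (fun v => c + l * v).
Proof.
move=> t x y _ _; rewrite !convRE; set s := t%:num.
have -> : (c + l * (s * x + (1 - s) * y)) =
  (s * (c + l * x) + (1 - s) * (c + l * y)) by ring.
by [].
Qed.

Lemma conv_env_ge g a b l p v : supports g a b l p -> a <= v <= b ->
  g p + l * (v - p) <= conv_env a b g v.
Proof.
move=> [pab h] vab; apply: ub_le_sup.
  exists (g v) => _ [k [_ kg] <-]; by apply: kg; rewrite inE /= in_itv.
exists (fun v => (g p - l * p) + l * v); last by ring.
split; first exact: convex_affine.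
move=> y; rewrite inE /= in_itv => /= yab; have := h _ yab; lra.
Qed.

Lemma conv_env_le_chord g a b p q w : a <= p -> p < q -> q <= b -> p <= w <= q ->
  (exists2 k, @convex_function R R^o `[a, b] k &
     {in `[a, b], forall y, k y <= g y}) ->
  (q - p) * conv_env a b g w <= (q - w) * g p + (w - p) * g q.
Proof.
move=> ap pq qb /andP[pw wq] [k0 k0c k0g].
rewrite mulrC -ler_pdivlMr; last lra.
apply: ge_sup; first by exists (k0 w), k0.
move=> _ [k [kc kg] <-].
have qp0 : 0 < q - p by lra.
have t0 : 0 <= (q - w) / (q - p) by apply: divr_ge0; lra.
have t1 : (q - w) / (q - p) <= 1 by rewrite ler_pdivrMr//; lra.
have t01 : (0 <= (q - w) / (q - p) <= 1) by rewrite t0.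
pose t : {i01 R} := Itv01 t0 t1.
have pin : p \in `[a, b] by rewrite inE /= in_itv/=; lra.
have qin : q \in `[a, b] by rewrite inE /= in_itv/=; lra.
have : k ((q - w) / (q - p) * p + (1 - (q - w) / (q - p)) * q) <=
  (q - w) / (q - p) * k p + (1 - (q - w) / (q - p)) * k q := kc t p q pin qin.
have -> : (q - w) / (q - p) * p + (1 - (q - w) / (q - p)) * q = w.
  by field; lra.
move=> /le_trans; apply.
have kp := kg p pin; have kq := kg q qin.
have -> : ((q - w) * g p + (w - p) * g q) / (q - p) =
  (q - w) / (q - p) * g p + (1 - (q - w) / (q - p)) * g q by field; lra.
by apply: lerD; apply: ler_wpM2l => //; lra.
Qed.

Lemma conv_env_le g a b w : a <= w <= b ->
  (exists2 k, @convex_function R R^o `[a, b] k &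
     {in `[a, b], forall y, k y <= g y}) ->
  conv_env a b g w <= g w.
Proof.
move=> wab [k0 k0c k0g]; apply: ge_sup; first by exists (k0 w), k0.
by move=> _ [k [kc kg] <-]; apply: kg; rewrite inE /= in_itv.
Qed.

Lemma supports_minorant g a b l p : supports g a b l p ->
  exists2 k, @convex_function R R^o `[a, b] k &
     {in `[a, b], forall y, k y <= g y}.
Proof.
move=> [pab h]; exists (fun v => (g p - l * p) + l * v).
  exact: convex_affine.
by move=> y; rewrite inE /= in_itv => /= yab; have := h _ yab; lra.
Qed.

(** Between two contact points of equal slope, the support line is a lower bound, the chord an upper
    bound, and they are the same line. *)
Lemma conv_envE g a b l p q w : supports g a b l p -> supports g a b l q ->
  p <= w <= q -> conv_env a b g w = g p + l * (w - p).
Proof.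
move=> sp sq /andP[pw wq].
have [/andP[ap pb] _] := sp; have [/andP[aq qb] _] := sq.
apply/eqP; rewrite eq_le (conv_env_ge sp) ?andbT; last by apply/andP; split; lra.
have mg := supports_minorant sp.
have [pq|qp] := ltP p q; last first.
  have -> : w = p by apply/eqP; rewrite eq_le; apply/andP; split; lra.
  by rewrite subrr mulr0 addr0 conv_env_le// ap pb.
have := @conv_env_le_chord g a b p q w ap pq qb ltac:(apply/andP; split; lra) mg.
have qE := supports_eq sp sq.
have -> : (q - w) * g p + (w - p) * g q = (q - p) * (g p + l * (w - p)).
  have -> : g q = g p + l * (q - p) by lra.
  by ring.
by rewrite ler_pM2l//; lra.
Qed.

Lemma env_slope_supports g dg a b w l : env_slope g dg a b w l ->
  exists p q, [/\ p <= w, w <= q, supports g a b l p & supports g a b l q].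
Proof.
move=> [_ _ [[s _]|[p [q [pq pw wq sp sq]]]]]; first by exists w, w.
by exists p, q.
Qed.

Lemma conv_env_subgradient g dg a b w l v : env_slope g dg a b w l ->
  a <= v <= b -> conv_env a b g w + l * (v - w) <= conv_env a b g v.
Proof.
move=> /env_slope_supports[p [q [pw wq sp sq]]] vab.
rewrite (conv_envE sp sq) ?pw//.
by have := conv_env_ge sp vab; lra.
Qed.

Lemma within_deriv_proper a b w : a < b -> a <= w <= b ->
  ProperFilter (within `[a, b] (w^')).
Proof.
move=> ab /andP[aw wb]; split; last exact: within_filter.
rewrite /within /= /dnbhs /within/= => /nbhs_ballP[e /= e0 he].
pose d := Num.min (e / 2) ((b - a) / 2).
have d0 : 0 < d by rewrite lt_min; apply/andP; split; [exact: divr_gt0|apply: divr_gt0; lra].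
have de : d <= e / 2 by rewrite ge_min lexx.
have db : d <= (b - a) / 2 by rewrite ge_min lexx orbT.
have [wm|wm] := leP w ((a + b) / 2).
- apply: (he (w + d)); rewrite /ball/= ?in_itv/=.
  + by rewrite opprD addNKr normrN gtr0_norm//; lra.
  + by apply/eqP; lra.
  + by apply/andP; split; lra.
- apply: (he (w - d)); rewrite /ball/= ?in_itv/=.
  + by rewrite opprB addrC subrK gtr0_norm//; lra.
  + by apply/eqP; lra.
  + by apply/andP; split; lra.
Qed.

Lemma derive_itvE (K : R) (h : R -> R) a b w l : a < b -> a <= w <= b ->
  (forall y, a <= y <= b -> `|h y - h w - l * (y - w)| <= K * `|y - w| * `|y - w|) ->
  derive_itv a b h w = l.
Proof.
move=> ab wab hK; apply: cvg_lim => //; first exact: within_deriv_proper.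
have K1 : 0 < `|K| + 1 by rewrite ltr_wpDl.
apply/cvgrPdist_le => /= e e0; rewrite near_withinE /dnbhs near_withinE.
near=> y => yw; rewrite /= in_itv/= => yab.
have yw0 : 0 < `|y - w| by rewrite normr_gt0 subr_eq0.
have -> : l - (h y - h w) / (y - w) = - ((h y - h w - l * (y - w)) / (y - w)).
  by field; rewrite subr_eq0.
rewrite normrN normrM normfV ler_pdivrMr//.
apply: (le_trans (hK _ yab)); rewrite ler_pM2r//.
apply: (@le_trans _ _ ((`|K| + 1) * `|y - w|)).
  by rewrite ler_pM2r//; have := ler_norm K; lra.
rewrite mulrC -ler_pdivlMr// distrC ltW//.
near: y; have e1 : 0 < e / (`|K| + 1) by apply: divr_gt0.
by apply/nbhs_ballP; exists (e / (`|K| + 1)).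
Unshelve. all: end_near. Qed.

Section Slope.
Variables (K : R) (g dg : R -> R).
Hypothesis gK : admissible_flux K g dg.

Definition hull_slope a b w := derive_itv a b (conv_env a b g) w.

(** The subgradient inequalities at [w] and at [y] enclose the increment, and the two slopes differ
    by at most [K] times the distance. *)
Lemma conv_env_taylor a b w y l : env_slope g dg a b w l -> a <= y <= b -> a < b ->
  `|conv_env a b g y - conv_env a b g w - l * (y - w)| <= K * `|y - w| * `|y - w|.
Proof.
move=> sw yab ab; have [aw wb _] := sw.
have wab : a <= w <= b by rewrite aw.
have [ly sy] := env_slope_exists gK ab yab.
have h1 := conv_env_subgradient sw yab.
have h2 := conv_env_subgradient sy wab.
rewrite ger0_norm; last lra.
have [wy|yw] := leP w y.
  have := env_slope_le gK sw sy wy; rewrite ger0_norm; last lra.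
  move=> /(ler_wpM2r (_ : 0 <= y - w)) => /(_ ltac:(lra)); lra.
have := env_slope_le gK sy sw (ltW yw); rewrite ler0_norm; last lra.
move=> /(ler_wpM2r (_ : 0 <= w - y)) => /(_ ltac:(lra)); lra.
Qed.

(** The bridge from the derivative that defines the speed to contact points, the form in which
    slopes are compared. *)
Lemma hull_slopeP a b w : a < b -> a <= w <= b ->
  env_slope g dg a b w (hull_slope a b w).
Proof.
move=> ab wab; have [l sl] := env_slope_exists gK ab wab.
rewrite /hull_slope (@derive_itvE K _ _ _ _ l)// => y yab.
exact: conv_env_taylor sl yab ab.
Qed.

Lemma hull_slope_unique a b w l : a < b -> env_slope g dg a b w l ->
  hull_slope a b w = l.
Proof.
move=> ab sl; have [aw wb _] := sl.
by apply: (env_slope_inj gK _ sl); apply: hull_slopeP => //; rewrite aw.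
Qed.

(* largest minimizer of g - th on [a, b] *)
Definition splits a b th q := supports g a b th q /\
  forall v, q < v <= b -> th * (v - q) < g v - g q.

(** The rule that moves the waves agrees with the sampling: the waves that stay are those with a
    state up to the cut. Maximality of [q] gives one direction, the first-order conditions at [q]
    the other. At [w = a = q] the slope may exceed [th], hence [a < w]. *)
Lemma hull_slope_split a b th q w : a < b -> splits a b th q -> a < w <= b ->
  (hull_slope a b w <= th) = (w <= q).
Proof.
move=> ab [sq qmax] /andP[aw wb].
have sw := @hull_slopeP a b w ab ltac:(rewrite wb ltW//).
have [[/andP[aq qb] hq]] := sq.
move: (hull_slope a b w) sw => l sw.
apply/idP/idP => [lth|wq].
- rewrite leNgt; apply/negP => qw.
  have [p [r [pw wr sp sr]]] := env_slope_supports sw.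
  have := qmax r ltac:(apply/andP; split; [lra|by case: sr => /andP[]]).
  have := supports_eq sq.
  have := sr.2 q ltac:(by apply/andP).
  have : l * (r - q) <= th * (r - q) by rewrite ler_wpM2r//; lra.
  lra.
- rewrite leNgt; apply/negP => thl.
  case: sw => [_ _ [[ss dgw]|[p [r [pr pw wr sp sr]]]]].
    have qw := supports_mono sq ss thl.
    have wE : w = q by apply/eqP; rewrite eq_le wq qw.
    rewrite wE in aw dgw ; have := supports_dg_le gK sq aw; lra.
  have qp := supports_mono sq sp thl.
  have pq : p = q by apply/eqP; rewrite eq_le; apply/andP; split; lra.
  rewrite pq in sp pr; have := supports_dg_le gK sq ltac:(lra).
  have := supports_dg_ge gK sp (lt_le_trans pr (andP sr.1).2); lra.
Qed.

End Slope.

End ConvexEnvelope.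

(** * Change of slopes and the gap between a flux and its hull *)

Section HullIntegral.
Context {R : realType}.
Variables (K : R) (g dg : R -> R).
Hypothesis gK : admissible_flux K g dg.
Implicit Types (a b l w p q x y : R).
Local Notation mu := (@lebesgue_measure R).

Lemma supports_sub a b a' b' l p : supports g a b l p -> a <= a' -> b' <= b ->
  a' <= p <= b' -> supports g a' b' l p.
Proof.
move=> [_ h] aa bb pab; split => // v /andP[av vb].
by apply: h; apply/andP; split; lra.
Qed.

(** Beyond the cut the slope exceeds [th], so its contact points lie right of [q] and remain contact
    points on [q, b]. *)
Lemma hull_slope_split_right a b th q w : splits g a b th q -> q < w <= b ->
  hull_slope g q b w = hull_slope g a b w.
Proof.
move=> sq /andP[qw wb].
have [/andP[aq qb] _] := sq.1.
have ab : a < b by lra.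
have wab : a < w <= b by apply/andP; split; lra.
have wab' : a <= w <= b by apply/andP; split; lra.
have thl : th < hull_slope g a b w.
  by rewrite ltNge (hull_slope_split gK ab sq wab) -ltNge.
apply: (hull_slope_unique gK); first lra.
case: (hull_slopeP gK ab wab'); move: (hull_slope g a b w) thl => l thl aw _ h.
split => //; first lra.
have res p : supports g a b l p -> supports g q b l p.
  move=> sp; apply: (supports_sub sp) => //.
  by rewrite (supports_mono sq.1 sp thl) /=; case: sp => /andP[].
case: h => [[s E]|[p [r [pr pw wr sp sr]]]]; [left|right].
  by split => //; exact: res.
by exists p, r; split => //; exact: res.
Qed.

Lemma hull_slope_split_left a b th q w : splits g a b th q -> a < w <= q ->
  hull_slope g a q w = hull_slope g a b w.
Proof.
move=> sq /andP[aw wq].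
have [/andP[aq qb] _] := sq.1.
have ab : a < b by lra.
have wab : a < w <= b by apply/andP; split; lra.
have wab' : a <= w <= b by apply/andP; split; lra.
have lth : hull_slope g a b w <= th.
  by rewrite (hull_slope_split gK ab sq wab).
apply: (hull_slope_unique gK); first lra.
case: (hull_slopeP gK ab wab'); move: (hull_slope g a b w) lth => l lth _ _ h.
split => //; first lra.
have res p : supports g a b l p -> supports g a q l p.
  move=> sp; apply: (supports_sub sp) => //.
  have [/andP[-> pb] _] /= := sp.
  (* For the slope [th] itself, monotonicity of contact points says nothing; there [q] is the
     largest minimizer. *)
  move: lth; rewrite le_eqVlt => /predU1P[lth|lth].
    rewrite leNgt; apply/negP => qp.
    have := sq.2 p ltac:(by rewrite qp); rewrite -lth => h'.
    by have := sp.2 q ltac:(apply/andP; split; lra); lra.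
  exact: supports_mono sp sq.1 lth.
case: h => [[s E]|[p [r [pr pw wr sp sr]]]]; [left|right].
  by split => //; exact: res.
by exists p, r; split => //; exact: res.
Qed.

(** Were the slope on [a, B] larger, a contact point of each hull would be [w] itself, where the
    first-order conditions order the slopes the other way. *)
Lemma hull_slope_extend_right a b B w : a < b -> b <= B -> a <= w <= b ->
  hull_slope g a B w <= hull_slope g a b w.
Proof.
move=> ab bB /andP[aw wb].
have s2 := hull_slopeP gK ab (introT andP (conj aw wb)).
have s1 := @hull_slopeP _ _ _ _ gK a B w ltac:(lra) ltac:(apply/andP; split; lra).
rewrite leNgt; apply/negP => l21.
have [p [P1 P2 P3]] := env_slope_left gK s1.
have [q [Q1 Q2 Q3]] := env_slope_right gK s2.
have [/andP[ap _] _] := P1; have [/andP[_ qb] _] := Q1.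
have P1' := @supports_sub _ _ a b _ _ P1 (lexx _) bB
  (introT andP (conj ap (le_trans P2 wb))).
have qp := supports_mono Q1 P1' l21.
have pE : p = w by apply/eqP; rewrite eq_le P2 (le_trans Q2 qp).
have qE : q = w by apply/eqP; rewrite eq_le Q2 (le_trans qp P2).
by move: P3 Q3 l21; rewrite pE qE; clear; lra.
Qed.

Lemma hull_slope_extend_left A a b w : a < b -> A <= a -> a <= w <= b ->
  hull_slope g a b w <= hull_slope g A b w.
Proof.
move=> ab Aa /andP[aw wb].
have s1 := hull_slopeP gK ab (introT andP (conj aw wb)).
have s2 := @hull_slopeP _ _ _ _ gK A b w ltac:(lra) ltac:(apply/andP; split; lra).
rewrite leNgt; apply/negP => l21.
have [p [P1 P2 P3]] := env_slope_left gK s1.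
have [q [Q1 Q2 Q3]] := env_slope_right gK s2.
have [/andP[ap _] _] := P1; have [/andP[_ qb] _] := Q1.
have Q1' := @supports_sub _ _ a b _ _ Q1 Aa (lexx _)
  (introT andP (conj (le_trans aw Q2) qb)).
have qp := supports_mono Q1' P1 l21.
have pE : p = w by apply/eqP; rewrite eq_le P2 (le_trans Q2 qp).
have qE : q = w by apply/eqP; rewrite eq_le Q2 (le_trans qp P2).
by move: P3 Q3 l21; rewrite pE qE; clear; lra.
Qed.

Lemma flux_const_ge0 : 0 <= K.
Proof.
case: gK => _ _ Kl; have := Kl 1 0; rewrite subr0 normr1 mulr1.
exact: le_trans.
Qed.

Lemma hull_slope_lipschitz a b x y : a < b -> a <= x <= b -> a <= y <= b ->
  `|hull_slope g a b x - hull_slope g a b y| <= K * `|x - y|.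
Proof.
move=> ab xab yab.
wlog xy : x y xab yab / x <= y.
  move=> H; have [/H|/ltW/H] := leP x y; first exact.
  by rewrite distrC (distrC x); exact.
have sx := hull_slopeP gK ab xab; have sy := hull_slopeP gK ab yab.
have := env_slope_le gK sx sy xy; have := env_slope_mono gK sx sy xy.
by move=> h1 h2; rewrite !ler0_norm ?subr_le0//; move: h1 h2; clear; lra.
Qed.

Lemma hull_slope_within a b : a < b ->
  {within `[a, b], continuous (hull_slope g a b)}.
Proof.
move=> ab; apply/subspace_continuousP => x /=; rewrite in_itv/= => xab.
apply/cvgrPdist_le => /= e e0; rewrite near_withinE.
have K1 : 0 < K + 1 by rewrite ltr_wpDl// flux_const_ge0.
have eK : 0 < e / (K + 1) by exact: divr_gt0.
near=> y => /=; rewrite in_itv/= => yab.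
apply: (le_trans (hull_slope_lipschitz ab xab yab)).
apply: (@le_trans _ _ ((K + 1) * `|x - y|)); first by rewrite ler_wpM2r// lerDl.
rewrite mulrC -ler_pdivlMr// ltW//.
Unshelve. all: end_near. Qed.

Lemma conv_env_endl a b : a < b -> conv_env a b g a = g a.
Proof.
move=> ab; have := @hull_slopeP _ _ _ _ gK a b a ab.
rewrite lexx ltW// => /(_ isT) s.
have [p [P1 P2 _]] := env_slope_left gK s.
have pE : p = a by apply/eqP; rewrite eq_le P2; case: P1 => /andP[].
rewrite pE in P1; rewrite (conv_envE P1 P1) ?lexx//; ring.
Qed.

Lemma conv_env_endr a b : a < b -> conv_env a b g b = g b.
Proof.
move=> ab; have := @hull_slopeP _ _ _ _ gK a b b ab.
rewrite lexx ltW// => /(_ isT) s.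
have [p [P1 P2 _]] := env_slope_right gK s.
have pE : p = b by apply/eqP; rewrite eq_le P2; case: P1 => /andP[_ ->].
rewrite pE in P1; rewrite (conv_envE P1 P1) ?lexx//; ring.
Qed.

Lemma conv_env_lipschitz a b x y : a < b -> a <= x <= b -> a <= y <= b ->
  `|conv_env a b g x - conv_env a b g y| <= `|x - y|.
Proof.
move=> ab xab yab.
have sx := hull_slopeP gK ab xab; have sy := hull_slopeP gK ab yab.
have h1 := conv_env_subgradient sx yab.
have h2 := conv_env_subgradient sy xab.
have := env_slope_norm gK sx; have := env_slope_norm gK sy.
rewrite !ler_norml => /andP[b1 b2] /andP[b3 b4].
have [xy|xy] := leP x y.
  rewrite (ler0_norm (_ : x - y <= 0)) ?subr_le0//.
  have := ler_wpM2r (_ : 0 <= y - x) b2; have := ler_wpM2r (_ : 0 <= y - x) b3.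
  move=> /(_ ltac:(by rewrite subr_ge0)) p3 /(_ ltac:(by rewrite subr_ge0)) p2.
  by apply/andP; split; [move: h2 p2|move: h1 p3]; clear; lra.
rewrite (ger0_norm (_ : 0 <= x - y)) ?subr_ge0 ?(ltW xy)//.
have := ler_wpM2r (_ : 0 <= x - y) b4; have := ler_wpM2r (_ : 0 <= x - y) b1.
move=> /(_ ltac:(by rewrite subr_ge0 ltW)) p1 /(_ ltac:(by rewrite subr_ge0 ltW)) p4.
by apply/andP; split; [move: h2 p1|move: h1 p4]; clear; lra.
Qed.

Lemma conv_env_is_derive a b x : a < x < b ->
  is_derive x 1 (conv_env a b g) (hull_slope g a b x).
Proof.
move=> /andP[ax xb]; have ab := lt_trans ax xb.
have xab : a <= x <= b by rewrite !ltW.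
have sx := hull_slopeP gK ab xab.
have [xa bx] : 0 < x - a /\ 0 < b - x by rewrite !subr_gt0.
apply: (@is_derive_quadratic _ _ _ _ K (Num.min (x - a) (b - x))) => [|h].
  by rewrite lt_min xa.
rewrite lt_min !ltr_norml => /andP[/andP[p1 _] /andP[_ p4]].
have hab : a <= x + h <= b.
  by apply/andP; split; [move: p1|move: p4]; clear; lra.
have := conv_env_taylor gK sx hab ab.
by rewrite (_ : x + h - x = h) ?(addrC x) ?addrK// -mulrA -normrM (ger0_norm (sqr_ge0 h)).
Qed.

Lemma conv_env_within a b : a < b -> {within `[a, b], continuous (conv_env a b g)}.
Proof.
move=> ab; apply/subspace_continuousP => x /=; rewrite in_itv/= => xab.
apply/cvgrPdist_le => /= e e0; rewrite near_withinE.
near=> y => /=; rewrite in_itv/= => yab.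
apply: (le_trans (conv_env_lipschitz ab xab yab)); rewrite ltW//.
Unshelve. all: end_near. Qed.

Lemma measurable_hull_slope a b : a < b ->
  measurable_fun `[a, b] (hull_slope g a b).
Proof.
move=> ab; apply/measurable_EFinP; apply: (measurable_int mu).
apply: continuous_compact_integrable; first exact: segment_compact.
exact: hull_slope_within.
Qed.

Lemma integral_hull_slope a b x y : a <= x -> x < y -> y <= b ->
  (\int[mu]_(w in `]x, y]) (hull_slope g a b w)%:E =
   (conv_env a b g y - conv_env a b g x)%:E)%E.
Proof.
move=> ax xy yb; have ab : a < b by lra.
have sub : `[x, y] `<=` `[a, b].
  by move=> z /=; rewrite !in_itv/= => /andP[? ?]; apply/andP; split; lra.
rewrite integral_itv_obnd_cbnd; last first.
  apply/measurable_EFinP; apply: measurable_funS (measurable_hull_slope ab) => //.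
  by apply: subset_trans sub; exact: subset_itv_oc_cc.
rewrite (@continuous_FTC2 _ _ (conv_env a b g))//.
- exact: continuous_subspaceW sub (hull_slope_within ab).
- have := continuous_subspaceW sub (conv_env_within ab).
  move=> /(continuous_within_itvP _ xy)[_ h1 h2]; split => //.
  move=> z; rewrite in_itv/= => /andP[? ?].
  by have [] := @conv_env_is_derive a b z ltac:(apply/andP; split; lra).
- move=> z; rewrite in_itv/= => /andP[? ?].
  have [d1 d2] := @conv_env_is_derive a b z ltac:(apply/andP; split; lra).
  by rewrite derive1E.
Qed.

Lemma integrable_hull_slope a b x y : a <= x -> x < y -> y <= b ->
  mu.-integrable `]x, y] (EFin \o hull_slope g a b).
Proof.
move=> ax xy yb; have ab : a < b by lra.
apply: (@integrableS _ _ _ mu `[a, b]) => //.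
  by move=> z /=; rewrite !in_itv/= => /andP[? ?]; apply/andP; split; lra.
apply: continuous_compact_integrable; first exact: segment_compact.
exact: (hull_slope_within).
Qed.

Lemma integral_hull_slopeB a b a' b' x y : a <= x -> y <= b -> a' <= x ->
  y <= b' -> x < y ->
  (forall w, x < w <= y -> hull_slope g a b w <= hull_slope g a' b' w) ->
  (\int[mu]_(w in `]x, y]) (`|hull_slope g a b w - hull_slope g a' b' w|)%:E =
   ((conv_env a' b' g y - conv_env a' b' g x)
    - (conv_env a b g y - conv_env a b g x))%:E)%E.
Proof.
move=> ax yb ax' yb' xy le.
have i1 := integrable_hull_slope ax xy yb.
have i2 := integrable_hull_slope ax' xy yb'.
rewrite EFinB -(integral_hull_slope ax xy yb) -(integral_hull_slope ax' xy yb').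
rewrite -integralB_EFin//; apply: eq_integral => w.
rewrite inE/= in_itv/= => /le lew.
by rewrite -EFinB distrC ger0_norm// subr_ge0.
Qed.

(** The difference of slopes has a constant sign, so its integral telescopes. Both hulls touch [g]
    at [a], the smaller one also at [b]: only the gap at [b] remains. *)
Lemma integral_hull_extend_right a b B : a < b -> b <= B ->
  (\int[mu]_(w in `]a, b]) (`|hull_slope g a B w - hull_slope g a b w|)%:E =
   (g b - conv_env a B g b)%:E)%E.
Proof.
move=> ab bB; rewrite integral_hull_slopeB//; last first.
  move=> w /andP[aw wb]; apply: (hull_slope_extend_right) => //.
  by rewrite (ltW aw).
rewrite !(conv_env_endr, conv_env_endl)//; last lra.
by congr EFin; ring.
Qed.

Lemma integral_hull_extend_left A a b : a < b -> A <= a ->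
  (\int[mu]_(w in `]a, b]) (`|hull_slope g a b w - hull_slope g A b w|)%:E =
   (g a - conv_env A b g a)%:E)%E.
Proof.
move=> ab Aa; rewrite integral_hull_slopeB//; last first.
  move=> w /andP[aw wb]; apply: (hull_slope_extend_left) => //.
  by rewrite (ltW aw).
rewrite !(conv_env_endr, conv_env_endl)//; last lra.
by congr EFin; ring.
Qed.

(** [p] and [q] are the ends of the flat piece through [x], on which the hull is a chord. The
    identity is void when [p = q], whence the last clause. *)
Lemma chord_gap a b x : a < b -> a <= x <= b ->
  exists p q, [/\ a <= p, p <= x, x <= q, q <= b &
    (q - p) * (g x - conv_env a b g x) =
      (q - x) * (g x - g p) - (x - p) * (g q - g x) /\
    (p = q -> g x = conv_env a b g x)].
Proof.
move=> ab xab; have s := hull_slopeP gK ab xab.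
have [p [q [px xq sp sq]]] := env_slope_supports s.
exists p, q; split => //; [by case: sp => /andP[]|by case: sq => /andP[]|].
have qE := supports_eq sp sq.
rewrite (conv_envE sp sq) ?px//; split.
  move: (hull_slope g a b x) qE => l qE.
  have -> : g q = g p + l * (q - p) by rewrite -qE; ring.
  by ring.
move=> pq; have -> : x = p by apply/eqP; rewrite eq_le; apply/andP; split; lra.
by ring.
Qed.

(** By the mean value theorem the right-hand side in [chord_gap] is (x - p)(q - x) times a
    difference of derivatives, at most K (q - p); the factor q - p cancels. *)
Lemma conv_env_gap_le a b x : a < b -> a <= x <= b ->
  g x - conv_env a b g x <= K * ((x - a) * (b - x)).
Proof.
move=> ab /andP[ax xb]; have [p [q [ap px xq qb [E E0]]]] := @chord_gap a b x ab
  ltac:(by rewrite ax).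
have K0 := flux_const_ge0.
have [pq|qp] := ltP p q; last first.
  rewrite -E0 ?subrr; last lra.
  by rewrite !mulr_ge0//; lra.
have [z1 /andP[? ?] h1] := flux_mvt gK px.
have [z2 /andP[? ?] h2] := flux_mvt gK xq.
have [_ _ Kl] := gK.
have Kz : dg z1 - dg z2 <= K * (q - p).
  apply: (le_trans (ler_norm _)); apply: (le_trans (Kl _ _)).
  by rewrite ler_wpM2l// ler0_norm; lra.
apply: (@le_trans _ _ (K * ((x - p) * (q - x)))); last first.
  by rewrite ler_wpM2l// ler_pM//; lra.
have qp0 : 0 < q - p by lra.
rewrite -(ler_pM2l qp0) E h1 h2.
have -> : (q - x) * (dg z1 * (x - p)) - (x - p) * (dg z2 * (q - x)) =
  ((x - p) * (q - x)) * (dg z1 - dg z2) by ring.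
have -> : (q - p) * (K * ((x - p) * (q - x))) =
  ((x - p) * (q - x)) * (K * (q - p)) by ring.
by rewrite ler_wpM2l// mulr_ge0//; lra.
Qed.

(* Split [p, x] at a2 and [x, q] at c2: in (q - p) * gap, an average of
   g'(v) - g'(v') over [p, x] * [x, q], the block [a2, x] * [x, c2]
   contributes nothing positive, because of the separating slope c. *)
Lemma conv_env_gap_memory a b x : a < b -> a <= x <= b ->
  exists p q, [/\ a <= p <= x, x <= q <= b & forall a2 c2 c,
    p <= a2 <= x -> x <= c2 <= q ->
    g x - g a2 <= c * (x - a2) -> c * (c2 - x) <= g c2 - g x ->
    g x - conv_env a b g x <=
      K * ((a2 - p) * (q - x) + (x - a2) * (q - c2))].
Proof.
move=> ab xab; have [p [q [ap px xq qb [E E0]]]] := chord_gap ab xab.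
exists p, q; split; [by rewrite ap|by rewrite xq|].
move=> a2 c2 c /andP[pa2 a2x] /andP[xc2 c2q] ha hc.
have K0 := flux_const_ge0.
have [pq|qp] := ltP p q; last first.
  rewrite -E0 ?subrr; last lra.
  by rewrite mulr_ge0// addr_ge0// mulr_ge0//; lra.
have [_ _ Kl] := gK.
have Kz z z' : p <= z <= q -> p <= z' <= q -> dg z - dg z' <= K * (q - p).
  move=> /andP[? ?] /andP[? ?].
  apply: (le_trans (ler_norm _)); apply: (le_trans (Kl _ _)).
  by rewrite ler_wpM2l// ler_norml; apply/andP; split; lra.
have [z1 z1i h1] := flux_mvt gK pa2.
have [z2 z2i h2] := flux_mvt gK a2x.
have [z3 z3i h3] := flux_mvt gK c2q.
have [z4 z4i h4] := flux_mvt gK xc2.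
have {z1i} z1i : p <= z1 <= q by move/andP: z1i => [h5 h6]; rewrite h5 (le_trans h6) ?(le_trans a2x).
have {z2i} z2i : p <= z2 <= q by move/andP: z2i => [h5 h6]; rewrite (le_trans pa2) ?(le_trans h6).
have {z3i} z3i : p <= z3 <= q by move/andP: z3i => [h5 h6]; rewrite (le_trans (le_trans px xc2)) ?h6.
have {z4i} z4i : p <= z4 <= q by move/andP: z4i => [h5 h6]; rewrite (le_trans px) ?(le_trans h6).
have qp0 : 0 < q - p by lra.
rewrite -(ler_pM2l qp0) E.
have -> : g x - g p = (g a2 - g p) + (g x - g a2) by ring.
have -> : g q - g x = (g q - g c2) + (g c2 - g x) by ring.
have b22 : (c2 - x) * (g x - g a2) - (x - a2) * (g c2 - g x) <= 0.
  have := ler_wpM2l (_ : 0 <= c2 - x) ha; have := ler_wpM2l (_ : 0 <= x - a2) hc.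
  by rewrite !subr_ge0 => /(_ a2x) + /(_ xc2); clear; lra.
have [x1 x2] : 0 <= a2 - p /\ 0 <= x - a2 by rewrite !subr_ge0.
have [y1 y2] : 0 <= q - c2 /\ 0 <= c2 - x by rewrite !subr_ge0.
(* The other three blocks are bounded by their areas: (a2 - p)(q - c2), (a2 - p)(c2 - x) and (x -
   a2)(q - c2) add up to the claimed expression. *)
have b11 := ler_wpM2l (mulr_ge0 x1 y1) (Kz z1 z3 z1i z3i).
have b12 := ler_wpM2l (mulr_ge0 x1 y2) (Kz z1 z4 z1i z4i).
have b21 := ler_wpM2l (mulr_ge0 x2 y1) (Kz z2 z3 z2i z3i).
move: b22; rewrite h1 h2 h3 h4 => b22.
move: (dg z1) (dg z2) (dg z3) (dg z4) b11 b12 b21 b22 => d1 d2 d3 d4.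
by clear; move=> b11 b12 b21 b22; lra.
Qed.

End HullIntegral.

(** * Entropy inequality in a cone *)

Section BoxSupport.
Context {R : realType}.

Lemma continuous_section1 (psi : R * R -> R) (x : R) : continuous psi ->
  continuous (fun t => psi (t, x)).
Proof.
move=> c t; apply: (@cvg_comp _ _ _ (fun s : R => (s, x)) psi _ _ _ _ (c (t, x))).
exact: (@cvg_pair _ _ _ (nbhs t) (nbhs t) (nbhs x) _ _ _ _ _ cvg_id (cvg_cst _)).
Qed.

Lemma continuous_section2 (psi : R * R -> R) (t : R) : continuous psi ->
  continuous (fun x => psi (t, x)).
Proof.
move=> c x; apply: (@cvg_comp _ _ _ (fun s : R => (t, s)) psi _ _ _ _ (c (t, x))).
exact: (@cvg_pair _ _ _ (nbhs x) (nbhs t) (nbhs x) _ _ _ _ _ (cvg_cst _) cvg_id).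
Qed.

Local Notation mu := (@lebesgue_measure R).
Local Notation mu2 := (mu \x mu)%E.

Definition box (A : R) : set (R * R) := `[- A, A] `*` `[- A, A].

Lemma boxE A t x : box A (t, x) <-> - A <= t <= A /\ - A <= x <= A.
Proof. by rewrite /box /= !in_itv. Qed.

Lemma measurable_box A : measurable (box A).
Proof. exact: measurableX. Qed.

Lemma mu2_box A : (mu2 (box A) < +oo)%E.
Proof.
rewrite product_measure1E//= lebesgue_measure_itv /=.
by case: ifP => _; rewrite ?mule0// -EFinB -EFinM ltry.
Qed.

Definition box_bounded (h : R * R -> R) := measurable_fun setT h /\
  exists C A : R, forall p, `|h p| <= C /\ (~ box A p -> h p = 0).

Lemma box_bounded_integrable h : box_bounded h ->
  mu2.-integrable setT (EFin \o h).
Proof.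
move=> [mh [C [A hA]]].
have hE : h = h \_ (box A).
  apply/funext => p; rewrite patchE; case: ifPn => // /negP pA.
  by have [_] := hA p; apply; move=> /mem_set.
rewrite hE -restrict_EFin; apply/integrable_restrict => //; first exact: measurable_box.
rewrite setTI; apply: measurable_bounded_integrable.
- exact: measurable_box.
- exact: mu2_box.
- exact: measurable_funS mh.
- exists C; split; first exact: num_real.
  by move=> x Cx p _ /=; have [+ _] := hA p; move=> /le_trans; apply; exact: ltW.
Qed.

Lemma box_boundedD h1 h2 : box_bounded h1 -> box_bounded h2 ->
  box_bounded (fun p => h1 p + h2 p).
Proof.
move=> [m1 [C1 [A1 b1]]] [m2 [C2 [A2 b2]]]; split; first exact: measurable_funD.
exists (C1 + C2), (Num.max A1 A2) => p; split.
  by rewrite (le_trans (ler_normD _ _))// lerD//; [have [] := b1 p|have [] := b2 p].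
have sub B : B <= Num.max A1 A2 -> ~ box (Num.max A1 A2) p -> ~ box B p.
  move=> BA; apply: contra_not; case: p => t x /boxE [/andP[? ?] /andP[? ?]].
  by apply/boxE; split; apply/andP; split; lra.
move=> np; rewrite (b1 p).2 ?(b2 p).2 ?addr0//; apply: sub np;
  by rewrite le_max lexx ?orbT.
Qed.

Lemma box_boundedM (h1 h2 : R * R -> R) C : measurable_fun setT h1 -> (forall p, `|h1 p| <= C) ->
  box_bounded h2 -> box_bounded (fun p => h1 p * h2 p).
Proof.
move=> m1 b1 [m2 [C2 [A2 b2]]]; split; first exact: measurable_funM.
exists (C * C2), A2 => p; split.
  by rewrite normrM ler_pM//; have [] := b2 p.
by move=> /(b2 p).2 ->; rewrite mulr0.
Qed.

Definition integral2 (h : R * R -> R) : \bar R := (\int[mu2]_p (h p)%:E)%E.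

Lemma integral2D h1 h2 : box_bounded h1 -> box_bounded h2 ->
  integral2 (fun p => h1 p + h2 p) = (integral2 h1 + integral2 h2)%E.
Proof.
move=> /box_bounded_integrable i1 /box_bounded_integrable i2.
rewrite /integral2 -integralD_EFin//.
Qed.

Lemma integral2Z c h : box_bounded h ->
  integral2 (fun p => c * h p) = (c%:E * integral2 h)%E.
Proof.
by move=> /box_bounded_integrable i1; rewrite /integral2 -integralZl.
Qed.

Lemma integral_deriv0 (F F' : R -> R) (A : R) : 0 <= A ->
  (forall x : R, is_derive x 1 F (F' x)) -> continuous F' ->
  (forall x : R, ~ (- A <= x <= A) -> F x = 0 /\ F' x = 0) ->
  (\int[mu]_x (F' x)%:E = 0)%E.
Proof.
move=> A0 dF cF' F0.
have AA : - (A + 1) < A + 1 by lra.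
have -> : (\int[mu]_x (F' x)%:E = \int[mu]_(x in `[(- (A + 1))%R, (A + 1)%R]) (F' x)%:E)%E.
  rewrite [RHS]integral_mkcond; apply: eq_integral => x _.
  rewrite patchE; case: ifPn => // /negP xA.
  rewrite (F0 x _).2// => /andP[? ?]; apply: xA.
  by rewrite inE /= in_itv/=; apply/andP; split; lra.
rewrite (@continuous_FTC2 _ _ F)//.
- by rewrite !(F0 _ _).1 ?subee// => /andP[? ?]; lra.
- exact: continuous_subspaceT.
- have cF : continuous F.
    move=> x; apply: differentiable_continuous.
    by apply/derivable1_diffP; have [] := dF x.
  split; first by move=> x _; have [] := dF x.
    by apply: cvg_at_right_filter; exact: cF.
  by apply: cvg_at_left_filter; exact: cF.
- by move=> x _; rewrite derive1E; exact: (@derive_val _ _ _ _ _ _ _ (dF x)).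
Qed.

End BoxSupport.

Section TestFields.
Context {R : realType}.
Local Notation mu := (@lebesgue_measure R).
Local Notation mu2 := (mu \x mu)%E.

Record test_field (phi phit phix : R -> R -> R) (tau A : R) := {
  tf_tau : 0 < tau;
  tf_A : tau <= A;
  tf_ge0 : forall t x, 0 <= phi t x;
  tf_dt : forall t x : R, is_derive t 1 (phi ^~ x) (phit t x);
  tf_dx : forall t x : R, is_derive x 1 (phi t) (phix t x);
  tf_ct : continuous (fun p : R * R => phit p.1 p.2);
  tf_cx : continuous (fun p : R * R => phix p.1 p.2);
  tf_mt : measurable_fun setT (fun p : R * R => phit p.1 p.2);
  tf_mx : measurable_fun setT (fun p : R * R => phix p.1 p.2);
  tf_supp : forall t x, ~ (tau <= t <= A /\ - A <= x <= A) ->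
    [/\ phi t x = 0, phit t x = 0 & phix t x = 0] }.

Section TestField.
Variables (phi phit phix : R -> R -> R) (tau A : R).
Hypothesis tf : test_field phi phit phix tau A.

Lemma tf_compact : compact (`[tau, A] `*` `[- A, A] : set (R * R)).
Proof. by apply: compact_setX; exact: segment_compact. Qed.

Lemma tf_partial_t : partial_t phi = phit.
Proof.
apply/funext => t; apply/funext => x; rewrite /partial_t derive1E.
exact: (@derive_val _ _ _ _ _ _ _ (tf_dt tf t x)).
Qed.

Lemma tf_partial_x : partial_x phi = phix.
Proof.
apply/funext => t; apply/funext => x; rewrite /partial_x derive1E.
exact: (@derive_val _ _ _ _ _ _ _ (tf_dx tf t x)).
Qed.

Lemma tf_test_function : test_function phi.
Proof.
split; first exact: (tf_ge0 tf).
- by move=> t x; split; [have [] := tf_dt tf t x|have [] := tf_dx tf t x].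
- rewrite tf_partial_t tf_partial_x; split; [exact: tf_ct tf|exact: tf_cx tf].
- exists (`[tau, A] `*` `[- A, A]); first exact: tf_compact.
  split.
    move=> [t x] [] /=; rewrite !in_itv/= => /andP[+ _] _.
    by apply: lt_le_trans; exact: tf_tau tf.
  move=> t x nK; suff nK' : ~ (tau <= t <= A /\ - A <= x <= A).
    by have [] := tf_supp tf nK'.
  by move=> [h1 h2]; apply: nK; split; rewrite /= in_itv.
Qed.

Lemma tf_bounded (psi : R -> R -> R) : continuous (fun p : R * R => psi p.1 p.2) ->
  measurable_fun setT (fun p : R * R => psi p.1 p.2) ->
  (forall t x, ~ (tau <= t <= A /\ - A <= x <= A) -> psi t x = 0) ->
  box_bounded (fun p => psi p.1 p.2).
Proof.
move=> cpsi mpsi psi0; split => //.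
have : compact ((fun p : R * R => psi p.1 p.2) @` (`[tau, A] `*` `[- A, A])).
  apply: continuous_compact; last exact: tf_compact.
  exact: continuous_subspaceT.
move=> /compact_bounded [C [Cr hC]].
exists (`|C| + 1), A => -[t x] /=; split; last first.
  move=> nb; apply: psi0 => -[/andP[h1 h2] h3]; apply: nb; apply/boxE; split => //.
  by have := tf_tau tf; have := tf_A tf => ? ?; apply/andP; split; lra.
have [K|/psi0 /= ->] := pselect (tau <= t <= A /\ - A <= x <= A); last first.
  by rewrite normr0 addr_ge0.
apply: (hC (`|C| + 1)); first by rewrite ltr_pwDr// ler_norm.
by exists (t, x) => //; split; rewrite /= in_itv; case: K.
Qed.

Lemma tf_bt : box_bounded (fun p => phit p.1 p.2).
Proof.
apply: tf_bounded; [exact: tf_ct tf|exact: tf_mt tf|].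
by move=> t x /(tf_supp tf)[].
Qed.

Lemma tf_bx : box_bounded (fun p => phix p.1 p.2).
Proof.
apply: tf_bounded; [exact: tf_cx tf|exact: tf_mx tf|].
by move=> t x /(tf_supp tf)[].
Qed.

Lemma tf_integral_t : integral2 (fun p => phit p.1 p.2) = 0%E.
Proof.
rewrite /integral2 -(integral21_prod_meas1 (box_bounded_integrable tf_bt)).
rewrite -[RHS](integral0 mu setT); apply: eq_integral => /= y _; pose x : R := y; rewrite -/x.
rewrite /fubini_G /=.
have A0 : 0 <= A by have := tf_tau tf; have := tf_A tf; lra.
have ct : continuous (phit ^~ x).
  exact: (@continuous_section1 _ (fun p => phit p.1 p.2) x (@tf_ct _ _ _ _ _ tf)).
have s0 t : ~ (- A <= t <= A) -> phi t x = 0 /\ phit t x = 0.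
  move=> tA; suff nK : ~ (tau <= t <= A /\ - A <= x <= A).
    by have [] := tf_supp tf nK.
  move=> [/andP[h1 h2] _]; apply: tA; have := tf_tau tf => ?.
  by apply/andP; split; lra.
exact: (integral_deriv0 A0 (fun t => tf_dt tf t x) ct s0).
Qed.

Lemma tf_integral_x : integral2 (fun p => phix p.1 p.2) = 0%E.
Proof.
rewrite /integral2 -(integral12_prod_meas1 (box_bounded_integrable tf_bx)).
rewrite -[RHS](integral0 mu setT); apply: eq_integral => /= s _; pose t : R := s; rewrite -/t.
rewrite /fubini_F /=.
have A0 : 0 <= A by have := tf_tau tf; have := tf_A tf; lra.
have cx : continuous (phix t).
  exact: (@continuous_section2 _ (fun p => phix p.1 p.2) t (@tf_cx _ _ _ _ _ tf)).
have s0 x : ~ (- A <= x <= A) -> phi t x = 0 /\ phix t x = 0.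
  move=> xA; suff nK : ~ (tau <= t <= A /\ - A <= x <= A).
    by have [] := tf_supp tf nK.
  by move=> [_ ?]; apply: xA.
exact: (integral_deriv0 A0 (fun x => tf_dx tf t x) cx s0).
Qed.

End TestField.

End TestFields.

(** * Kruzhkov half-entropies *)

Section Kruzhkov.
Context {R : realType}.
Local Notation mu := (@lebesgue_measure R).
Local Notation mu2 := (mu \x mu)%E.
Variables (f v0 : R -> R) (v : R -> R -> R).
Hypothesis hv : entropy_solution f v0 v.
Hypothesis f_lip : forall x y, `|f x - f y| <= `|x - y|.

Definition upper_half : set (R * R) := [set p | 0 <= p.1].
(** The extension by 0 to negative times lets integrals run over the whole plane; test fields vanish
    there. *)
Definition ext (p : R * R) : R := ((fun p => v p.1 p.2) \_ upper_half) p.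

Lemma measurable_upper_half : measurable upper_half.
Proof.
have -> : upper_half = setT `&` fst @^-1` `[0, +oo[.
  by apply/seteqP; split => -[t x]; rewrite /upper_half /= in_itv/= andbT// => -[].
exact: measurable_fst.
Qed.

Lemma measurable_ext : measurable_fun setT ext.
Proof.
case: hv => _ mv _ _ _.
by have /measurable_restrictT := mv; apply; exact: measurable_upper_half.
Qed.

Lemma extE t x : 0 <= t -> ext (t, x) = v t x.
Proof. by move=> t0; rewrite /ext patchE mem_set. Qed.

Lemma ext_bounded : exists2 M, 0 <= M & forall p, `|ext p| <= M.
Proof.
case: hv => -[M bM] _ _ _ _; exists `|M| => // -[t x].
rewrite /ext patchE; case: ifPn => [/set_mem /= t0|_]; last by rewrite normr0.
by rewrite (le_trans (bM _ _ t0))// ler_norm.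
Qed.

Lemma lip_continuous : continuous f.
Proof.
move=> x; apply/cvgrPdist_le => /= e e0; near=> y.
apply: (le_trans (f_lip _ _)); rewrite ltW//.
Unshelve. all: end_near. Qed.

(** The Kruzhkov flux without the sign function, in a form visibly continuous in [w]. *)
Definition kflux k w := f (Num.max w k) - f (Num.min w k).

Lemma kfluxE k w : Num.sg (w - k) * (f w - f k) = kflux k w.
Proof.
rewrite /kflux; have [wk|wk|->] := ltgtP w k.
- by rewrite ltr0_sg ?subr_lt0//; ring.
- by rewrite gtr0_sg ?subr_gt0//; ring.
- by rewrite !subrr mulr0.
Qed.

Lemma measurable_comp_ext (F : R -> R) : continuous F ->
  measurable_fun setT (fun p => F (ext p)).
Proof.
move=> cF; apply: (@measurableT_comp _ _ _ _ _ _ F); last exact: measurable_ext.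
exact: continuous_measurable_fun.
Qed.

Lemma bounded_comp_ext (F : R -> R) : continuous F ->
  exists C, forall p, `|F (ext p)| <= C.
Proof.
move=> cF; have [M M0 bM] := ext_bounded.
have [c _ hc] := @EVT_max R (fun w => `|F w|) (- M) M ltac:(lra)
  (continuous_subspaceT (fun x => cvg_norm (cF x))).
exists (`|F c|) => p; apply: hc.
by rewrite in_itv/= -ler_norml.
Qed.

Lemma box_bounded_comp_ext (F : R -> R) h : continuous F -> box_bounded h ->
  box_bounded (fun p => F (ext p) * h p).
Proof.
move=> cF bh; have [C bC] := bounded_comp_ext cF.
by apply: (box_boundedM _ bC bh); exact: measurable_comp_ext.
Qed.

Lemma continuous_kflux k : continuous (kflux k).
Proof.
move=> x; apply: cvgB.
  apply: (@continuous_comp _ _ _ (fun w => Num.max w k) f); last exact: lip_continuous.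
  by apply: continuous_max; [exact: cvg_id|exact: cvg_cst].
apply: (@continuous_comp _ _ _ (fun w => Num.min w k) f); last exact: lip_continuous.
by apply: continuous_min; [exact: cvg_id|exact: cvg_cst].
Qed.

(* (w - k)^+ if sg = 1 and (k - w)^+ if sg = -1, with the corresponding flux *)
Definition half_dist (sg k w : R) := (`|w - k| + sg * (w - k)) / 2.
Definition qflux (sg k w : R) := (kflux k w + sg * (f w - f k)) / 2.

Lemma continuous_dist k : continuous (fun w : R => `|w - k|).
Proof. by move=> x; apply: cvg_norm; apply: cvgB; [exact: cvg_id|exact: cvg_cst]. Qed.

Lemma continuous_half_dist sg k : continuous (half_dist sg k).
Proof.
move=> x; apply: cvgM; last exact: cvg_cst.
apply: cvgD; first exact: continuous_dist.
by apply: cvgM; [exact: cvg_cst|apply: cvgB; [exact: cvg_id|exact: cvg_cst]].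
Qed.

Lemma continuous_qflux sg k : continuous (qflux sg k).
Proof.
move=> x; apply: cvgM; last exact: cvg_cst.
apply: cvgD; first exact: continuous_kflux.
apply: cvgM; [exact: cvg_cst|apply: cvgB; [exact: lip_continuous|exact: cvg_cst]].
Qed.

Section Field.
Variables (phi phit phix : R -> R -> R) (tau A : R).
Hypothesis tf : test_field phi phit phix tau A.

Definition pairing (E Q : R -> R) : \bar R :=
  integral2 (fun p => E (ext p) * phit p.1 p.2 + Q (ext p) * phix p.1 p.2).

Lemma entropy_pairing k : (0 <= pairing (fun w => `|w - k|%R) (kflux k))%E.
Proof.
case: hv => _ _ _ _ /(_ k _ (tf_test_function tf)).
rewrite /entropy_production (tf_partial_t tf) (tf_partial_x tf).
rewrite integral_mkcond /pairing /integral2.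
congr (0 <= _)%E; apply: eq_integral => -[t x] _.
rewrite patchE; case: ifPn => [|/negP nt].
  by rewrite inE /= => t0; rewrite extE ?ltW// -kfluxE.
have nK : ~ (tau <= t <= A /\ - A <= x <= A).
  move=> [/andP[tt _] _]; apply: nt; rewrite inE /=.
  by apply: lt_le_trans tt; exact: tf_tau tf.
by have [_ /= -> ->] := tf_supp tf nK; rewrite !mulr0 addr0.
Qed.

Lemma half_entropy sg k : sg = 1 \/ sg = -1 ->
  (0 <= pairing (half_dist sg k) (qflux sg k))%E.
Proof.
move=> sg1; have [M M0 bM] := ext_bounded.
(* For k' beyond the range of v the entropy inequality is the weak equation. *)
pose k' := - sg * M.
have h1 := entropy_pairing k; have h2 := entropy_pairing k'.
have bt := tf_bt tf; have bx := tf_bx tf.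
pose H k := fun p : R * R => `|ext p - k| * phit p.1 p.2 + kflux k (ext p) * phix p.1 p.2.
have bH j : box_bounded (H j).
  exact: (box_boundedD (box_bounded_comp_ext (@continuous_dist j) bt)
    (box_bounded_comp_ext (@continuous_kflux j) bx)).
pose c1 := sg * (k' - k) / 2; pose c2 := sg * (f k' - f k) / 2.
have cst_bb c h : box_bounded h -> box_bounded (fun p : R * R => c * h p).
  move=> bh; apply: (@box_boundedM _ (cst c) h `|c|) => //.
have E1 p : `|ext p - k'| = sg * (ext p - k').
  have := bM p; rewrite ler_norml => /andP[? ?].
  by rewrite /k'; case: sg1 => ->; [rewrite ger0_norm|rewrite ler0_norm]; lra.
have E2 p : kflux k' (ext p) = sg * (f (ext p) - f k').
  have := bM p; rewrite ler_norml => /andP[? ?].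
  rewrite /kflux /k'; case: sg1 => ->.
    by rewrite max_l ?min_r; lra.
  by rewrite max_r ?min_l; lra.
(* The half-entropy differs from the average of the two entropies by constant multiples of [phit]
   and [phix], which integrate to 0. *)
have -> : pairing (half_dist sg k) (qflux sg k) = integral2 (fun p =>
    (2^-1 * (H k p + H k' p)) + (c1 * phit p.1 p.2 + c2 * phix p.1 p.2)).
  congr integral2; apply/funext => p.
  by rewrite /H E1 E2 /half_dist /qflux /c1 /c2; field.
have bHH := box_boundedD (bH k) (bH k').
have b1 := cst_bb c1 _ bt; have b2 := cst_bb c2 _ bx.
have b12 := box_boundedD b1 b2; have b3 := cst_bb 2^-1 _ bHH.
rewrite (integral2D b3 b12) (integral2D b1 b2).
rewrite (integral2Z c1 bt) (integral2Z c2 bx) (tf_integral_t tf) (tf_integral_x tf).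
rewrite !mule0 !adde0 (integral2Z _ bHH) (integral2D (bH k) (bH k')).
by rewrite mule_ge0 ?lee_fin ?invr_ge0// adde_ge0.
Qed.

End Field.

End Kruzhkov.

Section Tonelli.
Context {R : realType}.
Local Notation mu := (@lebesgue_measure R).
Local Notation mu2 := (mu \x mu)%E.
Local Open Scope ereal_scope.

Lemma integral2_fubini (h : R * R -> R) : measurable_fun setT h ->
  (forall p, 0 <= h p)%R ->
  integral2 h = \int[mu]_t \int[mu]_x (h (t, x))%:E.
Proof.
move=> mh h0; apply: (@fubini_tonelli1 _ _ _ _ _ mu mu (EFin \o h)).
- exact/measurable_EFinP.
- by move=> p; rewrite /= lee_fin.
Qed.

Lemma integral2_section_measurable (h : R * R -> R) : measurable_fun setT h ->
  (forall p, 0 <= h p)%R ->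
  measurable_fun setT (fun t => \int[mu]_x (h (t, x))%:E).
Proof.
move=> mh h0.
have mE : measurable_fun setT (EFin \o h) by exact/measurable_EFinP.
have E0 p : 0 <= (EFin \o h) p by rewrite /= lee_fin.
exact: (@measurable_fun_fubini_tonelli_F _ _ _ _ _ mu (EFin \o h) mE E0).
Qed.

Lemma integral2_le_slices (h : R * R -> R) (a b B : R) : measurable_fun setT h ->
  (forall p, 0 <= h p)%R -> (a <= b)%R ->
  (forall t x, ~ (a <= t <= b)%R -> h (t, x) = 0%R) ->
  (forall t, (a <= t <= b)%R -> \int[mu]_x (h (t, x))%:E <= B%:E) ->
  integral2 h <= (B * (b - a))%:E.
Proof.
move=> mh h0 ab out inn; rewrite integral2_fubini//.
have B0 : (0 <= B)%R.
  rewrite -lee_fin (le_trans _ (inn a _)) ?lexx//.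
  by apply: integral_ge0 => x _; rewrite lee_fin.
apply: (@le_trans _ _ (\int[mu]_(t in `[a, b]) B%:E)).
  rewrite [leRHS]integral_mkcond; apply: ge0_le_integral => //.
  - by move=> t _; apply: integral_ge0 => x _; rewrite lee_fin.
  - exact: integral2_section_measurable.
  - by apply: (measurable_restrictT _ _).1.
  - move=> t _; rewrite patchE; case: ifPn => [|/negP].
      by rewrite inE /= in_itv/=; exact: inn.
    rewrite inE /= in_itv/= => nt.
    rewrite (eq_integral (cst 0)) ?integral0// => x _.
    by rewrite out.
rewrite integral_cst//= lebesgue_measure_itv/= lte_fin.
case: ltP => [_|ba]; first by rewrite -EFinB -EFinM.
have -> : a = b by apply/eqP; rewrite eq_le ab.
by rewrite subrr mulr0 mule0.
Qed.

Lemma integral2_ge_slices (h : R * R -> R) (a b B : R) : measurable_fun setT h ->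
  (forall p, 0 <= h p)%R -> (a < b)%R -> (0 <= B)%R ->
  (forall t, (a <= t <= b)%R -> B%:E <= \int[mu]_x (h (t, x))%:E) ->
  (B * (b - a))%:E <= integral2 h.
Proof.
move=> mh h0 ab B0 inn; rewrite integral2_fubini//.
apply: (@le_trans _ _ (\int[mu]_(t in `[a, b]) B%:E)).
  by rewrite integral_cst//= lebesgue_measure_itv/= lte_fin ab -EFinB -EFinM.
rewrite integral_mkcond; apply: ge0_le_integral => //.
- by move=> t _; rewrite patchE; case: ifP => // _; rewrite lee_fin.
- by apply: (measurable_restrictT _ _).1.
- exact: integral2_section_measurable.
- move=> t _; rewrite patchE; case: ifPn => [|_].
    by rewrite inE /= in_itv/=; exact: inn.
  by apply: integral_ge0 => x _; rewrite lee_fin.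
Qed.

End Tonelli.

(** * A test function carried by a cone with moving sides *)

Section ConeField.
Context {R : realType}.

Definition cm (h : R * R -> R) := continuous h /\ measurable_fun setT h.

Lemma cm_cst c : cm (fun _ => c).
Proof. by split => //; move=> x; exact: cvg_cst. Qed.

Lemma cm_fst : cm fst. Proof. by split; [move=> x; exact: cvg_fst|exact: measurable_fst]. Qed.
Lemma cm_snd : cm snd. Proof. by split; [move=> x; exact: cvg_snd|exact: measurable_snd]. Qed.

Lemma cmD h1 h2 : cm h1 -> cm h2 -> cm (fun p => h1 p + h2 p).
Proof.
move=> [c1 m1] [c2 m2]; split; last exact: measurable_funD.
by move=> x; apply: cvgD; [exact: c1|exact: c2].
Qed.

Lemma cmM h1 h2 : cm h1 -> cm h2 -> cm (fun p => h1 p * h2 p).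
Proof.
move=> [c1 m1] [c2 m2]; split; last exact: measurable_funM.
by move=> x; apply: cvgM; [exact: c1|exact: c2].
Qed.

Lemma cmN h : cm h -> cm (fun p => - h p).
Proof.
move=> [c m]; split; last exact: measurable_funN.
by move=> x; apply: cvgN; exact: c.
Qed.

Lemma cm_comp (F : R -> R) h : continuous F -> cm h -> cm (fun p => F (h p)).
Proof.
move=> cF [c m]; split; last first.
  by apply: (@measurableT_comp _ _ _ _ _ _ F) => //; exact: continuous_measurable_fun.
by move=> x; apply: (@cvg_comp _ _ _ h F _ _ _ (c x)); exact: cF.
Qed.

Variables (x1 d1 x2 d2 tau T : R).
Hypotheses (tau0 : 0 < tau) (tauT : tau < T).

Definition coneL (t x : R) := x + - (x1 + d1 * t).
Definition coneR (t x : R) := x2 + d2 * t + - x.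
(** A C^1 bump on [x1 + d1 * t < x < x2 + d2 * t]. The two parts of its gradient are nonnegative
    multiples of (- d1, 1) and (d2, - 1), so that each side compares [qflux] with its own speed
    times [half_dist]. *)
Definition cone (t x : R) := ramp2 (coneL t x) * ramp2 (coneR t x).
(** Switches on during [tau, 2 tau] and off, quadratically, at T. In [dwindow] the first term
    measures what enters, the second what is present before T. *)
Definition window (t : R) := smoothstep tau t * ramp2 (T + - t).
Definition dwindow (t : R) := dsmoothstep tau t * ramp2 (T + - t)
  + - (smoothstep tau t * (2 * ramp (T + - t))).
Definition cone_phi (t x : R) := window t * cone t x.
Definition cone_phit (t x : R) := dwindow t * cone t x + window t *
  ((- d1 * (2 * ramp (coneL t x))) * ramp2 (coneR t x)
   + ramp2 (coneL t x) * (d2 * (2 * ramp (coneR t x)))).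
Definition cone_phix (t x : R) := window t *
  ((2 * ramp (coneL t x)) * ramp2 (coneR t x)
   + ramp2 (coneL t x) * (- (2 * ramp (coneR t x)))).

Lemma cm_coneL : cm (fun p => coneL p.1 p.2).
Proof.
apply: cmD; first exact: cm_snd.
by apply: cmN; apply: cmD; [exact: cm_cst|apply: cmM; [exact: cm_cst|exact: cm_fst]].
Qed.

Lemma cm_coneR : cm (fun p => coneR p.1 p.2).
Proof.
apply: cmD; last by apply: cmN; exact: cm_snd.
by apply: cmD; [exact: cm_cst|apply: cmM; [exact: cm_cst|exact: cm_fst]].
Qed.

Lemma cm_cone : cm (fun p => cone p.1 p.2).
Proof.
apply: cmM; apply: cm_comp; [exact: continuous_ramp2|exact: cm_coneL|
  exact: continuous_ramp2|exact: cm_coneR].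
Qed.

Lemma cm_Tt (F : R -> R) : continuous F -> cm (fun p => F (T + - p.1)).
Proof.
move=> cF; apply: cm_comp => //.
by apply: cmD; [exact: cm_cst|apply: cmN; exact: cm_fst].
Qed.

Lemma cm_smooth : cm (fun p => smoothstep tau p.1).
Proof. by apply: cm_comp; [exact: continuous_smoothstep|exact: cm_fst]. Qed.

Lemma cm_dsmooth : cm (fun p => dsmoothstep tau p.1).
Proof. by apply: cm_comp; [exact: continuous_dsmoothstep|exact: cm_fst]. Qed.

Lemma cm_window : cm (fun p => window p.1).
Proof. by apply: cmM; [exact: cm_smooth|apply: cm_Tt; exact: continuous_ramp2]. Qed.

Lemma cm_dwindow : cm (fun p => dwindow p.1).
Proof.
apply: cmD.
  by apply: cmM; [exact: cm_dsmooth|apply: cm_Tt; exact: continuous_ramp2].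
apply: cmN; apply: cmM; first exact: cm_smooth.
by apply: cmM; [exact: cm_cst|apply: cm_Tt; exact: continuous_ramp].
Qed.

Lemma cm_phit : cm (fun p => cone_phit p.1 p.2).
Proof.
have rL := cm_comp continuous_ramp cm_coneL.
have rR := cm_comp continuous_ramp cm_coneR.
have r2L := cm_comp continuous_ramp2 cm_coneL.
have r2R := cm_comp continuous_ramp2 cm_coneR.
apply: cmD; first by apply: cmM; [exact: cm_dwindow|exact: cm_cone].
apply: cmM; first exact: cm_window.
apply: cmD; apply: cmM => //; apply: cmM; try exact: cm_cst;
  by apply: cmM => //; exact: cm_cst.
Qed.

Lemma cm_phix : cm (fun p => cone_phix p.1 p.2).
Proof.
have rL := cm_comp continuous_ramp cm_coneL.
have rR := cm_comp continuous_ramp cm_coneR.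
have r2L := cm_comp continuous_ramp2 cm_coneL.
have r2R := cm_comp continuous_ramp2 cm_coneR.
apply: cmM; first exact: cm_window.
apply: cmD; apply: cmM => //; first by apply: cmM => //; exact: cm_cst.
by apply: cmN; apply: cmM => //; exact: cm_cst.
Qed.

Lemma is_derive_mul (F G : R -> R) (dF dG t : R) :
  is_derive t 1 F dF -> is_derive t 1 G dG ->
  is_derive t 1 (fun s => F s * G s) (dF * G t + F t * dG).
Proof.
move=> hF hG; apply: is_derive_eq; rewrite /GRing.scale /=; ring.
Qed.

Lemma cone_dt (t x : R) : is_derive t 1 (cone_phi ^~ x) (cone_phit t x).
Proof.
have hT := @is_derive_ramp2_affine _ (fun s => T + - s) T (-1) t
  ltac:(by move=> s; rewrite mulN1r).
have hL := @is_derive_ramp2_affine _ (coneL ^~ x) (x - x1) (- d1) t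
  ltac:(by move=> s; rewrite /coneL; ring).
have hR := @is_derive_ramp2_affine _ (coneR ^~ x) (x2 - x) d2 t
  ltac:(by move=> s; rewrite /coneR; ring).
rewrite mulN1r in hT.
have hw := is_derive_mul (is_derive_smoothstep tau t) hT.
have := is_derive_mul hw (is_derive_mul hL hR).
rewrite /cone_phit /dwindow mulrN; exact.
Qed.

Lemma cone_dx (t x : R) : is_derive x 1 (cone_phi t) (cone_phix t x).
Proof.
have hL := @is_derive_ramp2_affine _ (coneL t) (- (x1 + d1 * t)) 1 x
  ltac:(by move=> y; rewrite /coneL; ring).
have hR := @is_derive_ramp2_affine _ (coneR t) (x2 + d2 * t) (-1) x
  ltac:(by move=> y; rewrite /coneR; ring).
rewrite mul1r in hL; rewrite mulN1r in hR.
have hw : is_derive x 1 (fun _ : R => window t) 0 by exact: is_derive_cst.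
have := is_derive_mul hw (is_derive_mul hL hR).
rewrite mul0r add0r; exact.
Qed.

(** Bounds the position in the cone up to time [T]; the last summand is there because [test_field]
    has a single bound for time and space. *)
Definition cone_radius := `|x1| + `|x2| + (`|d1| + `|d2|) * T + T.

Lemma cone_out t x : 0 <= t <= T -> ~ (- cone_radius <= x <= cone_radius) ->
  coneL t x <= 0 \/ coneR t x <= 0.
Proof.
move=> /andP[t0 tT] nx; have [|L0] := leP (coneL t x) 0; first by left.
have [|R0] := leP (coneR t x) 0; first by right.
exfalso; apply: nx; rewrite /coneL /coneR /cone_radius in L0 R0 *.
have := ler_norm (- x1); have := ler_norm x2; rewrite normrN => a1 a2.
have e1 : `|d1 * t| <= `|d1| * T by rewrite normrM ler_wpM2l// ger0_norm.
have e2 : `|d2 * t| <= `|d2| * T by rewrite normrM ler_wpM2l// ger0_norm.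
move: e1 e2; rewrite !ler_norml => /andP[? ?] /andP[? ?].
have ? := normr_ge0 x1; have ? := normr_ge0 x2.
have : 0 <= `|d1| * T by rewrite mulr_ge0//; lra.
have : 0 <= `|d2| * T by rewrite mulr_ge0//; lra.
by rewrite mulrDl => ? ?; apply/andP; split; lra.
Qed.

Lemma cone_radius_ge : T <= cone_radius.
Proof.
have T0 : 0 <= T by apply: ltW; exact: lt_trans tauT.
rewrite /cone_radius; have ? := normr_ge0 x1; have ? := normr_ge0 x2.
have : 0 <= `|d1| * T by rewrite mulr_ge0.
have : 0 <= `|d2| * T by rewrite mulr_ge0.
by rewrite mulrDl => ? ?; lra.
Qed.

Lemma cone_test_field :
  test_field cone_phi cone_phit cone_phix tau cone_radius.
Proof.
have crT := cone_radius_ge; have t0 := tau0; have t1 := tauT.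
split.
- exact: tau0.
- by rewrite (le_trans _ crT)// ltW.
- by move=> t x; apply: mulr_ge0; apply: mulr_ge0;
    rewrite ?ramp2_ge0 ?smoothstep_ge0.
- exact: cone_dt.
- exact: cone_dx.
- by have [] := cm_phit.
- by have [] := cm_phix.
- by have [] := cm_phit.
- by have [] := cm_phix.
- move=> t x nK.
  suff : (window t = 0 /\ dwindow t = 0) \/ (coneL t x <= 0 \/ coneR t x <= 0).
    rewrite /cone_phi /cone_phit /cone_phix /cone.
    move=> [[-> ->]|[L|R']]; first by rewrite !mul0r addr0.
      by rewrite (ramp2_neg L) (ramp_neg L) !(mul0r, mulr0, addr0).
    by rewrite (ramp2_neg R') (ramp_neg R') !(mul0r, mulr0, addr0, oppr0).
  have [tt|tt] := leP t tau.
    by left; rewrite /window /dwindow smoothstep_le// dsmoothstep_le// !mul0r oppr0 addr0.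
  have [Tt|tT] := leP T t.
    left; rewrite /window /dwindow (@ramp2_neg _ (T + - t)); last lra.
    by rewrite (@ramp_neg _ (T + - t)); [rewrite !mulr0 oppr0 addr0|lra].
  right; apply: cone_out; first by apply/andP; split; lra.
  move=> xK; apply: nK; split => //.
  by apply/andP; split; lra.
Qed.

End ConeField.

(** * Vanishing of a half-entropy inside a cone *)

Section Vanish.
Context {R : realType}.
Local Notation mu := (@lebesgue_measure R).
Variables (f v0 : R -> R) (v : R -> R -> R).
Hypothesis hv : entropy_solution f v0 v.
Hypothesis f_lip : forall x y, `|f x - f y| <= `|x - y|.
Hypothesis v_rc : forall t, 0 <= t -> right_continuous (v t).

Lemma L1_continuity t0 M e : 0 <= t0 -> 0 < e -> exists2 rho, 0 < rho &
  forall s, 0 <= s -> `|s - t0| < rho -> (L1_distance M (v s) (v t0) <= e%:E)%E.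
Proof.
move=> t00 e0; case: hv => _ _ _ /(_ t0 M t00) /fine_cvgP[fn cv] _.
have := fn; rewrite near_withinE => /nbhs_ballP[r1 /= r10 h1].
move/cvgrPdist_lt : cv => /(_ _ e0); rewrite near_withinE => /nbhs_ballP[r2 /= r20 h2].
exists (Num.min r1 r2); first by rewrite lt_min r10.
move=> s s0; rewrite lt_min => /andP[s1 s2].
have fs := h1 s; have {}fs := fs ltac:(by rewrite /ball/= distrC) s0.
have hs := h2 s; have {}hs := hs ltac:(by rewrite /ball/= distrC) s0.
rewrite -(fineK fs) lee_fin; move: hs; rewrite /= sub0r normrN => /ltW.
by apply: le_trans; exact: ler_norm.
Qed.

Lemma half_dist_ge0 (sg k w : R) : sg = 1 \/ sg = -1 -> 0 <= half_dist sg k w.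
Proof.
rewrite /half_dist => -[] ->; apply: divr_ge0 => //.
  by have := ler_norm (- (w - k)); rewrite normrN; lra.
by have := ler_norm (w - k); lra.
Qed.

Lemma half_dist_lip (sg k w w' : R) : sg = 1 \/ sg = -1 ->
  half_dist sg k w <= half_dist sg k w' + `|w - w'|.
Proof.
move=> sg1; rewrite /half_dist.
have h : `|w - k| <= `|w' - k| + `|w - w'|.
  have := ler_normD (w - w') (w' - k).
  by rewrite (_ : w - w' + (w' - k) = w - k); [lra|ring].
have : sg * (w - k) <= sg * (w' - k) + `|w - w'|.
  by case: sg1 => ->; [have := ler_norm (w - w')|
     have := ler_norm (- (w - w')); rewrite normrN]; lra.
by lra.
Qed.

Lemma measurable_slice t : 0 <= t -> measurable_fun setT (v t).
Proof.
move=> t0; have -> : v t = (fun x => ext v (t, x)).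
  by apply/funext => x; rewrite extE.
apply: (@measurableT_comp _ _ _ _ _ _ (ext v) _ (fun x => (t, x))).
  exact: (measurable_ext hv).
exact: pair1_measurable.
Qed.

Section Cone.
Variables (sg k x1 d1 x2 d2 delta : R).
Hypothesis sg1 : sg = 1 \/ sg = -1.
Hypothesis side : forall t x, 0 < t ->
  qflux f sg k (v t x) <= d1 * half_dist sg k (v t x) /\
  d2 * half_dist sg k (v t x) <= qflux f sg k (v t x).
Hypothesis delta0 : 0 < delta.
Hypothesis init0 : forall x, x1 - delta < x < x2 + delta -> half_dist sg k (v0 x) = 0.

Local Ltac bare_lra := clear - hv f_lip v_rc sg1 side delta0 init0; lra.

Definition mass_out tau T (p : R * R) := half_dist sg k (ext v p) *
  (smoothstep tau p.1 * (2 * ramp (T + - p.1)) * cone x1 d1 x2 d2 p.1 p.2).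
Definition mass_in tau T (p : R * R) := half_dist sg k (ext v p) *
  (dsmoothstep tau p.1 * ramp2 (T + - p.1) * cone x1 d1 x2 d2 p.1 p.2).

Lemma cone_eq0 t x : coneL x1 d1 t x <= 0 \/ coneR x2 d2 t x <= 0 ->
  cone x1 d1 x2 d2 t x = 0.
Proof. by rewrite /cone => -[] /ramp2_neg ->; rewrite ?(mul0r, mulr0). Qed.

Lemma cone_ge0 t x : 0 <= cone x1 d1 x2 d2 t x.
Proof. by rewrite mulr_ge0 ?ramp2_ge0. Qed.

Lemma mass_out_cm tau T : cm (fun p => smoothstep tau p.1 * (2 * ramp (T + - p.1))
  * cone x1 d1 x2 d2 p.1 p.2).
Proof.
apply: cmM; last exact: cm_cone.
apply: cmM; first exact: cm_smooth.
by apply: cmM; [exact: cm_cst|apply: cm_Tt; exact: continuous_ramp].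
Qed.

Lemma mass_in_cm tau T : cm (fun p => dsmoothstep tau p.1 * ramp2 (T + - p.1)
  * cone x1 d1 x2 d2 p.1 p.2).
Proof.
apply: cmM; last exact: cm_cone.
by apply: cmM; [exact: cm_dsmooth|apply: cm_Tt; exact: continuous_ramp2].
Qed.

Lemma cone_field_supp (w : R -> R) tau T t x : 0 < tau -> tau < T ->
  (t <= tau \/ T <= t -> w t = 0) ->
  ~ (tau <= t <= cone_radius x1 d1 x2 d2 T /\
     - cone_radius x1 d1 x2 d2 T <= x <= cone_radius x1 d1 x2 d2 T) ->
  w t * cone x1 d1 x2 d2 t x = 0.
Proof.
move=> tau0 tauT w0 nK.
have [tt|tt] := leP t tau; first by rewrite w0 ?mul0r//; left.
have [Tt|tT] := leP T t; first by rewrite w0 ?mul0r//; right.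
rewrite cone_eq0 ?mulr0//; apply: (cone_out (T := T)) => //.
  by apply/andP; split; lra.
move=> xK; apply: nK; split => //.
have := @cone_radius_ge _ x1 d1 x2 d2 _ _ tau0 tauT => ?.
by apply/andP; split; lra.
Qed.

Lemma mass_out_bb tau T : 0 < tau -> tau < T -> box_bounded (mass_out tau T).
Proof.
move=> tau0 tauT.
have [c m] := mass_out_cm tau T.
have b := @tf_bounded _ _ _ _ _ _ (cone_test_field x1 d1 x2 d2 tau0 tauT)
  (fun t x => smoothstep tau t * (2 * ramp (T + - t)) * cone x1 d1 x2 d2 t x) c m.
apply: (box_bounded_comp_ext hv (@continuous_half_dist _ sg k) (b _)) => t x.
apply: (@cone_field_supp (fun t => smoothstep tau t * (2 * ramp (T + - t)))) => // -[h|h].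
  by rewrite smoothstep_le ?mul0r.
by rewrite ramp_neg ?mulr0//; lra.
Qed.

Lemma mass_in_bb tau T : 0 < tau -> tau < T -> box_bounded (mass_in tau T).
Proof.
move=> tau0 tauT.
have [c m] := mass_in_cm tau T.
have b := @tf_bounded _ _ _ _ _ _ (cone_test_field x1 d1 x2 d2 tau0 tauT)
  (fun t x => dsmoothstep tau t * ramp2 (T + - t) * cone x1 d1 x2 d2 t x) c m.
apply: (box_bounded_comp_ext hv (@continuous_half_dist _ sg k) (b _)) => t x.
apply: (@cone_field_supp (fun t => dsmoothstep tau t * ramp2 (T + - t))) => // -[h|h].
  by rewrite dsmoothstep_le ?mul0r.
by rewrite ramp2_neg ?mulr0//; lra.
Qed.

Lemma mass_out_ge0 tau T p : 0 < tau -> 0 <= mass_out tau T p.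
Proof.
move=> tau0; rewrite mulr_ge0 ?half_dist_ge0// mulr_ge0 ?cone_ge0//.
by rewrite mulr_ge0 ?smoothstep_ge0// mulr_ge0 ?ramp_ge0.
Qed.

Lemma mass_in_ge0 tau T p : 0 < tau -> 0 <= mass_in tau T p.
Proof.
move=> tau0; rewrite mulr_ge0 ?half_dist_ge0// mulr_ge0 ?cone_ge0//.
by rewrite mulr_ge0 ?ramp2_ge0//; have /andP[] := dsmoothstep_bound p.1 tau0.
Qed.

(* The entropy inequality for the window: what leaves before time T has entered
   near time 0, the fluxes through the sides of the cone having a sign. *)
Lemma mass_out_le_in tau T : 0 < tau -> tau < T ->
  (integral2 (mass_out tau T) <= integral2 (mass_in tau T))%E.
Proof.
move=> tau0 tauT.
have tf := cone_test_field x1 d1 x2 d2 tau0 tauT.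
have bo := mass_out_bb tau0 tauT; have bi := mass_in_bb tau0 tauT.
have bo' : box_bounded (fun p => -1 * mass_out tau T p).
  by apply: (@box_boundedM _ (cst (-1)) _ 1) => // p; rewrite normrN1.
have pw (t x : R) : half_dist sg k (ext v (t, x)) * cone_phit x1 d1 x2 d2 tau T t x +
    qflux f sg k (ext v (t, x)) * cone_phix x1 d1 x2 d2 tau T t x <=
    mass_in tau T (t, x) + -1 * mass_out tau T (t, x).
  have [tt|tt] := leP t tau.
    rewrite /mass_in /mass_out /cone_phit /cone_phix /window /dwindow /=.
    by rewrite smoothstep_le// dsmoothstep_le// !(mul0r,mulr0,oppr0,addr0).
  have t0 : 0 < t by exact: lt_trans tt.
  have [s1 s2] := side x t0.
  rewrite /mass_in /mass_out (extE _ _ (ltW t0)) /=.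
  set E := half_dist sg k (v t x) in s1 s2 *; set Q := qflux f sg k (v t x) in s1 s2 *.
  have w0 : 0 <= window tau T t by rewrite mulr_ge0 ?smoothstep_ge0 ?ramp2_ge0.
  (* The weights of the two side fluxes: by [side], the derivatives of the cone factors contribute
     at most 0, and only [dwindow] remains. *)
  have a0 : 0 <= window tau T t * (2 * ramp (coneL x1 d1 t x) * ramp2 (coneR x2 d2 t x)).
    by rewrite mulr_ge0// mulr_ge0 ?ramp2_ge0// mulr_ge0 ?ramp_ge0.
  have b0 : 0 <= window tau T t * (ramp2 (coneL x1 d1 t x) * (2 * ramp (coneR x2 d2 t x))).
    by rewrite mulr_ge0// mulr_ge0 ?ramp2_ge0// mulr_ge0 ?ramp_ge0.
  have h1 := ler_wpM2l a0 s1; have h2 := ler_wpM2l b0 s2.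
  rewrite -subr_ge0 /cone_phit /cone_phix /dwindow /cone.
  rewrite -subr_ge0 in h1; rewrite -subr_ge0 in h2.
  have := addr_ge0 h1 h2; congr (0 <= _); ring.
have fo : integral2 (mass_out tau T) \is a fin_num.
  exact: (integrable_fin_num measurableT (box_bounded_integrable bo)).
rewrite -sube_ge0 ?fo//.
apply: (le_trans (half_entropy hv f_lip tf k sg1)).
have <- : integral2 (fun p => mass_in tau T p + -1 * mass_out tau T p) =
   (integral2 (mass_in tau T) - integral2 (mass_out tau T))%E.
  by rewrite (integral2D bi bo') (integral2Z _ bo) mulN1e.
rewrite /pairing /integral2; apply: le_integral => //.
- apply: box_bounded_integrable; apply: box_boundedD.
    exact: (box_bounded_comp_ext hv (@continuous_half_dist _ sg k) (tf_bt tf)).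
  exact: (box_bounded_comp_ext hv (@continuous_qflux _ _ f_lip sg k) (tf_bx tf)).
- exact: box_bounded_integrable (box_boundedD bi bo').
by move=> -[t x] _; rewrite lee_fin; exact: pw.
Qed.


Lemma ramp2_le_sqr (z B : R) : `|z| <= B -> ramp2 z <= B * B.
Proof.
move=> zB; have h : ramp z <= B.
  rewrite /ramp ge_max (le_trans (ler_norm z))// andbT.
  by apply: le_trans zB.
by rewrite /ramp2 ler_pM// ramp_ge0.
Qed.

(** During [tau, 2 tau] the cone lies over points where [half_dist] of [v0] vanishes, so the density
    is bounded by the distance of [v t] to [v 0], small in L1. The height [2 / tau] of the tent is
    compensated by the length [tau] of its support. *)
Lemma mass_in_small T eta0 : 0 < T -> 0 < eta0 ->
  exists2 tau0, 0 < tau0 & forall tau, 0 < tau -> tau <= tau0 -> tau < T ->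
    (integral2 (mass_in tau T) <= eta0%:E)%E.
Proof.
move=> T0 e0.
pose A := cone_radius x1 d1 x2 d2 T.
(* Bounds of [coneL] and [coneR] on the box; the resulting [C] does not depend on [tau]. *)
pose B1 := A + `|x1| + `|d1| * T; pose B2 := A + `|x2| + `|d2| * T.
pose C := 2 * (T * T) * ((B1 * B1) * (B2 * B2)).
have C0 : 0 <= C.
  have sq (z : R) : 0 <= z * z by rewrite -expr2 sqr_ge0.
  by apply: mulr_ge0; apply: mulr_ge0 => //; exact: sq.
have eC : 0 < eta0 / (C + 1) by apply: divr_gt0 => //; lra.
have [rho rho0 hrho] := L1_continuity A (lexx 0) eC.
pose D := `|d1| + `|d2| + 1.
have D0 : 0 < D by rewrite /D ltr_pwDr.
(* [rho / 3] keeps 2 tau below [rho]; [delta / (4 * D)] keeps the sides from moving by [delta] until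
   time 2 tau. *)
pose tau0 := Num.min (rho / 3) (delta / (4 * D)).
exists tau0.
  rewrite lt_min; apply/andP; split; apply: divr_gt0 => //.
  exact: mulr_gt0.
move=> tau tau_gt0; rewrite le_min => /andP[tr td] tauT.
have tauD : 2 * tau * D < delta.
  move: td; rewrite ler_pdivlMr ?mulr_gt0// => td.
  have := mulr_gt0 tau_gt0 D0; have d0 := delta0; lra.
have t2 : 0 < 2 / tau by exact: divr_gt0.
pose B := 2 / tau * (T * T) * ((B1 * B1) * (B2 * B2)) * (eta0 / (C + 1)).
have -> : eta0 = eta0 / (C + 1) * (C + 1) by field; lra.
have : (integral2 (mass_in tau T) <= (B * (2 * tau - tau))%:E)%E.
  apply: integral2_le_slices.
  - by have [] := mass_in_bb tau_gt0 tauT.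
  - by move=> p; exact: mass_in_ge0.
  - lra.
  - move=> t x nt; rewrite /mass_in /=.
    have -> : dsmoothstep tau t = 0; last by rewrite !mul0r mulr0.
    have [tt|tt] := leP t tau; first by rewrite dsmoothstep_le.
    by rewrite dsmoothstep_ge//; rewrite leNgt; apply/negP => ?; apply: nt; lra.
  move=> t /andP[t1 t3].
  have t0 : 0 < t by lra.
  pose c := 2 / tau * (T * T) * ((B1 * B1) * (B2 * B2)).
  have c0 : 0 <= c.
    have sq (z : R) : 0 <= z * z by rewrite -expr2 sqr_ge0.
    by apply: mulr_ge0; apply: mulr_ge0 => //; [exact: ltW|exact: sq..].
  have m0 := measurable_slice (lexx 0); have mt := measurable_slice (ltW t0).
  have v00 : v 0 = v0 by case: hv.
  have md : measurable_fun setT (fun x => (`|v t x - v 0 x|)%:E).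
    by apply/measurable_EFinP; apply: measurableT_comp => //; exact: measurable_funB.
  have ptw (x : R) : mass_in tau T (t, x) <=
      ((fun x => c * `|v t x - v 0 x|) \_ `[- A, A]) x.
    rewrite patchE /mass_in /= (extE _ _ (ltW t0)).
    have [Tt|tT] := leP T t.
      rewrite (ramp2_neg (_ : T - t <= 0)); last lra.
      by rewrite mulr0 mul0r mulr0; case: ifP => // _; rewrite mulr_ge0.
    case: ifPn => [|/negP nA]; last first.
      rewrite cone_eq0 ?mulr0//; apply: (cone_out (T := T)).
        by rewrite (ltW t0) (ltW tT).
      by move=> xA; apply: nA; rewrite inE /= in_itv.
    rewrite inE /= in_itv/= => /andP[xA1 xA2].
    have [c0'|cn0] := eqVneq (cone x1 d1 x2 d2 t x) 0.
      by rewrite c0' !mulr0 mulr_ge0.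
    have /andP[L0 R0] : (0 < coneL x1 d1 t x) && (0 < coneR x2 d2 t x).
      by rewrite !ltNge; apply/andP; split; apply: contra cn0 => h;
        rewrite cone_eq0//; [left|right].
    have e0' : half_dist sg k (v 0 x) = 0.
      rewrite v00; apply: init0; rewrite /coneL /coneR in L0 R0.
      have h1 : `|d1 * t| <= D * (2 * tau).
        rewrite normrM ler_pM// ?(ger0_norm (ltW t0))//.
        by rewrite /D -addrA lerDl addr_ge0.
      have h2 : `|d2 * t| <= D * (2 * tau).
        rewrite normrM ler_pM// ?(ger0_norm (ltW t0))//.
        by rewrite /D addrAC lerDr addr_ge0.
      move: h1 h2; rewrite !ler_norml => /andP[a1 a2] /andP[b1 b2].
      by apply/andP; split; [move: a1 a2 L0|move: b1 b2 R0]; move: tauD; bare_lra.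
    have hE := half_dist_lip k (v t x) (v 0 x) sg1; rewrite e0' add0r in hE.
    have ds := dsmoothstep_bound t tau_gt0.
    have d0 : 0 <= dsmoothstep tau t by have /andP[] := ds.
    have d1' : dsmoothstep tau t <= 2 / tau by have /andP[] := ds.
    have rT : ramp2 (T - t) <= T * T.
      by apply: ramp2_le_sqr; rewrite ger0_norm ?subr_ge0 ?(ltW tT)// lerBlDr lerDl ltW.
    have bb (d : R) : `|d * t| <= `|d| * T.
      by rewrite normrM ler_wpM2l// (ger0_norm (ltW t0)) ltW.
    have cB : cone x1 d1 x2 d2 t x <= (B1 * B1) * (B2 * B2).
      apply: ler_pM; rewrite ?ramp2_ge0//; apply: ramp2_le_sqr;
        rewrite /coneL /coneR /B1 /B2.
        have := bb d1; have := ler_norm x1; have := ler_norm (- x1).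
        rewrite normrN !ler_norml => n1 n2 /andP[b1 b2]; apply/andP; split;
          move: n1 n2 b1 b2 xA1 xA2; bare_lra.
      have := bb d2; have := ler_norm x2; have := ler_norm (- x2).
      rewrite normrN !ler_norml => n1 n2 /andP[b1 b2]; apply/andP; split;
          move: n1 n2 b1 b2 xA1 xA2; bare_lra.
    rewrite mulrC; apply: ler_pM => //.
    - by apply: mulr_ge0; [apply: mulr_ge0 => //; exact: ramp2_ge0|exact: cone_ge0].
    - exact: half_dist_ge0.
    by apply: ler_pM => //; [apply: mulr_ge0 => //; exact: ramp2_ge0|
      exact: cone_ge0|apply: ler_pM => //; exact: ramp2_ge0].
  have mE : measurable_fun setT (fun x => (mass_in tau T (t, x))%:E).
    apply/measurable_EFinP.
    have [mm _] := mass_in_bb tau_gt0 tauT.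
    by apply: (@measurableT_comp _ _ _ _ _ _ _ _ (fun x => (t, x)) mm);
      exact: pair1_measurable.
  apply: (@le_trans _ _ (\int[mu]_(x in `[(- A)%R, A]) (c * `|v t x - v 0 x|)%:E)%E).
    rewrite [leRHS]integral_mkcond; apply: ge0_le_integral => //.
    - by move=> x _; rewrite lee_fin; exact: mass_in_ge0.
    - apply: (measurable_restrictT _ _).1 => //.
      apply: measurable_funTS; apply/measurable_EFinP.
      by apply: measurable_funM => //; exact/measurable_EFinP.
    - by move=> x _; have := ptw x; rewrite !patchE; case: ifP => _; rewrite lee_fin.
  under eq_integral do rewrite EFinM.
  rewrite ge0_integralZl_EFin//; last first.
    exact: measurable_funTS.
  have -> : B%:E = (c%:E * (eta0 / (C + 1))%:E)%E by rewrite -EFinM.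
  apply: lee_wpmul2l; first by rewrite lee_fin.
  apply: (hrho t (ltW t0)).
  rewrite subr0 ger0_norm ?(ltW t0)//.
  by move: tr; rewrite ler_pdivlMr// => tr; lra.
move=> /le_trans; apply; rewrite lee_fin.
have -> : B * (2 * tau - tau) = C * (eta0 / (C + 1)).
  rewrite /B; move: (eta0 / (C + 1)) => q; rewrite /C; field.
  by rewrite gt_eqF.
by rewrite mulrC ler_wpM2l ?(ltW eC)//; lra.
Qed.

Lemma right_continuous_lower (t x e : R) : 0 <= t -> 0 < e -> half_dist sg k (v t x) = e ->
  exists2 r, 0 < r & forall y, x <= y <= x + r -> e / 2 <= half_dist sg k (v t y).
Proof.
move=> t0 e0 hE; have e2 : 0 < e / 2 by exact: divr_gt0.
have /cvgrPdist_lt /(_ _ e2) := v_rc t0 (x := x).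
move=> [r /= r0 hr]; exists (r / 2); first exact: divr_gt0.
move=> y /andP[xy yr].
have [yx|yx] := eqVneq y x; first by rewrite yx hE; lra.
have {yx} xy' : x < y by rewrite lt_neqAle eq_sym yx.
have := hr y; rewrite /ball /= => /(_ _ xy') h.
have {}h : `|v t x - v t y| < e / 2 by apply: h; rewrite ler0_norm; lra.
have := half_dist_lip k (v t x) (v t y) sg1; rewrite hE; lra.
Qed.

(** A positive value at (t, x) persists on [x, x + r] by right-continuity and, in L1, at times
    slightly below [t]. This bounds [mass_out] from below independently of [tau], while [mass_in]
    tends to 0 with [tau]. *)
Lemma cone_vanish t x : 0 < t -> x1 + d1 * t < x < x2 + d2 * t ->
  half_dist sg k (v t x) = 0.
Proof.
move=> t0 /andP[xL xR].
have := half_dist_ge0 k (v t x) sg1; rewrite le_eqVlt => /predU1P[->//|e0].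
exfalso; set e := half_dist sg k (v t x) in e0.
have [r1 r10 hr1] := right_continuous_lower (ltW t0) e0 (erefl : half_dist sg k (v t x) = e).
pose r := Num.min r1 ((x2 + d2 * t - x) / 2).
have r0 : 0 < r by rewrite lt_min r10/=; apply: divr_gt0; lra.
have rr1 : r <= r1 by rewrite ge_min lexx.
have rR : x + r < x2 + d2 * t.
  suff : r <= (x2 + d2 * t - x) / 2 by lra.
  by rewrite ge_min lexx orbT.
pose T := t + 1.
pose A := cone_radius x1 d1 x2 d2 T.
have re0 : 0 < r * e / 4 by apply: divr_gt0 => //; exact: mulr_gt0.
have [s1 s10 hs1] := L1_continuity (`|x| + r) (ltW t0) re0.
pose l0 := (x - (x1 + d1 * t)) / 2; pose q0 := (x2 + d2 * t - (x + r)) / 2.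
have l00 : 0 < l0 by apply: divr_gt0 => //; lra.
have q00 : 0 < q0 by apply: divr_gt0 => //; lra.
pose D := `|d1| + `|d2| + 1.
have D0 : 0 < D by rewrite /D ltr_pwDr.
pose rho := Num.min (Num.min (t / 2) (s1 / 2)) (Num.min (l0 / D) (q0 / D)).
have rho0 : 0 < rho.
  rewrite !lt_min; apply/andP; split; apply/andP; split; exact: divr_gt0.
have [[rt rs] [rl rq]] : (rho <= t / 2 /\ rho <= s1 / 2) /\
    (rho <= l0 / D /\ rho <= q0 / D).
  by split; split; rewrite !ge_min lexx ?orbT.
have {}rl : D * rho <= l0 by rewrite mulrC -ler_pdivlMr.
have {}rq : D * rho <= q0 by rewrite mulrC -ler_pdivlMr.
(* Lower bound of the weight in [mass_out] over the strip: [2 * ramp (T - s) >= 2] because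
   [T = t + 1], and the strip keeps distances at least [l0] and [q0] from the sides of the cone. *)
pose kap := 2 * ((l0 * l0) * (q0 * q0)).
have kap0 : 0 < kap by apply: mulr_gt0 => //; apply: mulr_gt0; exact: mulr_gt0.
pose B := kap * (r * e / 4).
have B0 : 0 < B by exact: mulr_gt0.
have T0 : 0 < T by rewrite /T; lra.
have Br0 : 0 < B * rho / 2 by apply: divr_gt0 => //; exact: mulr_gt0.
have [tau0 tau00 htau] := mass_in_small T0 Br0.
pose tau := Num.min tau0 (t / 4).
have tau_gt0 : 0 < tau by rewrite lt_min tau00 /= divr_gt0.
have tautau0 : tau <= tau0 by rewrite ge_min lexx.
have taut : tau <= t / 4 by rewrite ge_min lexx orbT.
have tauT : tau < T by rewrite /T; lra.
have UB := htau tau tau_gt0 tautau0 tauT.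
have UB2 := le_trans (mass_out_le_in tau_gt0 tauT) UB.
suff LB : ((B * (t - (t - rho)))%:E <=
    integral2 (mass_out tau T))%E.
  have := le_trans LB UB2; rewrite lee_fin.
  have -> : t - (t - rho) = rho by ring.
  have := mulr_gt0 B0 rho0; bare_lra.
apply: integral2_ge_slices.
- by have [] := mass_out_bb tau_gt0 tauT.
- by move=> p; exact: mass_out_ge0.
- lra.
- exact: ltW.
move=> s /andP[ts st].
have s0 : 0 < s by move: ts rt t0; bare_lra.
have mE : measurable_fun setT (fun x => (mass_out tau T (s, x))%:E).
  apply/measurable_EFinP.
  have [mm _] := mass_out_bb tau_gt0 tauT.
  by apply: (@measurableT_comp _ _ _ _ _ _ _ _ (fun x => (s, x)) mm);
    exact: pair1_measurable.
have ms := measurable_slice (ltW s0); have mt := measurable_slice (ltW t0).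
have mEs : measurable_fun setT (fun y => half_dist sg k (v s y)).
  apply: (@measurableT_comp _ _ _ _ _ _ (half_dist sg k)) => //.
  exact: continuous_measurable_fun (@continuous_half_dist _ sg k).
have md : measurable_fun setT (fun y => `|v s y - v t y|).
  by apply: measurableT_comp => //; exact: measurable_funB.
have lower y : x <= y <= x + r -> kap * half_dist sg k (v s y) <=
    mass_out tau T (s, y).
  move=> /andP[xy yr].
  rewrite /mass_out (extE _ _ (ltW s0)) /= smoothstep_ge//; last by move: taut ts rt; bare_lra.
  rewrite mul1r mulrC ler_wpM2l ?half_dist_ge0//.
  have hd (d : R) : `|d| <= D -> `|d * s - d * t| <= D * rho.
    move=> dD; rewrite -mulrBr normrM ler_pM//.
    by rewrite ler_norml; apply/andP; split; move: ts st rho0; bare_lra.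
  have h1 := hd d1; have {}h1 : `|d1 * s - d1 * t| <= D * rho.
    by apply: h1; rewrite /D -addrA lerDl addr_ge0.
  have h2 := hd d2; have {}h2 : `|d2 * s - d2 * t| <= D * rho.
    by apply: h2; rewrite /D addrAC lerDr addr_ge0.
  move: h1 h2; rewrite !ler_norml => /andP[a1 a2] /andP[b1 b2].
  have hl : l0 <= y - (x1 + d1 * s) by move: rl a1 a2 xy; rewrite /l0; bare_lra.
  have hq : q0 <= x2 + d2 * s - y by move: rq b1 b2 yr; rewrite /q0; bare_lra.
  have l1 := ltW l00; have q1 := ltW q00.
  have lq : 0 <= l0 * l0 * (q0 * q0) by apply: mulr_ge0; exact: mulr_ge0.
  rewrite /kap; apply: ler_pM => //.
    rewrite ramp_pos /T; move: st; bare_lra.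
  rewrite /cone /ramp2 /coneL /coneR.
  rewrite (ramp_pos (le_trans l1 hl)) (ramp_pos (le_trans q1 hq)).
  by apply: ler_pM; [exact: mulr_ge0|exact: mulr_ge0|exact: ler_pM|exact: ler_pM].
pose I := `[x, x + r] : set R.
have mI : measurable I by exact: measurable_itv.
apply: (@le_trans _ _ (\int[mu]_(y in I) (kap * half_dist sg k (v s y))%:E)%E); last first.
  rewrite [leLHS]integral_mkcond; apply: ge0_le_integral => //.
  - move=> y _; rewrite patchE; case: ifP => // _.
    by rewrite lee_fin mulr_ge0 ?half_dist_ge0// ltW.
  - apply: (measurable_restrictT _ mI).1; apply: measurable_funTS.
    by apply/measurable_EFinP; exact: measurable_funM.
  - move=> y _; rewrite patchE; case: ifPn => [|_]; last first.
      by rewrite lee_fin; exact: mass_out_ge0.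
    by rewrite inE /I /= in_itv/= lee_fin; exact: lower.
under eq_integral do rewrite EFinM.
rewrite ge0_integralZl_EFin//;
  try (by move=> y _; rewrite lee_fin half_dist_ge0);
  try (by apply: measurable_funTS; exact/measurable_EFinP);
  try exact: ltW.
rewrite /B EFinM; apply: lee_wpmul2l; first by rewrite lee_fin ltW.
have half : ((r * (e / 2))%:E <= \int[mu]_(y in I) (half_dist sg k (v s y))%:E +
    \int[mu]_(y in I) (`|v s y - v t y|)%:E)%E.
  rewrite -ge0_integralD//;
    try (by move=> y _; rewrite lee_fin half_dist_ge0);
    try (by apply: measurable_funTS; exact/measurable_EFinP).
  apply: (@le_trans _ _ (\int[mu]_(y in I) (e / 2)%:E)%E).
    rewrite integral_cst//= /I lebesgue_measure_itv/= lte_fin ltrDl r0.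
    by rewrite -EFinB -EFinM lee_fin; bare_lra.
  apply: ge0_le_integral => //.
  - by move=> y _; rewrite lee_fin divr_ge0// ltW.
  - apply: measurable_funTS; apply: emeasurable_funD; exact/measurable_EFinP.
  - move=> y; rewrite /I /= in_itv/= => /andP[xy yr].
    rewrite -EFinD lee_fin.
    have h1 := hr1 y ltac:(rewrite xy/=; exact: le_trans yr (lerD (lexx x) rr1)).
    have h2 := half_dist_lip k (v t y) (v s y) sg1.
    by rewrite distrC; apply: le_trans h2.
have small : (\int[mu]_(y in I) (`|v s y - v t y|)%:E <= (r * e / 4)%:E)%E.
  apply: le_trans (hs1 s (ltW s0) _); last first.
    by rewrite ler0_norm ?subr_le0//; move: ts rs s10; bare_lra.
  apply: ge0_subset_integral => //; first exact: measurable_funTS (measurableT_comp _ md).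
  move=> y; rewrite /I /= !in_itv/= => /andP[xy yr].
  have n1 := ler_norm x; have := ler_norm (- x); rewrite normrN => n2.
  by apply/andP; split; move: xy yr r0 n1 n2; bare_lra.
have : ((r * (e / 2))%:E <= \int[mu]_(y in I) (half_dist sg k (v s y))%:E +
   (r * e / 4)%:E)%E by apply: le_trans half _; exact: leeD2l.
rewrite -leeBlDr//; apply: le_trans.
by rewrite -EFinB lee_fin; bare_lra.
Qed.

End Cone.

End Vanish.

(** * Riemann problems *)

Section Riemann.
Context {R : realType}.
Implicit Types (f : R -> R) (k w c : R).

Lemma half_dist_pos_le k w : w <= k -> half_dist 1 k w = 0.
Proof. by move=> wk; rewrite /half_dist ler0_norm; lra. Qed.

Lemma half_dist_pos_gt k w : k < w -> half_dist 1 k w = w - k.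
Proof. by move=> wk; rewrite /half_dist ger0_norm; lra. Qed.

Lemma half_dist_neg_ge k w : k <= w -> half_dist (-1) k w = 0.
Proof. by move=> wk; rewrite /half_dist ger0_norm; lra. Qed.

Lemma half_dist_neg_lt k w : w < k -> half_dist (-1) k w = k - w.
Proof. by move=> wk; rewrite /half_dist ler0_norm; lra. Qed.

Lemma qflux_pos_le f k w : w <= k -> qflux f 1 k w = 0.
Proof. by move=> wk; rewrite /qflux /kflux max_r ?min_l//; lra. Qed.

Lemma qflux_pos_gt f k w : k < w -> qflux f 1 k w = f w - f k.
Proof. by move=> /ltW wk; rewrite /qflux /kflux max_l ?min_r//; lra. Qed.

Lemma qflux_neg_ge f k w : k <= w -> qflux f (-1) k w = 0.
Proof. by move=> wk; rewrite /qflux /kflux max_l ?min_r//; lra. Qed.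

Lemma qflux_neg_lt f k w : w < k -> qflux f (-1) k w = f k - f w.
Proof. by move=> /ltW wk; rewrite /qflux /kflux max_r ?min_l//; lra. Qed.

Section Comparison.
Variables (f v0 : R -> R) (v : R -> R -> R).
Hypothesis hv : entropy_solution f v0 v.
Hypothesis f_lip : forall x y, `|f x - f y| <= `|x - y|.
Hypothesis f_mono : forall x y, x <= y -> f x <= f y.
Hypothesis v_rc : forall t, 0 <= t -> right_continuous (v t).

(** The excess above [k] travels with speed at least [c], so it stays out of the region left of
    [X + c * t]. The left side of the cone moves with speed 1, and no excess overtakes it because
    [f] is 1-Lipschitz. *)
Lemma upper_comparison k c X t x :
  (forall t x, 0 < t -> k < v t x -> c * (v t x - k) <= f (v t x) - f k) ->
  (forall x, x < X -> v0 x <= k) ->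
  0 < t -> x < X + c * t -> v t x <= k.
Proof.
move=> hc h0 t0 xX; rewrite leNgt; apply/negP => kv.
pose d := (X + c * t - x) / 2.
have d0 : 0 < d by apply: divr_gt0 => //; lra.
have := @cone_vanish _ _ _ _ hv f_lip v_rc 1 k (x - 1 - t) 1 (X - d) c d
  (or_introl erefl) _ d0 _ t x t0.
rewrite half_dist_pos_gt// => H; suff : v t x - k = 0 by lra.
apply: H.
- move=> s y s0; have [vk|kv'] := leP (v s y) k.
    by rewrite qflux_pos_le// half_dist_pos_le// !mulr0.
  rewrite qflux_pos_gt// half_dist_pos_gt// mul1r; split; last exact: hc.
  apply: (le_trans (ler_norm _)); apply: (le_trans (f_lip _ _)).
  by rewrite ger0_norm; lra.
- by move=> y /andP[_ yX]; rewrite half_dist_pos_le// h0//; lra.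
- by apply/andP; split; rewrite ?/d; lra.
Qed.

(** The deficit below [k] travels with speed at most [c]; the right side of the cone may be vertical
    because [f] is nondecreasing. *)
Lemma lower_comparison k c X t x :
  (forall t x, 0 < t -> v t x < k -> f k - f (v t x) <= c * (k - v t x)) ->
  (forall x, X < x -> k <= v0 x) ->
  0 < t -> X + c * t < x -> k <= v t x.
Proof.
move=> hc h0 t0 xX; rewrite leNgt; apply/negP => kv.
pose d := (x - (X + c * t)) / 2.
have d0 : 0 < d by apply: divr_gt0 => //; lra.
have := @cone_vanish _ _ _ _ hv f_lip v_rc (-1) k (X + d) c (x + 1) 0 d
  (or_intror erefl) _ d0 _ t x t0.
rewrite half_dist_neg_lt// => H; suff : k - v t x = 0 by lra.
apply: H.
- move=> s y s0; have [kv'|vk] := leP k (v s y).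
    by rewrite qflux_neg_ge// half_dist_neg_ge// !mulr0.
  rewrite qflux_neg_lt// half_dist_neg_lt// mul0r; split; first exact: hc.
  by rewrite subr_ge0 f_mono// ltW.
- by move=> y /andP[yX _]; rewrite half_dist_neg_ge// h0//; lra.
- by apply/andP; split; rewrite ?/d; lra.
Qed.

End Comparison.

Section Sampling.
Variables (f : R -> R) (ul ur : R) (v : R -> R -> R).
Hypothesis hv : riemann_solution f ul ur v.
Hypothesis f_lip : forall x y, `|f x - f y| <= `|x - y|.
Hypothesis f_mono : forall x y, x < y -> f x < f y.
Hypothesis ulr : ul <= ur.

Let f_mono' x y : x <= y -> f x <= f y.
Proof. by rewrite le_eqVlt => /predU1P[->//|/f_mono/ltW]. Qed.

Let ev := proj1 hv.
Let rc := proj2 hv.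

Lemma riemann_range t x : 0 < t -> ul <= v t x <= ur.
Proof.
move=> t0; apply/andP; split.
- apply: (lower_comparison ev f_lip f_mono' rc (c := 1) (X := x - t - 1)) => //.
  + move=> s y _ vk; rewrite mul1r; apply: (le_trans (ler_norm _)).
    by apply: (le_trans (f_lip _ _)); rewrite ger0_norm; lra.
  + by move=> y _; rewrite /riemann_data; case: ifP.
  + lra.
- apply: (upper_comparison ev f_lip rc (c := 0) (X := x + 1)) => //.
  + by move=> s y _ vk; rewrite mul0r subr_ge0; apply: f_mono'; exact: ltW.
  + by move=> y _; rewrite /riemann_data; case: ifP.
  + lra.
Qed.

(** A support line at [p] says exactly that the values above [p] travel with speed at least [th]. *)
Lemma riemann_upper th p t x : supports f ul ur th p -> 0 < t -> x < th * t ->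
  v t x <= p.
Proof.
move=> [/andP[up pu] hp] t0 xt.
apply: (upper_comparison ev f_lip rc (c := th) (X := 0)) => //; last by rewrite add0r.
- move=> s y s0 pv; apply: hp; have /andP[h1 h2] := riemann_range y s0.
  by rewrite h1 h2.
- by move=> y y0; rewrite /riemann_data y0.
Qed.

Lemma riemann_lower th p t x : supports f ul ur th p -> 0 < t -> th * t < x ->
  p <= v t x.
Proof.
move=> [/andP[up pu] hp] t0 xt.
apply: (lower_comparison ev f_lip f_mono' rc (c := th) (X := 0)) => //; last by rewrite add0r.
- move=> s y s0 vp; have /andP[h1 h2] := riemann_range y s0.
  by have := hp (v s y) ltac:(by rewrite h1 h2); lra.
- by move=> y y0; rewrite /riemann_data ltNge (ltW y0).
Qed.

(** The support line at [w] gives the lower bound. For the upper bound, the point th eps is left of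
    the ray of slope [th + d] once t is close to [eps], and the minimizers for [th + d] approach [w]
    because [w] is the largest one for [th]. *)
Lemma riemann_sample th w eps l : 0 < eps -> 0 <= th -> splits f ul ur th w ->
  v t (th * eps) @[t --> eps^'-] --> l -> l = w.
Proof.
move=> e0 th0 [sw wmax] cv.
have [/andP[uw wu] hw] := sw.
have le_lim a : (\forall t \near eps^'-, v t (th * eps) <= a) -> l <= a.
  by move=> h; apply: (@closed_cvg _ _ (eps^'-) _ _ [set x | x <= a] (@closed_le _ a) h).
have ge_lim a : (\forall t \near eps^'-, a <= v t (th * eps)) -> a <= l.
  by move=> h; apply: (@closed_cvg _ _ (eps^'-) _ _ [set x | a <= x] (@closed_ge _ a) h).
have pos : \forall t \near eps^'-, 0 < t < eps.
  near=> t; apply/andP; split; near: t; [exact: nbhs_left_gt|exact: nbhs_left_lt].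
apply/eqP; rewrite eq_le; apply/andP; split; last first.
  apply: ge_lim; near=> t.
  have /andP[t0 te] : 0 < t < eps by near: t.
  (* For [th = 0] the point stays on the ray itself, where the comparison is silent; there strict
     monotonicity of [f] makes [ul] the minimizer. *)
  move: th0; rewrite le_eqVlt => /predU1P[th0|th0].
    rewrite -th0 mul0r; have /andP[h _] := riemann_range 0 t0.
    apply: le_trans h; rewrite leNgt; apply/negP => uw'.
    have := hw ul; rewrite lexx ulr -th0 mul0r => /(_ isT).
    by have := f_mono uw'; lra.
  by apply: (riemann_lower sw) => //; rewrite ltr_pM2l.
rewrite leNgt; apply/negP => wl.
have lu : l <= ur.
  apply: le_lim; near=> t; have /andP[t0 te] : 0 < t < eps by near: t.
  by have /andP[] := riemann_range (th * eps) t0.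
pose w1 := (w + l) / 2.
have w1u : w1 <= ur by rewrite /w1; lra.
have ww1 : w < w1 by rewrite /w1; lra.
(* the minimizers for slopes slightly above th stay below w1 *)
have cf : continuous (fun x => f x - th * x).
  move=> x; apply: cvgB; first exact: (lip_continuous f_lip).
  by apply: cvgM; [exact: cvg_cst|exact: cvg_id].
have [z /[!in_itv]/= /andP[z1 z2] zmin] := EVT_min w1u (continuous_subspaceT cf).
have gap := wmax z ltac:(apply/andP; split; lra).
pose d := (f z - f w - th * (z - w)) / (2 * (ur - w)).
have urw : 0 < ur - w by lra.
have d0 : 0 < d by apply: divr_gt0; [lra|lra].
have dE : 2 * (d * (ur - w)) = f z - f w - th * (z - w).
  by rewrite /d; field; lra.
have cf' : continuous (fun x => f x - (th + d) * x).
  move=> x; apply: cvgB; first exact: (lip_continuous f_lip).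
  by apply: cvgM; [exact: cvg_cst|exact: cvg_id].
have [p /[!in_itv]/= /andP[p1 p2] pmin] := EVT_min ulr (continuous_subspaceT cf').
have sp : supports f ul ur (th + d) p.
  split; first by rewrite p1.
  by move=> x xi; have := pmin x xi; lra.
have pw1 : p < w1.
  rewrite ltNge; apply/negP => wp.
  have h1 := zmin p; rewrite in_itv/= wp p2 in h1; have {}h1 := h1 isT.
  have h2 := pmin w; rewrite in_itv/= uw wu in h2; have {}h2 := h2 isT.
  have : d * (p - w) <= d * (ur - w) by apply: ler_wpM2l; lra.
  have := mulr_gt0 d0 urw; lra.
suff : l <= p by rewrite /w1 in pw1; lra.
have thd : 0 < th + d by lra.
have thd1 : th * eps / (th + d) < eps.
  rewrite ltr_pdivrMr//; have := mulr_gt0 d0 e0; lra.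
apply: le_lim; near=> t.
have /andP[t0 te] : 0 < t < eps by near: t.
apply: (riemann_upper sp) => //.
rewrite (mulrC (th + d)) -ltr_pdivrMr//.
Unshelve. all: end_near. Qed.

Lemma exists_split a b th : a <= b -> exists w, splits f a b th w.
Proof.
move=> ab.
have cf : continuous (fun x => f x - th * x).
  move=> x; apply: cvgB; first exact: (lip_continuous f_lip).
  by apply: cvgM; [exact: cvg_cst|exact: cvg_id].
have [p /[!in_itv]/= pab pmin] := EVT_min ab (continuous_subspaceT cf).
pose m := f p - th * p.
pose Z := `[a, b] `&` [set x | f x - th * x <= m].
have Zc : compact Z.
  apply: (subclosed_compact _ (@segment_compact _ a b)); last by move=> x [].
  apply: closedI; first exact: itv_closed.
  by apply: (@closed_comp _ _ (fun x => f x - th * x) [set y | y <= m]);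
    [move=> x _; exact: cf|exact: closed_le].
have Z0 : Z !=set0 by exists p; split => //=; rewrite in_itv.
have [w /[!inE] -[/= wab wm] wmax] :=
  compact_EVT_max Z0 Zc (continuous_subspaceT (fun x => @cvg_id _ (nbhs x))).
rewrite in_itv/= in wab; exists w; split.
  split => // x xab; have := pmin x; rewrite in_itv/= => /(_ xab).
  by rewrite -/m in wm *; lra.
move=> x /andP[wx xb]; rewrite ltNge; apply/negP => h.
have xZ : x \in Z.
  rewrite inE; split => /=; last by rewrite /m in wm *; lra.
  by rewrite in_itv/=; case/andP: wab => ? _; apply/andP; split; lra.
by have := wmax _ xZ; lra.
Qed.

End Sampling.
End Riemann.

(** * Interaction cost of waves of one sign *)

Section ChangeVar.
Context {R : realType}.
Local Notation mu := (@lebesgue_measure R).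

(** [w] maps the Lebesgue measure on [A] to that on ]a, b]. Measurability of preimages is included,
    so that nothing is asked of [w] outside [A]. *)
Definition transports (A : set R) (w : R -> R) (a b : R) :=
  [/\ measurable A, forall s, A s -> a < w s <= b &
  forall B, measurable B -> measurable (A `&` w @^-1` B) /\
    mu (A `&` w @^-1` B) = mu (`]a, b] `&` B)].

Lemma transports_measurable A w a b : transports A w a b -> measurable_fun A w.
Proof. by move=> [mA _ h] _ B /h[]. Qed.

Lemma transports_measurable_comp A w a b (G : R -> R) : transports A w a b ->
  measurable_fun `]a, b] G -> measurable_fun A (G \o w).
Proof.
move=> tA mG; apply: (@measurable_comp _ _ _ _ _ _ `]a, b]) => //.
  by case: tA => _ h _ _ [s /h As <-]; rewrite /= in_itv.
exact: transports_measurable tA.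
Qed.

Lemma transports_integral A w a b (G : R -> R) : transports A w a b ->
  measurable_fun `]a, b] G -> (forall x, a < x <= b -> 0 <= G x) ->
  (\int[mu]_(s in A) (G (w s))%:E = \int[mu]_(x in `]a, b]) (G x)%:E)%E.
Proof.
move=> tA mG G0; have mw := transports_measurable tA.
have [mA wA hA] := tA.
(* Points outside [A] are sent to [a], which is not in ]a, b]: a globally measurable map with the
   same preimages of subsets of ]a, b]. *)
pose phi s := ((fun s => w s - a) \_ A) s + a.
have phiA s : A s -> phi s = w s by move=> As; rewrite /phi patchE mem_set// subrK.
have phiNA s : ~ A s -> phi s = a by move=> As; rewrite /phi patchE memNset// add0r.
have mphi : measurable_fun setT phi.
  apply: measurable_funD => //; apply: (measurable_restrictT _ mA).1.
  exact: measurable_funB.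
have pre B : B `<=` `]a, b] -> phi @^-1` B = A `&` w @^-1` B.
  move=> Bab; apply/seteqP; split => s /=.
    have [As|nAs] := pselect (A s); first by rewrite phiA.
    by rewrite phiNA// => /Bab; rewrite /= in_itv/= ltxx.
  by move=> [As]; rewrite phiA.
have preI : phi @^-1` `]a, b] = A.
  rewrite pre//; apply/seteqP; split => [s []//|s As]; split => //=.
  by rewrite in_itv/=; exact: wA.
have G0' : {in `]a, b], forall x, (0 <= (EFin \o G) x)%E}.
  by move=> x; rewrite inE /= in_itv/= lee_fin; exact: G0.
have mG' : measurable_fun `]a, b] (EFin \o G) by exact/measurable_EFinP.
pose T := measurableTypeR R.
pose mphi_mixin := isMeasurableFun.Build _ _ T T phi mphi.
pose phim : {mfun T >-> T} := HB.pack phi mphi_mixin.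
have H := @ge0_integral_pushforward _ _ T T R phim mphi (@lebesgue_measure R)
  `]a, b] (EFin \o G) (measurable_itv _) mG' G0'.
have E := @eq_measure_integral _ T R `]a, b] (@lebesgue_measure R)
  (pushforward (@lebesgue_measure R) phim) (EFin \o G).
transitivity (\int[mu]_(x in phim @^-1` `]a, b]) ((EFin \o G) \o phim) x)%E.
  have -> : phim @^-1` `]a, b] = A by exact: preI.
  by apply: eq_integral => s; rewrite inE => As; rewrite /= phiA.
rewrite -H (E mphi)// => B mB BI.
apply: (@eq_trans _ _ (mu (A `&` w @^-1` B))); first by rewrite -(pre _ BI).
by have [_ ->] := hA _ mB; rewrite setIidr.
Qed.

End ChangeVar.

Section Extrema.
Context {R : realType}.
Implicit Types (h : R -> R) (Q : set R).

Lemma continuous_inf_ge0 h Q : continuous h -> has_inf Q ->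
  (forall l, Q l -> 0 <= h l) -> 0 <= h (inf Q).
Proof.
move=> ch Qi hQ; rewrite leNgt; apply/negP => hlt.
have : \forall z \near inf Q, h z < 0 by apply: (cvgr_lt (h (inf Q)) (ch _)).
move=> /nbhs_ballP[r /= r0 hr]; have [l Ql lt] := inf_adherent r0 Qi.
have : h l < 0; last by rewrite ltNge hQ.
apply: hr; rewrite /ball /= ler0_norm ?subr_le0; last first.
  by apply: ge_inf => //; exact: Qi.2.
by rewrite opprB ltrBlDl.
Qed.

Lemma continuous_sup_ge0 h Q : continuous h -> has_sup Q ->
  (forall l, Q l -> 0 <= h l) -> 0 <= h (sup Q).
Proof.
move=> ch Qs hQ; rewrite leNgt; apply/negP => hlt.
have : \forall z \near sup Q, h z < 0 by apply: (cvgr_lt (h (sup Q)) (ch _)).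
move=> /nbhs_ballP[r /= r0 hr]; have [l Ql lt] := sup_adherent r0 Qs.
have : h l < 0; last by rewrite ltNge hQ.
apply: hr; rewrite /ball /= ger0_norm ?subr_ge0; last first.
  by apply: ub_le_sup => //; exact: Qs.2.
by rewrite ltrBlDl -ltrBlDr.
Qed.

End Extrema.

Section IntFamily.
Context {d : measure_display} {R : realType} {T : measurableType d}.

Definition int_family (A : int -> set T) (k : nat) : set T :=
  if (pickle_inv k : option int) is Some m then A m else set0.

Lemma int_family_sub (A : int -> set T) k s : int_family A k s -> exists m, A m s.
Proof. by rewrite /int_family; case: pickle_inv => // m h; exists m. Qed.

Lemma bigcup_int_family (A : int -> set T) :
  \bigcup_k int_family A k = [set s | exists m, A m s].
Proof.
apply/seteqP; split => s; first by move=> [k _]; exact: int_family_sub.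
move=> [m Am]; exists (pickle m); first by [].
by rewrite /int_family pickleK_inv; exact: Am.
Qed.

Lemma int_family_measurable (A : int -> set T) :
  (forall m, measurable (A m)) -> forall k, measurable (int_family A k).
Proof. by move=> mA k; rewrite /int_family; case: pickle_inv. Qed.

Lemma int_family_trivIset (A : int -> set T) :
  (forall m m' s, A m s -> A m' s -> m = m') -> trivIset setT (int_family A).
Proof.
move=> inj k k' _ _ [s []]; rewrite /int_family.
have := @pickle_invK int k; have := @pickle_invK int k'.
case: (pickle_inv k') => [m'|//] /=; case: (pickle_inv k) => [m|//] /= <- <-.
by move=> h h'; rewrite (inj _ _ _ h h').
Qed.

Lemma measure_int_family (mu : {measure set T -> \bar R}) (A : int -> set T) :
  (forall m, measurable (A m)) ->
  (forall m m' s, A m s -> A m' s -> m = m') ->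
  (\sum_(0 <= k <oo) mu (int_family A k))%E = mu [set s | exists m, A m s].
Proof.
move=> mA inj; rewrite -bigcup_int_family measure_semi_bigcup//.
- exact: int_family_measurable.
- exact: int_family_trivIset.
- by apply: bigcupT_measurable; exact: int_family_measurable.
Qed.

End IntFamily.

(** * Abstract wave scheme for one sign *)

Section WaveScheme.
Context {R : realType}.
Local Notation mu := (@lebesgue_measure R).
Local Notation mu2 := (mu \x mu)%E.
Variables (K : R) (g dg : R -> R).
Hypothesis gK : admissible_flux K g dg.
Variables (y : nat -> int -> R) (at_ : nat -> int -> set R) (w : R -> R).
(* [at_ n m] is the set of the waves at node m; their states [w s] fill
   ]y n (m - 1), y n m]. *)
Hypothesis y_split : forall n m, y n (m - 1) < y n m ->
  exists th, splits g (y n (m - 1)) (y n m) th (y n.+1 m).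
Hypothesis y_between_le : forall n m, y n (m - 1) <= y n m ->
  y n (m - 1) <= y n.+1 m <= y n m.
Hypothesis y_between_ge : forall n m, y n m <= y n (m - 1) ->
  y n m <= y n.+1 m <= y n (m - 1).
Hypothesis at_inj : forall n m m' s, at_ n m s -> at_ n m' s -> m = m'.
Hypothesis at_step : forall n m s, at_ n.+1 m s <->
  (at_ n (m - 1) s \/ at_ n m s) /\ y n.+1 (m - 1) < w s <= y n.+1 m.
Hypothesis at0 : forall m, transports (at_ 0 m) w (y 0 (m - 1)) (y 0 m).

Lemma transports_sub (A : set R) a b a' b' : transports A w a b ->
  a <= a' -> b' <= b -> transports (A `&` w @^-1` `]a', b']) w a' b'.
Proof.
move=> [mA wA hA] aa bb; split.
- by have [] := hA `]a', b'] (measurable_itv _).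
- by move=> s [_]; rewrite /= in_itv.
move=> B mB; have mB' : measurable (`]a', b'] `&` B) by apply: measurableI.
have [h1 h2] := hA _ mB'.
have -> : A `&` w @^-1` `]a', b'] `&` w @^-1` B = A `&` w @^-1` (`]a', b'] `&` B).
  by rewrite -setIA -preimage_setI.
split => //; rewrite h2 setIA; congr (mu (_ `&` _)).
apply/seteqP; split => [x []//|x /=]; rewrite !in_itv/= => /andP[x1 x2].
by split; apply/andP; split => //; lra.
Qed.

(** Both new endpoints lie between neighbouring old values, so the new interval at [m] is covered by
    the old ones at [m - 1] and [m]; measures add up since the old packets are disjoint. *)
Lemma transports_at n m : transports (at_ n m) w (y n (m - 1)) (y n m).
Proof.
elim: n m => [|n IH] m; first exact: at0.
pose I := `]y n.+1 (m - 1), y n.+1 m] : set R.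
have mI : measurable I by exact: measurable_itv.
have E B : at_ n.+1 m `&` w @^-1` B =
    (at_ n (m - 1) `&` w @^-1` (I `&` B)) `|` (at_ n m `&` w @^-1` (I `&` B)).
  apply/seteqP; split => s.
    move=> [/at_step[[|] h wI] wB]; [left|right]; split => //; split => //;
      by rewrite /I /= in_itv.
  by move=> [|] [h []]; rewrite /I /= in_itv/= => wI wB; split => //;
    apply/at_step; split => //; [left|right].
have disj B : at_ n (m - 1) `&` w @^-1` B `&` (at_ n m `&` w @^-1` B) = set0.
  apply/seteqP; split => // s [[h1 _] [h2 _]]; have := at_inj h1 h2; lia.
have lo (x : R) : y n.+1 (m - 1) < x -> x <= y n (m - 1) -> y n (m - 1 - 1) < x.
  move=> x1 xl; have [h|h] := leP (y n (m - 1 - 1)) (y n (m - 1)).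
    by have /andP[h' _] := y_between_le h; apply: le_lt_trans h' x1.
  by have /andP[h' _] := y_between_ge (ltW h); lra.
have hi (x : R) : x <= y n.+1 m -> y n (m - 1) < x -> x <= y n m.
  move=> x2 xr; have [h|h] := leP (y n (m - 1)) (y n m).
    by have /andP[_ h'] := y_between_le h; apply: le_trans x2 h'.
  by have /andP[_ h'] := y_between_ge (ltW h); lra.
have [mA1 w1 h1] := IH (m - 1); have [mA2 w2 h2] := IH m.
split.
- have := E setT; rewrite preimage_setT !setIT => ->.
  by apply: measurableU; [have [] := h1 _ mI|have [] := h2 _ mI].
- by move=> s /at_step[].
move=> B mB; rewrite E.
have mIB : measurable (I `&` B) by exact: measurableI.
have [m1 e1] := h1 _ mIB; have [m2 e2] := h2 _ mIB.
split; first exact: measurableU.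
rewrite measureU//=.
apply: (@eq_trans _ _ (mu (`]y n (m - 1 - 1), y n (m - 1)] `&` (I `&` B)) +
   mu (`]y n (m - 1), y n m] `&` (I `&` B)))%E).
  by congr (_ + _)%E.
rewrite -measureU//; last 3 first.
- exact: measurableI.
- exact: measurableI.
- apply/seteqP; split => // x [[+ _] [+ _]]; rewrite /= !in_itv/=.
  by move=> /andP[_ x1] /andP[x2 _]; have := lt_le_trans x2 x1; rewrite ltxx.
congr mu; apply/seteqP; split => x.
  by move=> [|] [_ []].
move=> [xI xB]; have := xI; rewrite /I /= in_itv/= => /andP[x1 x2].
have [xl|xr] := leP x (y n (m - 1)); [left|right]; split => //;
  rewrite /= in_itv/= ?xl ?xr ?andbT/=.
  exact: lo.
exact: hi.
Qed.

Let at0_range m s : at_ 0 m s -> y 0 (m - 1) < w s <= y 0 m.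
Proof. by case: (at0 m) => _ h _; exact: h. Qed.

Lemma at_range n m s : at_ n m s -> y n (m - 1) < w s <= y n m.
Proof. by case: n => [|n]; [exact: at0_range|move/at_step => []]. Qed.

Lemma at_prev n m s : at_ n.+1 m s -> exists2 m', at_ n m' s & m' <= m <= m' + 1.
Proof.
by move=> /at_step[[|] h _]; [exists (m - 1)|exists m] => //; lia.
Qed.

Lemma at_alive n k m s : (k <= n)%N -> at_ n m s -> exists m', at_ k m' s.
Proof.
elim: n m => [|n IH] m; first by rewrite leqn0 => /eqP ->; exists m.
rewrite leq_eqVlt => /predU1P[->|]; first by exists m.
by rewrite ltnS => kn /at_prev[m' h _]; exact: IH kn h.
Qed.

Definition met n s s' := exists k j, [/\ (k <= n)%N, at_ k j s & at_ k j s'].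

Lemma met_succ n s s' m m' : met n.+1 s s' -> at_ n.+1 m s -> at_ n.+1 m' s' ->
  m <> m' -> met n s s'.
Proof.
move=> [k [j [kn h1 h2]]] a1 a2 mm.
move: kn; rewrite leq_eqVlt => /predU1P[kE|]; last by exists k, j.
by move: h1 h2; rewrite kE => /at_inj/(_ a1) h1 /at_inj/(_ a2) h2; case: mm; rewrite -h1.
Qed.

(** No decrease can come between two waves that have met: at an inner node, [y n.+1 (k - 1) <= y n
    (k - 1) <= y n.+1 k] by the previous step; at the end nodes the waves themselves witness an
    increase. *)
Lemma met_monotone n s s' m m' : met n s s' -> at_ n m s -> at_ n m' s' -> m <= m' ->
  forall k, m <= k <= m' -> y n (k - 1) <= y n k.
Proof.
elim: n s s' m m' => [|n IH] s s' m m' hm a1 a2 mm k /andP[mk km].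
  case: hm => k0 [j [+ h1 h2]]; rewrite leqn0 => /eqP k00.
  rewrite k00 in h1 h2.
  have e1 := at_inj h1 a1; have e2 := at_inj h2 a2.
  have -> : k = m by lia.
  by have /andP[/lt_le_trans + h] := at_range a1 => /(_ _ h)/ltW.
have [->|km'] := eqVneq k m.
  by have /andP[/lt_le_trans + h] := at_range a1 => /(_ _ h)/ltW.
have [->|km''] := eqVneq k m'.
  by have /andP[/lt_le_trans + h] := at_range a2 => /(_ _ h)/ltW.
have [p hp /andP[p1 p2]] := at_prev a1.
have [p' hp' /andP[p1' p2']] := at_prev a2.
have hm' : met n s s' by apply: met_succ hm a1 a2 _; lia.
have mono := IH _ _ _ _ hm' hp hp' ltac:(lia).
have /andP[_ h1] := y_between_le (mono (k - 1) ltac:(lia)).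
have /andP[h2 _] := y_between_le (mono k ltac:(lia)).
exact: le_trans h1 h2.
Qed.

Lemma mono_chain n (m m' : int) : m <= m' ->
  (forall k, m < k <= m' -> y n (k - 1) <= y n k) -> y n m <= y n m'.
Proof.
move=> mm; have [j ->] : exists j : nat, m' = m + j%:Z by exists `|m' - m|%N; lia.
elim: j => [|j IH] h; first by rewrite addr0.
apply: (le_trans (IH _)).
  by move=> k kj; apply: h; lia.
have := h (m + j.+1%:Z) ltac:(lia).
by have -> : m + j.+1%:Z - 1 = m + j%:Z by lia.
Qed.

Lemma met_between n s s' m m' k : met n s s' -> at_ n m s -> at_ n m' s' ->
  m <= k -> k < m' -> w s <= y n k /\ y n k < w s'.
Proof.
move=> hm a1 a2 mk km.
have mono := met_monotone hm a1 a2 ltac:(lia).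
have /andP[_ h1] := at_range a1; have /andP[h2 _] := at_range a2.
split.
  apply: (le_trans h1); apply: mono_chain => // j jk; apply: mono; lia.
apply: le_lt_trans h2; apply: mono_chain; first lia.
by move=> j jk; apply: mono; lia.
Qed.

(* Memory of the scheme: the cut made at a node lies on the hull of the packet
   that is cut, and its slope, or the one inherited from the neighbouring node,
   keeps separating the waves that have met. *)
Lemma met_slope n m : exists c, forall s s' m1 m2, met n s s' ->
  at_ n m1 s -> at_ n m2 s' -> m1 <= m -> m < m2 ->
  (forall v, w s <= v <= y n m -> g (y n m) - g v <= c * (y n m - v)) /\
  (forall v, y n m <= v <= w s' -> c * (v - y n m) <= g v - g (y n m)).
Proof.
elim: n m => [|n IH] m.
  exists 0 => s s' m1 m2 [k [j [+ h1 h2]]] a1 a2; rewrite leqn0 => /eqP k0.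
  rewrite k0 in h1 h2; have := at_inj h1 a1; have := at_inj h2 a2; lia.
have [c1 H1] := IH (m - 1); have [c2 H2] := IH m.
have prev s m1 : at_ n.+1 m1 s -> m1 <= m ->
    (exists2 p, at_ n p s & p <= m - 1) \/ at_ n m s.
  move=> /at_step[[|] h _] m1m; first by left; exists (m1 - 1) => //; lia.
  have [->|ne] := eqVneq m m1; first by right.
  by left; exists m1 => //; lia.
have prev' s m2 : at_ n.+1 m2 s -> m < m2 ->
    (exists2 p, at_ n p s & m < p) \/ at_ n m s.
  move=> /at_step[[|] h _] m1m; last by left; exists m2.
  have [e|ne] := eqVneq m (m2 - 1); first by right; rewrite e.
  by left; exists (m2 - 1) => //; lia.
have rng s m1 : at_ n.+1 m1 s -> at_ n m s -> m1 <= m -> w s <= y n.+1 m /\ m1 = m.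
  move=> /at_step[[|] h /andP[_ h']] hm m1m.
    by have := at_inj h hm; lia.
  by have E := at_inj h hm; rewrite E in h'.
have rng' s m2 : at_ n.+1 m2 s -> at_ n m s -> m < m2 -> y n.+1 m < w s.
  move=> /at_step[[|] h /andP[h' _]] hm m1m; last by have := at_inj h hm; lia.
  by have E := at_inj h hm; rewrite E in h'.
(* The boundary value [y n.+1 m] is the old one on the left or on the right, whose slope is kept, or
   else a genuine cut in the packet of node [m], whose slope is [th]. *)
have [e1|ne1] := eqVneq (y n.+1 m) (y n (m - 1)).
  exists c1 => s s' m1 m2 hm a1 a2 mm1 mm2.
  have hm' : met n s s' by apply: met_succ hm a1 a2 _; lia.
  rewrite e1.
  have [[p hp pm]|h] := prev _ _ a1 mm1; last first.
    exfalso; have [r1 _] := rng _ _ a1 h mm1; have /andP[r2 _] := at_range h.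
    by rewrite e1 in r1; lra.
  have [[p' hp' pm']|h'] := prev' _ _ a2 mm2.
    by apply: (H1 _ _ _ _ hm' hp hp'); lia.
  by apply: (H1 _ _ _ _ hm' hp h'); lia.
have [e2|ne2] := eqVneq (y n.+1 m) (y n m).
  exists c2 => s s' m1 m2 hm a1 a2 mm1 mm2.
  have hm' : met n s s' by apply: met_succ hm a1 a2 _; lia.
  rewrite e2.
  have [[p' hp' pm']|h'] := prev' _ _ a2 mm2; last first.
    exfalso; have r1 := rng' _ _ a2 h' mm2; have /andP[_ r2] := at_range h'.
    by rewrite e2 in r1; lra.
  have [[p hp pm]|h] := prev _ _ a1 mm1.
    by apply: (H2 _ _ _ _ hm' hp hp'); clear - pm pm'; lia.
  by apply: (H2 _ _ _ _ hm' h hp'); clear - pm'; lia.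
(* Two waves that have met cannot straddle a node with a decrease, so the claim is vacuous there. *)
have [lt|ge] := ltP (y n (m - 1)) (y n m); last first.
  exists 0 => s s' m1 m2 hm a1 a2 mm1 mm2; exfalso.
  have hm' : met n s s' by apply: met_succ hm a1 a2 _; lia.
  have /andP[i1 i2] := y_between_ge ge.
  have nat_m s0 : ~ at_ n m s0 by move=> /at_range/andP[]; lra.
  have [[p hp pm]|/nat_m//] := prev _ _ a1 mm1.
  have [[p' hp' pm']|/nat_m//] := prev' _ _ a2 mm2.
  have := met_monotone hm' hp hp' ltac:(lia) (k := m) ltac:(lia) => le.
  have E : y n m = y n (m - 1) by apply/eqP; rewrite eq_le ge le.
  by move/eqP: ne1; apply; apply/eqP; rewrite eq_le i2 -E i1.
have [th [[/andP[i1 i2] sup] _]] := y_split lt.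
have {ne1} i1' : y n (m - 1) < y n.+1 m by rewrite lt_neqAle eq_sym ne1.
have {ne2} i2' : y n.+1 m < y n m by rewrite lt_neqAle ne2.
exists th => s s' m1 m2 hm a1 a2 mm1 mm2.
have hm' : met n s s' by apply: met_succ hm a1 a2 _; lia.
have ws : w s <= y n.+1 m by have [] := met_between hm a1 a2 mm1 mm2.
have ws' : y n.+1 m < w s' by have [] := met_between hm a1 a2 mm1 mm2.
split => v /andP[v1 v2].
  have [iv|vi] := leP (y n (m - 1)) v.
    by have := sup v ltac:(apply/andP; split; lra); lra.
  have [[p hp pm]|h] := prev _ _ a1 mm1; last first.
    by have /andP[] := at_range h; lra.
  have [G1 G2] : (forall v, w s <= v <= y n (m - 1) ->
      g (y n (m - 1)) - g v <= c1 * (y n (m - 1) - v)) /\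
      (forall v, y n (m - 1) <= v <= w s' ->
       c1 * (v - y n (m - 1)) <= g v - g (y n (m - 1))).
    have [[p' hp' pm']|h'] := prev' _ _ a2 mm2.
      by apply: (H1 _ _ _ _ hm' hp hp'); clear - pm pm'; lia.
    by apply: (H1 _ _ _ _ hm' hp h'); clear - pm; lia.
  have b1 := G1 v ltac:(apply/andP; split; lra).
  have b2 := G2 (y n.+1 m) ltac:(apply/andP; split; lra).
  have b3 := sup (y n (m - 1)) ltac:(apply/andP; split; lra).
  (* Both slopes are compared with the secant from [y n (m - 1)] to the cut. Since [c1 <= th], the
     separation by [th] extends beyond the packet that is cut. *)
  have c1th : c1 <= th.
    have d0 : 0 < y n.+1 m - y n (m - 1) by lra.
    by rewrite -(ler_pM2r d0); lra.
  have : c1 * (y n (m - 1) - v) <= th * (y n (m - 1) - v) by apply: ler_wpM2r => //; lra.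
  lra.
have [vi|iv] := leP v (y n m).
  by have := sup v ltac:(apply/andP; split; lra); lra.
have [[p' hp' pm']|h'] := prev' _ _ a2 mm2; last first.
  by have /andP[] := at_range h'; lra.
have [G1 G2] : (forall v, w s <= v <= y n m ->
    g (y n m) - g v <= c2 * (y n m - v)) /\
    (forall v, y n m <= v <= w s' -> c2 * (v - y n m) <= g v - g (y n m)).
  have [[p hp pm]|h] := prev _ _ a1 mm1.
    by apply: (H2 _ _ _ _ hm' hp hp'); clear - pm pm'; lia.
  by apply: (H2 _ _ _ _ hm' h hp'); clear - pm'; lia.
have b1 := G2 v ltac:(apply/andP; split; lra).
have b2 := G1 (y n.+1 m) ltac:(apply/andP; split; lra).
have b3 := sup (y n m) ltac:(apply/andP; split; lra).
have thc2 : th <= c2.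
  have d0 : 0 < y n m - y n.+1 m by lra.
  by rewrite -(ler_pM2r d0); lra.
have : th * (v - y n m) <= c2 * (v - y n m) by apply: ler_wpM2r => //; lra.
lra.
Qed.

Lemma secant_continuous x c : continuous (fun v => g v - g x - c * (v - x)).
Proof.
move=> v; apply: cvgB.
  by apply: cvgB; [exact: (flux_continuous gK)|exact: cvg_cst].
by apply: cvgM; [exact: cvg_cst|apply: cvgB; [exact: cvg_id|exact: cvg_cst]].
Qed.

(** Applied to the states of left waves that have already met the right packet: those below [a2]
    have not. The inequality passes to the infimum by continuity; adding [x] to the set gives
    [a2 = x] when [P] is empty. *)
Lemma memory_left (P : set R) (p x c : R) : p <= x ->
  (forall l, P l -> [/\ p <= l, l <= x &
    forall v, l <= v <= x -> g x - g v <= c * (x - v)]) ->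
  exists a2, [/\ p <= a2 <= x, forall l, P l -> a2 <= l & g x - g a2 <= c * (x - a2)].
Proof.
move=> px hP; pose Q := P `|` [set x].
have Qi : has_inf Q.
  split; first by exists x; right.
  by exists p => l [/hP[]//|->].
exists (inf Q); split.
- apply/andP; split; last by apply: ge_inf; [exact: Qi.2|right].
  by apply: lb_le_inf Qi.1 _ => l [/hP[]//|->].
- by move=> l Pl; apply: ge_inf; [exact: Qi.2|left].
suff : 0 <= g (inf Q) - g x - c * (inf Q - x) by lra.
apply: (continuous_inf_ge0 (@secant_continuous x c) Qi).
move=> l [/hP[_ lx /(_ l)]|->]; last by rewrite !subrr mulr0 subr0.
by rewrite lexx lx => /(_ isT); lra.
Qed.

Lemma memory_right (P : set R) (q x c : R) : x <= q ->
  (forall l, P l -> [/\ x <= l, l <= q &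
    forall v, x <= v <= l -> c * (v - x) <= g v - g x]) ->
  exists c2, [/\ x <= c2 <= q, forall l, P l -> l <= c2 & c * (c2 - x) <= g c2 - g x].
Proof.
move=> xq hP; pose Q := P `|` [set x].
have Qs : has_sup Q.
  split; first by exists x; right.
  by exists q => l [/hP[]//|->].
exists (sup Q); split.
- apply/andP; split; first by apply: ub_le_sup; [exact: Qs.2|right].
  by apply: ge_sup Qs.1 _ => l [/hP[]//|->].
- by move=> l Pl; apply: ub_le_sup; [exact: Qs.2|left].
rewrite -subr_ge0; apply: (continuous_sup_ge0 (@secant_continuous x c) Qs).
move=> l [/hP[xl _ /(_ l)]|->]; last by rewrite !subrr mulr0 subr0.
by rewrite lexx xl => /(_ isT); rewrite subr_ge0.
Qed.

Variable F : nat -> R -> R.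
Hypothesis speedE : forall n m s, at_ n m s ->
  F n s = hull_slope g (y n (m - 1)) (y n m) (w s).
Variables (Om : set R) (v : R).
Hypothesis mOm : measurable Om.
Hypothesis muOm : mu Om = v%:E.
Hypothesis at_Om : forall n m, at_ n m `<=` Om.

(** The wave is directed to [m], fast from [m - 1] or slow at [m] as expressed by the cuts, but is
    found at no node afterwards. *)
Definition dies n m s := (at_ n (m - 1) s /\ y n.+1 (m - 1) < w s \/
  at_ n m s /\ w s <= y n.+1 m) /\ forall m', ~ at_ n.+1 m' s.

Definition speed_change n s := `|F n.+1 s - F n s|.

Lemma transports_cost A a b (G : R -> R) n : transports A w a b ->
  measurable_fun `]a, b] G -> (forall x, a < x <= b -> 0 <= G x) ->
  (forall s, A s -> speed_change n s = G (w s)) ->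
  measurable_fun A (speed_change n) /\
  (\int[mu]_(s in A) (speed_change n s)%:E = \int[mu]_(x in `]a, b]) (G x)%:E)%E.
Proof.
move=> tA mG G0 FG; split.
  apply: eq_measurable_fun (transports_measurable_comp tA mG).
  by move=> s; rewrite inE => /FG ->.
rewrite -(transports_integral tA mG G0); apply: eq_integral => s.
by rewrite inE => /FG ->.
Qed.

Lemma transports_measure A a b : transports A w a b -> a <= b -> mu A = (b - a)%:E.
Proof.
move=> [mA wA hA] ab; have [_] := hA setT measurableT.
rewrite preimage_setT !setIT => ->; rewrite lebesgue_measure_itv/= lte_fin.
case: ltP => [//|ba]; have -> : a = b by apply/eqP; rewrite eq_le ab.
by rewrite subrr.
Qed.

Lemma measurable_hull_diff (a b a' b' x z : R) : a < b -> a' < b' -> a <= x -> z <= b ->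
  a' <= x -> z <= b' ->
  measurable_fun `]x, z] (fun p => `|hull_slope g a b p - hull_slope g a' b' p|).
Proof.
move=> ab ab' ax zb ax' zb'; apply: measurableT_comp => //; apply: measurable_funB.
  apply: measurable_funS (measurable_hull_slope gK ab) => // p.
  by rewrite /= !in_itv/= => /andP[? ?]; apply/andP; split; lra.
apply: measurable_funS (measurable_hull_slope gK ab') => // p.
by rewrite /= !in_itv/= => /andP[? ?]; apply/andP; split; lra.
Qed.

(** The survivors come from the left packet, whose states above [y n.+1 m] are cancelled and form
    [D]. The gap left by their loss is at most [K] times the lengths of the surviving and cancelled
    parts; the former is at most [v], the latter is the measure of [D]. *)
Lemma node_cost_right n m : y n.+1 (m - 1) < y n.+1 m -> y n.+1 m <= y n (m - 1) ->
  exists D, [/\ measurable D, D `<=` dies n m,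
    measurable_fun (at_ n.+1 m) (speed_change n) &
    (\int[mu]_(s in at_ n.+1 m) (speed_change n s)%:E <= (K * v)%:E * mu D)%E].
Proof.
set al := y n.+1 (m - 1); set be := y n.+1 m; set x1 := y n (m - 1) => ab bx.
set x0 := y n (m - 1 - 1).
have x0x1 : x0 < x1.
  rewrite ltNge; apply/negP => h.
  by have /andP[] := y_between_ge h; rewrite -/al -/x1 -/x0; lra.
have [th sp] := y_split x0x1; rewrite -/al -/x0 -/x1 in sp.
have [/andP[x0a _] _] := sp.1.
have tA : transports (at_ n (m - 1) `&` w @^-1` `]al, be]) w al be.
  by apply: (transports_sub (transports_at n (m - 1))); rewrite -/x0 -/x1.
have AE : at_ n.+1 m = at_ n (m - 1) `&` w @^-1` `]al, be].
  apply/seteqP; split => s.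
    move=> /at_step[[|] h wI]; first by split => //=; rewrite in_itv.
    by case: (transports_at n m) => _ /(_ _ h) /andP[+ _] _; case/andP: wI; rewrite -/x1 -/be; lra.
  by move=> [h] /=; rewrite in_itv/= => wI; apply/at_step; split => //; left.
have tD : transports (at_ n (m - 1) `&` w @^-1` `]be, x1]) w be x1.
  by apply: (transports_sub (transports_at n (m - 1))); rewrite -/x0 -/x1//; lra.
have muD := transports_measure tD bx.
exists (at_ n (m - 1) `&` w @^-1` `]be, x1]).
have ax1 : al < x1 by lra.
have mG : measurable_fun `]al, be]
    (fun p => `|hull_slope g al x1 p - hull_slope g al be p|).
  by apply: measurable_hull_diff; lra.
have [||mX IX] := @transports_cost _ _ _ _ n tA mG.
- by move=> p _.
- move=> s [h]; rewrite /= in_itv/= => /andP[w1 w2].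
  have a1 : at_ n.+1 m s by rewrite AE; split => //=; rewrite in_itv/= w1.
  rewrite /speed_change (speedE a1) (speedE h) -/al -/be -/x0 -/x1.
  by rewrite distrC (hull_slope_split_right gK sp) ?w1//= (le_trans w2 bx).
split => //.
- by case: tD.
- move=> s [h]; rewrite /= in_itv/= => /andP[w1 w2]; split.
    by left; split => //; exact: lt_trans ab w1.
  move=> m' /at_step[[|] h' /andP[w3 w4]]; have E := at_inj h h'.
    have mE : m' = m by move: E; clear; lia.
    by rewrite mE -/be in w4; lra.
  by rewrite -E -/al in w4; lra.
- by rewrite AE.
rewrite AE IX (integral_hull_extend_right gK ab bx) muD -EFinM lee_fin.
apply: (le_trans (conv_env_gap_le gK ax1 _)); first by apply/andP; split; lra.
rewrite -mulrA ler_wpM2l ?(flux_const_ge0 gK)// ler_wpM2r//; first lra.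
rewrite -lee_fin -muOm -(transports_measure tA (ltW ab)).
apply: le_measure; rewrite ?inE//; first by case: tA.
by move=> s [h _]; exact: at_Om h.
Qed.

(** Mirror image of [node_cost_right]: the right packet loses its states up to [y n.+1 (m - 1)]. *)
Lemma node_cost_left n m : y n.+1 (m - 1) < y n.+1 m -> y n (m - 1) <= y n.+1 (m - 1) ->
  exists D, [/\ measurable D, D `<=` dies n m,
    measurable_fun (at_ n.+1 m) (speed_change n) &
    (\int[mu]_(s in at_ n.+1 m) (speed_change n s)%:E <= (K * v)%:E * mu D)%E].
Proof.
set al := y n.+1 (m - 1); set be := y n.+1 m; set x1 := y n (m - 1) => ab xa.
set x2 := y n m.
have x1x2 : x1 < x2.
  rewrite ltNge; apply/negP => h.
  by have /andP[] := y_between_ge h; rewrite -/be -/x1 -/x2; lra.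
have [th sp] := y_split x1x2; rewrite -/be -/x1 -/x2 in sp.
have [/andP[_ bx2] _] := sp.1.
have tA : transports (at_ n m `&` w @^-1` `]al, be]) w al be.
  by apply: (transports_sub (transports_at n m)); rewrite -/x1 -/x2.
have AE : at_ n.+1 m = at_ n m `&` w @^-1` `]al, be].
  apply/seteqP; split => s.
    move=> /at_step[[|] h wI]; last by split => //=; rewrite in_itv.
    by case: (transports_at n (m - 1)) => _ /(_ _ h) /andP[_ +] _; case/andP: wI; rewrite -/x1 -/al; lra.
  by move=> [h] /=; rewrite in_itv/= => wI; apply/at_step; split => //; right.
have tD : transports (at_ n m `&` w @^-1` `]x1, al]) w x1 al.
  by apply: (transports_sub (transports_at n m)); rewrite -/x1 -/x2//; lra.
have muD := transports_measure tD xa.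
exists (at_ n m `&` w @^-1` `]x1, al]).
have x1b : x1 < be by lra.
have mG : measurable_fun `]al, be]
    (fun p => `|hull_slope g al be p - hull_slope g x1 be p|).
  by apply: measurable_hull_diff; lra.
have [||mX IX] := @transports_cost _ _ _ _ n tA mG.
- by move=> p _.
- move=> s [h]; rewrite /= in_itv/= => /andP[w1 w2].
  have a1 : at_ n.+1 m s by rewrite AE; split => //=; rewrite in_itv/= w1.
  rewrite /speed_change (speedE a1) (speedE h) -/al -/be -/x1 -/x2.
  by rewrite (hull_slope_split_left gK sp) ?w2// (le_lt_trans xa w1).
split => //.
- by case: tD.
- move=> s [h]; rewrite /= in_itv/= => /andP[w1 w2]; split.
    by right; split => //; rewrite -/be; lra.
  move=> m' /at_step[[|] h' /andP[w3 w4]]; have E := at_inj h h'.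
    have mE : m' - 1 = m by move: E; clear; lia.
    by rewrite mE -/be in w3; lra.
  by rewrite -E -/al in w3; lra.
- by rewrite AE.
rewrite AE IX (integral_hull_extend_left gK ab xa) muD -EFinM lee_fin.
apply: (le_trans (conv_env_gap_le gK x1b _)); first by apply/andP; split; lra.
rewrite -mulrA ler_wpM2l ?(flux_const_ge0 gK)// mulrC ler_wpM2r//; first lra.
rewrite -lee_fin -muOm -(transports_measure tA (ltW ab)).
apply: le_measure; rewrite ?inE//; first by case: tA.
by move=> s [h _]; exact: at_Om h.
Qed.

Lemma transports_measure_itv (A : set R) (a b a' b' : R) : transports A w a b -> a <= a' ->
  b' <= b -> a' <= b' -> measurable (A `&` w @^-1` `]a', b'[) /\
  mu (A `&` w @^-1` `]a', b'[) = (b' - a')%:E.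
Proof.
move=> [mA _ hA] aa bb ab; have [h1 ->] := hA `]a', b'[ (measurable_itv _).
split => //; have -> : `]a, b] `&` `]a', b'[ = `]a', b'[.
  apply/seteqP; split => [x []//|x /=]; rewrite !in_itv/= => /andP[x1 x2].
  split; last by rewrite x1.
  by rewrite (le_lt_trans aa x1)/= ltW// (lt_le_trans x2).
rewrite lebesgue_measure_itv/= lte_fin.
case: ltP => [//|ba]; have -> : a' = b' by apply/eqP; rewrite eq_le ab.
by rewrite subrr.
Qed.

(** Nothing is cancelled: the arriving parts fill both sides of the junction [y n (m - 1)]. Each
    pays the same gap there, whence the factor 2, and the gap is at most [K] times the area of
    [E]. *)
Lemma node_cost_merge n m : y n.+1 (m - 1) < y n (m - 1) -> y n (m - 1) < y n.+1 m ->
  exists E, [/\ measurable E,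
    E `<=` [set p | [/\ at_ n.+1 m p.1, at_ n.+1 m p.2 & ~ met n p.1 p.2]],
    measurable_fun (at_ n.+1 m) (speed_change n) &
    (\int[mu]_(s in at_ n.+1 m) (speed_change n s)%:E <= (2 * K)%:E * mu2 E)%E].
Proof.
have mm : m - 1 < m by lia.
set al := y n.+1 (m - 1); set be := y n.+1 m; set x1 := y n (m - 1) => ax xb.
set x0 := y n (m - 1 - 1); set x2 := y n m.
have K0 := flux_const_ge0 gK.
have ab : al < be by exact: lt_trans xb.
have x0x1 : x0 < x1.
  rewrite ltNge; apply/negP => h.
  by have /andP[] := y_between_ge h; rewrite -/al -/x1 -/x0; lra.
have x1x2 : x1 < x2.
  rewrite ltNge; apply/negP => h.
  by have /andP[] := y_between_ge h; rewrite -/be -/x1 -/x2; lra.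
have [th sp] := y_split x0x1; rewrite -/al -/x0 -/x1 in sp.
have [/andP[x0a _] _] := sp.1.
have [th' sp'] := y_split x1x2; rewrite -/be -/x1 -/x2 in sp'.
have [/andP[_ bx2] _] := sp'.1.
pose A1 := at_ n (m - 1) `&` w @^-1` `]al, x1].
pose A2 := at_ n m `&` w @^-1` `]x1, be].
have tA1 : transports A1 w al x1.
  by apply: (transports_sub (transports_at n (m - 1))); rewrite -/x0 -/x1.
have tA2 : transports A2 w x1 be.
  by apply: (transports_sub (transports_at n m)); rewrite -/x1 -/x2.
have AE : at_ n.+1 m = A1 `|` A2.
  apply/seteqP; split => s.
    move=> /at_step[[|] h /andP[w1 w2]]; [left|right]; split => //=; rewrite in_itv/=.
      by rewrite w1; case: (transports_at n (m - 1)) => _ /(_ _ h) /andP[_ ->].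
    by rewrite w2 andbT; case: (transports_at n m) => _ /(_ _ h) /andP[].
  move=> [|] [h] /=; rewrite in_itv/= => /andP[w1 w2]; apply/at_step; split => //;
    [by left| |by right|]; rewrite -/al -/be; apply/andP; split; lra.
have A12 : [disjoint A1 & A2].
  apply/disj_setPS => s [[h1 _] [h2 _]] /=; by have E := at_inj h1 h2; move: mm; rewrite E ltxx.
have [|||mX1 IX1] := @transports_cost A1 al x1
    (fun p => `|hull_slope g al be p - hull_slope g al x1 p|) n tA1.
- by apply: measurable_hull_diff; lra.
- by move=> p _.
- move=> s As; have [h] := As; rewrite /= in_itv/= => /andP[w1 w2].
  have a1 : at_ n.+1 m s by rewrite AE; left.
  rewrite /speed_change (speedE a1) (speedE h) -/al -/be -/x0 -/x1.
  by rewrite (hull_slope_split_right gK sp) ?w1.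
have [|||mX2 IX2] := @transports_cost A2 x1 be
    (fun p => `|hull_slope g x1 be p - hull_slope g al be p|) n tA2.
- by apply: measurable_hull_diff; lra.
- by move=> p _.
- move=> s As; have [h] := As; rewrite /= in_itv/= => /andP[w1 w2].
  have a1 : at_ n.+1 m s by rewrite AE; right.
  rewrite /speed_change (speedE a1) (speedE h) -/al -/be -/x1 -/x2.
  by rewrite distrC (hull_slope_split_left gK sp') ?w1.
have [mA1 _ _] := tA1; have [mA2 _ _] := tA2.
have mX : measurable_fun (at_ n.+1 m) (speed_change n).
  by rewrite AE; apply/measurable_funU.
have [p [q [/andP[alp px] /andP[xq qbe] gap]]] := conv_env_gap_memory gK ab
  (introT andP (conj (ltW ax) (ltW xb))).
have [c hc] := met_slope n (m - 1).
(* States, within the flat piece [p, q], of waves that have already met a wave across the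
   junction. *)
pose P := [set l | exists s s', [/\ at_ n (m - 1) s, at_ n m s', met n s s', l = w s & p <= l]].
pose Q := [set l | exists s s', [/\ at_ n (m - 1) s, at_ n m s', met n s s', l = w s' & l <= q]].
have [a2 [/andP[pa2 a2x] a2P ga2]] : exists a2, [/\ p <= a2 <= x1,
    forall l, P l -> a2 <= l & g x1 - g a2 <= c * (x1 - a2)].
  apply: memory_left => // l [s [s' [h1 h2 hm lE pl]]].
  have [H _] := hc s s' (m - 1) m hm h1 h2 (lexx _) mm.
  by rewrite lE in pl *; split => //; case: (transports_at n (m - 1)) => _ /(_ _ h1) /andP[].
have [c2 [/andP[xc2 c2q] c2Q gc2]] : exists c2, [/\ x1 <= c2 <= q,
    forall l, Q l -> l <= c2 & c * (c2 - x1) <= g c2 - g x1].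
  apply: memory_right => // l [s [s' [h1 h2 hm lE pl]]].
  have [_ H] := hc s s' (m - 1) m hm h1 h2 (lexx _) mm.
  rewrite lE in pl *; split => //.
  by case: (transports_at n m) => _ /(_ _ h2) /andP[/ltW].
have {}gap := gap a2 c2 c ltac:(by rewrite pa2) ltac:(by rewrite xc2) ga2 gc2.
have [mS1 eS1] := @transports_measure_itv _ _ _ p a2 tA1 alp a2x pa2.
have [mS2 eS2] := @transports_measure_itv _ _ _ a2 x1 tA1 (le_trans alp pa2) (lexx _) a2x.
have [mT1 eT1] := @transports_measure_itv _ _ _ x1 q tA2 (lexx _) qbe xq.
have [mT2 eT2] := @transports_measure_itv _ _ _ c2 q tA2 xc2 qbe c2q.
(* Left wave below [a2], or right wave above [c2]: such pairs have not met. The intervals are open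
   because a wave that has met another may sit at [a2] or [c2]. *)
pose E1 := (A1 `&` w @^-1` `]p, a2[) `*` (A2 `&` w @^-1` `]x1, q[).
pose E2 := (A1 `&` w @^-1` `]a2, x1[) `*` (A2 `&` w @^-1` `]c2, q[).
have mE1 : measurable E1 by exact: measurableX.
have mE2 : measurable E2 by exact: measurableX.
have E12 : E1 `&` E2 = set0.
  apply/seteqP; split => // -[s s'] [[[_ /= +] _] [[_ /= +] _]].
  by rewrite !in_itv/= => /andP[_ h1] /andP[h2 _]; have := lt_trans h1 h2; rewrite ltxx.
have muE : mu2 (E1 `|` E2) = ((a2 - p) * (q - x1) + (x1 - a2) * (q - c2))%:E.
  have e1 : mu2 E1 = ((a2 - p) * (q - x1))%:E.
    rewrite /E1 product_measure1E//.
    by rewrite [X in (X * _)%E]eS1 [X in (_ * X)%E]eT1 -EFinM.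
  have e2 : mu2 E2 = ((x1 - a2) * (q - c2))%:E.
    rewrite /E2 product_measure1E//.
    by rewrite [X in (X * _)%E]eS2 [X in (_ * X)%E]eT2 -EFinM.
  by rewrite measureU// [X in (X + _)%E]e1 [X in (_ + X)%E]e2 -EFinD.
exists (E1 `|` E2); split => //; first exact: measurableU.
- move=> [s s'] [|] [[h1 /= w1] [h2 /= w2]]; split => /=;
    [by rewrite AE; left|by rewrite AE; right| |
     by rewrite AE; left|by rewrite AE; right|].
  + move=> hm; move: w1; rewrite in_itv/= => /andP[w1 w3].
    have := a2P (w s); rewrite leNgt w3 => H; suff : false by [].
    by apply: H; exists s, s'; split => //; [case: h1|case: h2|exact: ltW].
  + move=> hm; move: w2; rewrite in_itv/= => /andP[w2 w3].
    have := c2Q (w s'); rewrite leNgt w2 => H; suff : false by [].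
    by apply: H; exists s, s'; split => //; [case: h1|case: h2|exact: ltW].
rewrite muE AE ge0_integral_setU//; last 2 first.
- by rewrite -AE; exact/measurable_EFinP.
- by move=> s _; rewrite lee_fin /speed_change.
rewrite IX1 IX2 (integral_hull_extend_right gK ax (ltW xb)).
rewrite (integral_hull_extend_left gK xb (ltW ax)) -EFinD -EFinM lee_fin; lra.
Qed.

(* E: pairs of waves meeting here for the first time; D: waves cancelled here *)
Lemma node_cost n m : exists ED : set (R * R) * set R,
  [/\ measurable ED.1, measurable ED.2,
    ED.1 `<=` [set p | [/\ at_ n.+1 m p.1, at_ n.+1 m p.2 & ~ met n p.1 p.2]],
    ED.2 `<=` dies n m &
    measurable_fun (at_ n.+1 m) (speed_change n) /\
    (\int[mu]_(s in at_ n.+1 m) (speed_change n s)%:E <=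
      (2 * K)%:E * mu2 ED.1 + (K * v)%:E * mu ED.2)%E].
Proof.
have K0 := flux_const_ge0 gK.
have v0 : 0 <= v by rewrite -lee_fin -muOm.
have [ab|ba] := ltP (y n.+1 (m - 1)) (y n.+1 m); last first.
  have A0 : at_ n.+1 m = set0.
    by apply/seteqP; split => // s /at_step[_ /andP[h1 h2]]; lra.
  exists (set0, set0); split => //=; rewrite A0; split.
    exact: measurable_fun_set0.
  by rewrite integral_set0 !measure0 !mule0 adde0.
have [bx|xb] := leP (y n.+1 m) (y n (m - 1)).
  have [D [mD sD mX le]] := node_cost_right ab bx.
  exists (set0, D); split => //=; split => //.
  by rewrite measure0 mule0 add0e.
have [xa|ax] := leP (y n (m - 1)) (y n.+1 (m - 1)).
  have [D [mD sD mX le]] := node_cost_left ab xa.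
  exists (set0, D); split => //=; split => //.
  by rewrite measure0 mule0 add0e.
have [E [mE sE mX le]] := node_cost_merge ax xb.
exists (E, set0); split => //=; split => //.
by rewrite measure0 mule0 adde0.
Qed.

Lemma alive_measurable n : measurable [set s | exists m, at_ n m s].
Proof.
rewrite -bigcup_int_family; apply: bigcupT_measurable.
apply: int_family_measurable => m.
by case: (transports_at n m).
Qed.

Lemma speed_change_measurable n :
  measurable_fun [set s | exists m, at_ n.+1 m s] (speed_change n).
Proof.
rewrite -bigcup_int_family; apply/measurable_fun_bigcup.
  apply: int_family_measurable => m.
  by case: (transports_at n.+1 m).
move=> k; rewrite /int_family; case: pickle_inv => [m|].
  by have [ED [_ _ _ _ []]] := node_cost n m.
exact: measurable_fun_set0.
Qed.

Lemma total_cost :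
  (\sum_(0 <= n <oo) \int[mu]_(s in [set s | exists m, at_ n.+1 m s])
     (speed_change n s)%:E <= (3 * K * v ^+ 2)%:E)%E.
Proof.
have K0 := flux_const_ge0 gK.
have v0 : 0 <= v by rewrite -lee_fin -muOm.
have [ED hED] := @boolp.choice _ _ _ (fun p => node_cost p.1 p.2).
pose E n m := (ED (n, m)).1; pose D n m := (ED (n, m)).2.
have mE n m : measurable (E n m) by have [] := hED (n, m).
have mD n m : measurable (D n m) by have [] := hED (n, m).
have sE n m s s' : E n m (s, s') ->
    [/\ at_ n.+1 m s, at_ n.+1 m s' & ~ met n s s'].
  by have [_ _ h _ _] := hED (n, m); exact: (h (s, s')).
have sD n m s : D n m s -> dies n m s.
  by have [_ _ _ h _] := hED (n, m); exact: h.
have cost n m : (\int[mu]_(s in at_ n.+1 m) (speed_change n s)%:E <=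
    (2 * K)%:E * mu2 (E n m) + (K * v)%:E * mu (D n m))%E.
  by have [_ _ _ _ []] := hED (n, m).
have mat n m : measurable (at_ n m).
  by case: (transports_at n m).
pose EE n := [set p | exists m, E n m p]; pose DD n := [set s | exists m, D n m s].
have Einj n m m' p : E n m p -> E n m' p -> m = m'.
  case: p => s s' /sE[h1 _ _] /sE[h2 _ _]; exact: at_inj h1 h2.
(* A dying wave is directed to one node only: the cut at its old node decides whether it is fast or
   slow. *)
have Dinj n m m' s : D n m s -> D n m' s -> m = m'.
  move=> /sD[[[h1 w1]|[h1 w1]] _] /sD[[[h2 w2]|[h2 w2]] _];
    have e := at_inj h1 h2.
  - lia.
  - have mE' : m' = m - 1 by lia.
    by move: w2; rewrite mE' leNgt w1.
  - have mE' : m = m' - 1 by lia.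
    by move: w1; rewrite mE' leNgt w2.
  - by [].
have mEE n : measurable (EE n).
  rewrite /EE -bigcup_int_family; apply: bigcupT_measurable.
  exact: int_family_measurable.
have mDD n : measurable (DD n).
  rewrite /DD -bigcup_int_family; apply: bigcupT_measurable.
  exact: int_family_measurable.
have step n : (\int[mu]_(s in [set s | exists m, at_ n.+1 m s])
     (speed_change n s)%:E <= (2 * K)%:E * mu2 (EE n) + (K * v)%:E * mu (DD n))%E.
  rewrite -bigcup_int_family ge0_integral_bigcup//; last 4 first.
  - exact: (int_family_measurable (mat n.+1)).
  - apply/measurable_EFinP; rewrite bigcup_int_family.
    exact: speed_change_measurable.
  - by move=> s _; rewrite lee_fin /speed_change.
  - by apply: int_family_trivIset => m m' s; exact: at_inj.
  have e1 := measure_int_family mu2 (mE n) (@Einj n).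
  have e2 := measure_int_family mu (mD n) (@Dinj n).
  rewrite /EE /DD -[X in ((2 * K)%:E * X + _)%E]e1 -[X in (_ + _ * X)%E]e2.
  rewrite -!nneseriesZl//.
  rewrite -nneseriesD//; last 2 first.
  - by move=> k _ _; apply: mule_ge0; rewrite ?lee_fin ?mulr_ge0//; exact: measure_ge0.
  - by move=> k _ _; apply: mule_ge0; rewrite ?lee_fin ?mulr_ge0//; exact: measure_ge0.
  apply: lee_nneseries => [k _ _|k _].
    by apply: integral_ge0 => s _; rewrite lee_fin /speed_change.
  rewrite /int_family; case: pickle_inv => [m|]; first exact: cost.
  by rewrite integral_set0 !measure0 !mule0 adde0.
pose B n : \bar R := ((2 * K)%:E * mu2 (EE n) + (K * v)%:E * mu (DD n))%E.
apply: (@le_trans _ _ (\sum_(0 <= n <oo) B n)%E).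
  apply: lee_nneseries => [k _ _|k _]; last exact: step.
  by apply: integral_ge0 => s _; rewrite lee_fin /speed_change.
(* A pair charged at step n is together at time n + 1, hence counts as met at every later step. *)
have tE : trivIset setT EE.
  move=> n n' _ _ [[s s'] [[m h] [m' h']]].
  have [a1 a2 nm] := sE _ _ _ _ h; have [a1' a2' nm'] := sE _ _ _ _ h'.
  have [lt|lt|//] := ltngtP n n'.
    by exfalso; apply: nm'; exists n.+1, m.
  by exfalso; apply: nm; exists n'.+1, m'.
have alive n m s : dies n m s -> exists m', at_ n m' s.
  by move=> [[[h _]|[h _]] _]; [exists (m - 1)|exists m].
(* A wave that dies at a later step was still present after the earlier one. *)
have tD : trivIset setT DD.
  move=> n n' _ _ [s [[m h] [m' h']]].
  have d1 := sD _ _ _ h; have d2 := sD _ _ _ h'.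
  have [p1 a1] := alive _ _ _ d1; have [p2 a2] := alive _ _ _ d2.
  have [lt|lt|//] := ltngtP n n'.
    by have [q aq] := at_alive lt a2; case: d1 => _ /(_ q).
  by have [q aq] := at_alive lt a1; case: d2 => _ /(_ q).
rewrite /B nneseriesD//; last 2 first.
- by move=> k _ _; apply: mule_ge0; rewrite ?lee_fin ?mulr_ge0//; exact: measure_ge0.
- by move=> k _ _; apply: mule_ge0; rewrite ?lee_fin ?mulr_ge0//; exact: measure_ge0.
rewrite !nneseriesZl//.
have -> : (\sum_(0 <= n <oo) mu2 (EE n) = mu2 (\bigcup_n EE n))%E.
  by rewrite measure_semi_bigcup//; exact: bigcupT_measurable.
have -> : (\sum_(0 <= n <oo) mu (DD n) = mu (\bigcup_n DD n))%E.
  by rewrite measure_semi_bigcup//; exact: bigcupT_measurable.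
have leE : (mu2 (\bigcup_n EE n) <= (v * v)%:E)%E.
  have -> : (v * v)%:E = mu2 (Om `*` Om).
    by rewrite product_measure1E// [X in (X * X)%E]muOm -EFinM.
  apply: le_measure; rewrite ?inE; [exact: bigcupT_measurable|exact: measurableX|].
  by move=> [s s'] [n _ [m /sE[h1 h2 _]]]; split; apply: at_Om; eassumption.
have leD : (mu (\bigcup_n DD n) <= v%:E)%E.
  rewrite -muOm; apply: le_measure; rewrite ?inE//; first exact: bigcupT_measurable.
  by move=> s [n _ [m /sD/alive[m' h]]]; exact: at_Om h.
apply: (@le_trans _ _ ((2 * K)%:E * (v * v)%:E + (K * v)%:E * v%:E)%E).
  by apply: leeD; apply: lee_wpmul2l => //; rewrite lee_fin mulr_ge0.
by rewrite -!EFinM -EFinD lee_fin expr2; lra.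
Qed.

End WaveScheme.

(** * The Glimm scheme *)

Section Translation.
Context {R : realType}.
Local Notation mu := (@lebesgue_measure R).

Lemma lebesgue_measure_translation (c : R) (B : set R) : measurable B ->
  mu ((fun x => x + c) @^-1` B) = mu B.
Proof.
move=> mB.
pose T := measurableTypeR R; pose phi : T -> T := fun x => x + c.
have mphi : measurable_fun [set: T] phi by exact: measurable_funD.
pose mphi_mixin := isMeasurableFun.Build _ _ T T phi mphi.
pose phim : {mfun T >-> T} := HB.pack phi mphi_mixin.
have H := @lebesgue_measure_unique R (pushforward (@lebesgue_measure R) phim).
rewrite [RHS](H mphi)// => _ [[a b] _ <-] /=; rewrite /pushforward.
rewrite (_ : phim @^-1` `]a, b] = `]a - c, b - c]); last first.
  apply/seteqP; split => x /=; rewrite !in_itv/= /phi => /andP[h1 h2];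
    apply/andP; split; [rewrite ltrBlDr|rewrite lerBrDr|rewrite -ltrBlDr|rewrite -lerBrDr];
    by [].
rewrite !lebesgue_measure_itv /= !lte_fin ltrD2r; case: ifP => // _.
by rewrite -!EFinB; congr EFin; ring.
Qed.

Lemma transports_translation (A : set R) (w : R -> R) (a b c : R) :
  A = `]a, b] -> (forall s, A s -> w s = s + c) -> transports A w (a + c) (b + c).
Proof.
move=> -> hw; split.
- exact: measurable_itv.
- by move=> s /[dup] As; rewrite /= in_itv/= (hw _ As) ltrD2r lerD2r.
move=> B mB.
have E : `]a, b] `&` w @^-1` B = (fun x => x + c) @^-1` (`]a + c, b + c] `&` B).
  apply/seteqP; split => s /=.
    move=> [sI]; rewrite (hw _ sI) => Bs; split => //.
    by move: sI; rewrite !in_itv/= ltrD2r lerD2r.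
  move=> [sI Bs]; have sI' : `]a, b]%classic s.
    by move: sI; rewrite /= !in_itv/= ltrD2r lerD2r.
  by split => //; rewrite (hw _ sI').
have mIB : measurable (`]a + c, b + c] `&` B) by exact: measurableI.
rewrite E; split; last exact: lebesgue_measure_translation.
have := @measurable_funD _ _ R setT idfun (cst c) (@measurable_id _ _ _) (@measurable_cst _ _ _ _ _ _).
by move=> /(_ measurableT _ mIB); rewrite setTI.
Qed.

End Translation.

Section StepVariation.
Context {R : realType}.
Implicit Types (h : R -> R) (a b c : R).
Local Notation TV := total_variation.

Lemma left_limit_const h a b c : a < b -> (forall x, a <= x < b -> h x = c) ->
  left_limit h b = c.
Proof.
move=> ab hc; apply: cvg_lim => //; apply: cvg_near_cst.
near=> x; apply: hc; apply/andP; split; last by near: x; exact: nbhs_left_lt.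
by apply: ltW; near: x; exact: nbhs_left_gt.
Unshelve. all: end_near. Qed.

Lemma total_variation_sub h a b a' b' : a' <= a -> a <= b -> b <= b' ->
  (TV a b h <= TV a' b' h)%E.
Proof.
move=> aa ab bb.
rewrite (total_variationD h aa (le_trans ab bb)) (total_variationD h ab bb).
rewrite addeCA leeDl// adde_ge0 ?total_variation_ge0//.
Qed.

Lemma total_variation_const h a b c : a <= b -> (forall x, a <= x <= b -> h x = c) ->
  TV a b h = 0%E.
Proof.
move=> ab hc; rewrite nondecreasing_total_variation//.
  by rewrite !hc ?subrr ?lexx ?ab.
move=> x y; rewrite !in_itv/= => xi yi _.
by rewrite !hc.
Qed.

Lemma total_variation_jump h a b : a < b -> (forall x, a <= x < b -> h x = h a) ->
  TV a b h = (`|h b - h a|)%:E.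
Proof.
move=> ab hc.
have case1 (k : R -> R) : (forall x, a <= x < b -> k x = k a) -> k a <= k b ->
    TV a b k = (`|k b - k a|)%:E.
  move=> kc kab; rewrite ger0_norm ?subr_ge0//.
  apply: nondecreasing_total_variation; first exact: ltW.
  move=> x y; rewrite !in_itv/= => /andP[ax xb] /andP[ay yb] xy.
  have [yE|yb'] := eqVneq y b.
    rewrite yE; have [->//|xb'] := eqVneq x b.
    by rewrite kc// ax lt_neqAle xb'.
  have {}yb' : y < b by rewrite lt_neqAle yb'.
  by rewrite !kc ?ay ?yb' ?ax ?(le_lt_trans xy).
have [hab|hba] := leP (h a) (h b); first exact: case1.
rewrite -total_variationN (case1 (\- h)).
- by congr (_%:E); rewrite -normrN; congr (`|_|); rewrite /=; ring.
- by move=> x xi /=; rewrite hc.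
- by rewrite /= lerN2 ltW.
Qed.

End StepVariation.

(** * Variation of the discretized datum and initial positions *)

Section Datum.
Context {R : realType}.
Variables (eps : R) (ubar : R -> R).
Hypothesis eps_gt0 : 0 < eps.
Local Notation TV := total_variation.
Local Notation D := (discretized_datum eps ubar).
Local Notation x_ := (node eps).
Local Notation Uf := (U eps ubar).
Local Notation TVD := (total_variation_line D).
Local Notation Tle x := (Defs.total_variation_le x D).

Lemma node_lt m m' : (x_ m < x_ m') = (m < m').
Proof. by rewrite /node ltr_pM2r// ltr_int. Qed.

Lemma node_le m m' : (x_ m <= x_ m') = (m <= m').
Proof. by rewrite /node ler_pM2r// ler_int. Qed.

Lemma node_inj m m' : x_ m = x_ m' -> m = m'.
Proof. by move=> E; apply/eqP; rewrite eq_le -!node_le E lexx. Qed.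

Lemma node_floor x : x_ (Num.floor (x / eps)) <= x < x_ (Num.floor (x / eps) + 1).
Proof.
rewrite /node; have := floor_itv (x / eps) => /andP[h1 h2].
by rewrite -ler_pdivlMr// h1 /= -ltr_pdivrMr.
Qed.

Lemma node_floor_unique m x : x_ m <= x < x_ (m + 1) -> Num.floor (x / eps) = m.
Proof.
rewrite /node => /andP[h1 h2]; apply/eqP; rewrite floor_eq.
by rewrite ler_pdivlMr// h1 /= ltr_pdivrMr.
Qed.

Lemma datumE m x : x_ m <= x < x_ (m + 1) -> D x = ubar (x_ m).
Proof. by move=> /node_floor_unique E; rewrite /discretized_datum E. Qed.

Lemma datum_node m : D (x_ m) = ubar (x_ m).
Proof. by apply: datumE; rewrite lexx node_lt; lia. Qed.

Lemma datum_pred m x : x_ (m - 1) <= x < x_ m -> D x = D (x_ (m - 1)).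
Proof. by move=> xi; rewrite datum_node; apply: datumE; rewrite subrK. Qed.

Lemma datum_left m : left_limit D (x_ m) = ubar (x_ (m - 1)).
Proof.
apply: (@left_limit_const _ _ (x_ (m - 1))); first by rewrite node_lt; lia.
by move=> x /datum_pred ->; rewrite datum_node.
Qed.

Definition jump m := `|ubar (x_ m) - ubar (x_ (m - 1))|.

Lemma TV_cell m : TV (x_ (m - 1)) (x_ m) D = (jump m)%:E.
Proof.
rewrite total_variation_jump ?datum_node//; first by rewrite node_lt; lia.
by move=> x /datum_pred ->; rewrite datum_node.
Qed.

Lemma TV_datum_nodes m (k : nat) : (TV (x_ m) (x_ (m + k%:Z)) D
  <= TV (x_ m) (x_ (m + k%:Z)) ubar)%E.
Proof.
elim: k => [|k IH]; first by rewrite addr0 !total_variationxx.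
have E : m + k.+1%:Z - 1 = m + k%:Z by lia.
have l1 : x_ m <= x_ (m + k%:Z) by rewrite node_le; lia.
have l2 : x_ (m + k%:Z) <= x_ (m + k.+1%:Z) by rewrite node_le; lia.
rewrite (total_variationD D l1 l2) (total_variationD ubar l1 l2).
apply: leeD => //; rewrite -E TV_cell E.
by rewrite /jump E; apply: total_variation_ge.
Qed.

(** The interval is enlarged to nodes, between which every jump of the step function is an increment
    of [ubar]. *)
Lemma TVD_le : (TVD <= total_variation_line ubar)%E.
Proof.
apply: ge_ereal_sup => _ [[a b] /= ab <-].
have /andP[a1 a2] := node_floor a; have /andP[b1 b2] := node_floor b.
set m := Num.floor (a / eps) in a1 a2; set m' := Num.floor (b / eps) in b1 b2.
have mm : m < m' + 1 by rewrite -node_lt; exact: le_lt_trans (le_trans a1 ab) b2.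
have [k kE] : exists k : nat, m' + 1 = m + k%:Z by exists `|(m' + 1 - m)%R|%N; lia.
rewrite kE in b2.
apply: (le_trans (total_variation_sub D a1 ab (ltW b2))).
apply: (le_trans (TV_datum_nodes m k)).
apply: ereal_sup_ubound; exists (x_ m, x_ (m + k%:Z)) => //=.
by rewrite node_le; lia.
Qed.

Hypothesis ubar_BV : (total_variation_line ubar < +oo)%E.

Lemma TVD_fin : TVD \is a fin_num.
Proof.
rewrite ge0_fin_numE; first exact: le_lt_trans TVD_le ubar_BV.
by apply: ereal_sup_ubound; exists (0, 0) => //=; rewrite total_variationxx.
Qed.

Lemma TV_le_line a b : a <= b -> (TV a b D <= TVD)%E.
Proof. by move=> ab; apply: ereal_sup_ubound; exists (a, b). Qed.

Lemma Tle_le x : (Tle x <= TVD)%E.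
Proof. by apply: ge_ereal_sup => _ [a /= ax <-]; exact: TV_le_line. Qed.

Lemma Tle_ge0 x : (0 <= Tle x)%E.
Proof.
by apply: ereal_sup_ubound; exists x => //=; rewrite total_variationxx.
Qed.

Lemma TleE x : Tle x = (Uf x)%:E.
Proof.
rewrite /U fineK// ge0_fin_numE ?Tle_ge0//.
by apply: (le_lt_trans (Tle_le x)); exact: le_lt_trans TVD_le ubar_BV.
Qed.

Lemma U_ge0 x : 0 <= Uf x. Proof. by rewrite -lee_fin -TleE Tle_ge0. Qed.

Lemma U_le x : ((Uf x)%:E <= TVD)%E. Proof. by rewrite -TleE Tle_le. Qed.

Lemma U_add x z : x <= z -> ((Uf z)%:E = (Uf x)%:E + TV x z D)%E.
Proof.
move=> xz; rewrite -!TleE; apply/eqP; rewrite eq_le; apply/andP; split.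
  apply: ge_ereal_sup => _ [a /= az <-].
  have [ax|xa] := leP a x.
    rewrite (total_variationD D ax xz); apply: leeD => //.
    by apply: ereal_sup_ubound; exists a.
  apply: (@le_trans _ _ (TV x z D)); first by apply: total_variation_sub => //; exact: ltW.
  by rewrite leeDr// Tle_ge0.
have fz : TV x z D \is a fin_num.
  rewrite ge0_fin_numE ?total_variation_ge0//.
  by apply: (le_lt_trans (TV_le_line xz)); exact: le_lt_trans TVD_le ubar_BV.
rewrite -leeBrDr//; apply: ge_ereal_sup => _ [a /= ax <-].
rewrite leeBrDr// -(total_variationD D ax xz).
by apply: ereal_sup_ubound; exists a => //=; exact: le_trans ax xz.
Qed.

Lemma U_mono x z : x <= z -> Uf x <= Uf z.
Proof.
by move=> xz; rewrite -lee_fin (U_add xz) leeDl// total_variation_ge0.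
Qed.

Lemma U_node m : Uf (x_ m) = Uf (x_ (m - 1)) + jump m.
Proof.
have := @U_add (x_ (m - 1)) (x_ m); rewrite node_le => /(_ ltac:(lia)).
by rewrite TV_cell -EFinD => -[].
Qed.

Lemma U_cell m x : x_ m <= x < x_ (m + 1) -> Uf x = Uf (x_ m).
Proof.
move=> /andP[mx xm]; have := U_add mx.
rewrite (total_variation_const (c := D (x_ m)) mx).
  by rewrite adde0 => -[].
move=> z /andP[z1 z2]; rewrite datum_node; apply: datumE.
by rewrite z1 (le_lt_trans z2).
Qed.

Lemma U_left m : left_limit Uf (x_ m) = Uf (x_ (m - 1)).
Proof.
apply: (@left_limit_const _ _ (x_ (m - 1))); first by rewrite node_lt; lia.
by move=> x xi; apply: U_cell; rewrite subrK.
Qed.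

(** All the variation but [e] is attained on some [a, b], so less than [e] is left before a node to
    the left of [a]. *)
Lemma U_small e : 0 < e -> exists m, Uf (x_ m) < e.
Proof.
move=> e0; have fV := TVD_fin.
have [_ [[a b] /= ab <-] lt] : exists2 z, [set TV ab.1 ab.2 D | ab in [set ab : R * R | ab.1 <= ab.2]] z
    & (TVD - e%:E < z)%E.
  by apply: ub_ereal_sup_adherent => //.
have /andP[a1 _] := node_floor a; set m := Num.floor (a / eps) in a1.
exists m; have := U_add (le_trans a1 ab).
rewrite (total_variationD D a1 ab) => E.
have le := U_le b; have ft : TV a b D \is a fin_num.
  rewrite ge0_fin_numE ?total_variation_ge0//.
  by apply: (le_lt_trans (TV_le_line ab)); exact: le_lt_trans TVD_le ubar_BV.
rewrite -lte_fin; move: lt le.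
have h : ((Uf (x_ m))%:E + TV a b D <= (Uf b)%:E)%E.
  by rewrite E leeD2l// leeDr// total_variation_ge0.
rewrite EFinN lteBlDr// => lt le.
have := le_lt_trans (le_trans h le) lt.
by rewrite addeC lteD2lE.
Qed.

Lemma wave_cell s x : 0 < s -> s <= Uf x -> exists m, Uf (x_ (m - 1)) < s <= Uf (x_ m).
Proof.
move=> s0 sx; have [m0 h0] := U_small s0.
have /andP[b1 b2] := node_floor x; set m1 := Num.floor (x / eps) in b1 b2.
have h1 : s <= Uf (x_ m1) by rewrite -(@U_cell _ x)// b1.
have mm : m0 < m1.
  rewrite -node_lt ltNge; apply/negP => /U_mono h2.
  by have := lt_le_trans h0 (le_trans h1 h2); rewrite ltxx.
have [k kE] : exists k : nat, m1 = m0 + k%:Z by exists `|(m1 - m0)%R|%N; lia.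
rewrite kE in h1; clear - h0 h1.
elim: k h1 => [|k IH]; first by rewrite addr0 leNgt h0.
have [h _|h h1] := leP s (Uf (x_ (m0 + k%:Z))); first exact: IH.
exists (m0 + k.+1%:Z); rewrite h1 andbT.
by have -> : m0 + k.+1%:Z - 1 = m0 + k%:Z by lia.
Qed.

Lemma position0_cell s m : Uf (x_ (m - 1)) < s <= Uf (x_ m) ->
  position0 eps ubar s = (x_ m)%:E.
Proof.
move=> /andP[h1 h2]; apply/eqP; rewrite eq_le; apply/andP; split.
  by apply: ereal_inf_lbound; exists (x_ m).
apply: le_ereal_inf_tmp => _ [x /= sx <-]; rewrite lee_fin leNgt; apply/negP => xm.
have : Uf x <= Uf (x_ (m - 1)).
  have /andP[b1 b2] := node_floor x; set m1 := Num.floor (x / eps) in b1 b2.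
  rewrite (U_cell (introT andP (conj b1 b2))); apply: U_mono; rewrite node_le.
  have : m1 < m by rewrite -node_lt; exact: le_lt_trans xm.
  by lia.
by move=> /(le_trans sx); rewrite leNgt h1.
Qed.

Lemma position0_node s m : 0 < s -> position0 eps ubar s = (x_ m)%:E ->
  Uf (x_ (m - 1)) < s <= Uf (x_ m).
Proof.
move=> s0 E.
have [[x sx]|nx] := pselect (exists x, s <= Uf x).
  have [m' hm'] := wave_cell s0 sx.
  by have := position0_cell hm'; rewrite E => -[/node_inj ->].
have : position0 eps ubar s = +oo%E.
  rewrite /position0 (_ : [set x%:E | x in _] = set0) ?ereal_inf0//.
  by apply/seteqP; split => // _ [x /= sx _]; apply: nx; exists x.
by rewrite E.
Qed.

End Datum.

(** * Reduction of negative waves to positive ones *)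

Section Reflection.
Context {R : realType}.
Local Notation mu := (@lebesgue_measure R).
Implicit Types (f : R -> R) (S : R).

(* For S = -1 this exchanges the two signs of waves and the two envelopes. *)
Definition signed_flux S f (w : R) : R := S * f (S * w).

Lemma signed_flux1 f : signed_flux 1 f = f.
Proof. by apply/funext => w; rewrite /signed_flux !mul1r. Qed.

Lemma signed_fluxN1 f : signed_flux (-1) f = fun w => - f (- w).
Proof. by apply/funext => w; rewrite /signed_flux !mulN1r. Qed.

Lemma convex_function_reflect (a b : R) (h : R -> R) :
  @convex_function R R^o `[a, b] h ->
  @convex_function R R^o `[- b, - a] (fun x => h (- x)).
Proof.
move=> hc t x y xI yI; have := hc t (- x) (- y).
have I z : (z : R^o) \in (`[- b, - a]%classic : set R^o) -> (- z : R^o) \in (`[a, b]%classic : set R^o).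
  by rewrite !inE /= !in_itv/= => /andP[h1 h2]; apply/andP; split; lra.
move=> /(_ (I _ xI) (I _ yI)); set s := t%:num : R.
change (h (s * - (x : R) + (1 - s) * - (y : R)) <= s * h (- x) + (1 - s) * h (- y) ->
  h (- (s * (x : R) + (1 - s) * (y : R))) <= s * h (- x) + (1 - s) * h (- y)).
by rewrite !mulrN -opprD.
Qed.

Lemma conc_env_reflect (c d : R) f x :
  conc_env c d f x = - conv_env (- d) (- c) (signed_flux (-1) f) (- x).
Proof.
rewrite signed_fluxN1 /conc_env /conv_env /inf; congr (- sup _).
apply/seteqP; split => y /=.
- move=> [_ [h [hc fh] <-] <-]; exists (fun z => - h (- z)); last by rewrite opprK.
  split; first exact: (@convex_function_reflect _ _ (\- h)).
  move=> z; rewrite inE/= in_itv/= => /andP[z1 z2]; rewrite lerN2; apply: fh.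
  by rewrite inE/= in_itv/=; apply/andP; split; lra.
- move=> [h [hc fh] <-]; exists (- h (- x)); last by rewrite opprK.
  exists (fun z => - h (- z)) => //; split.
    have := @convex_function_reflect _ _ _ hc; rewrite !opprK => H.
    by rewrite (_ : (\- _) = fun z => h (- z))//; apply/funext => z /=; rewrite opprK.
  move=> z; rewrite inE/= in_itv/= => /andP[z1 z2].
  have := fh (- z); rewrite inE/= in_itv/= opprK => H.
  by rewrite lerNr; apply: H; apply/andP; split; lra.
Qed.

(** The quadratic remainder of the reflected hull is transferred; this covers the endpoints, where
    the derivative is one-sided. *)
Lemma derive_conc_env K f dg (c d w : R) :
  admissible_flux K (signed_flux (-1) f) dg -> c < d -> c <= w <= d ->
  derive_itv c d (conc_env c d f) w =
  hull_slope (signed_flux (-1) f) (- d) (- c) (- w).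
Proof.
move=> gK cd /andP[cw wd].
have dc : - d < - c by lra.
have wI : - d <= - w <= - c by apply/andP; split; lra.
have sl := hull_slopeP gK dc wI.
apply: (@derive_itvE _ K) => //; first by rewrite cw.
move=> z /andP[cz zd].
have zI : - d <= - z <= - c by apply/andP; split; lra.
have := conv_env_taylor gK sl zI dc; rewrite !conc_env_reflect.
set l := hull_slope _ _ _ _; set A := conv_env _ _ _ _; set B := conv_env _ _ _ _.
have -> : - z - - w = - (z - w) by ring.
rewrite normrN; apply: le_trans; rewrite -normrN.
by rewrite le_eqVlt; apply/orP; left; apply/eqP; congr (`|_|); ring.
Qed.

End Reflection.

Section SignedFlux.
Context {R : realType}.
Variables (f : R -> R) (S K : R).
Hypothesis f_C2 : C2 f.
Hypothesis f'_itv : forall w : R, 0 < f^`() w < 1.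
Hypothesis f''_le : forall w : R, `|f^`()^`() w| <= K.
Hypothesis S_sign : S = 1 \/ S = -1.
Local Notation g := (signed_flux S f).

Lemma signK : S * S = 1.
Proof. by case: S_sign => ->; ring. Qed.

Lemma norm_sign : `|S| = 1.
Proof. by case: S_sign => ->; rewrite ?normrN normr1. Qed.

(** The two signs cancel, so slopes of [g] are slopes of [f], still in ]0, 1[: speeds are not
    reflected. *)
Lemma is_derive_signed_flux (x : R) : is_derive x 1 g (f^`() (S * x)).
Proof.
have [df _ _] := f_C2.
have dS : is_derive x 1 (fun w : R => S * w) S.
  by apply: is_derive_eq; rewrite /GRing.scale/= mulr1.
have dfS : is_derive (S * x) 1 f (f^`() (S * x)).
  by rewrite derive1E; apply: derivableP.
have H := @is_derive1_comp _ f (fun w => S * w) x _ _ dfS dS.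
have := @is_deriveZ _ _ _ (f \o (fun w => S * w)) S x 1 _ H.
by rewrite /GRing.scale/= mulrCA signK mulr1.
Qed.

Lemma admissible_signed_flux : admissible_flux K g (fun w => f^`() (S * w)).
Proof.
have [df d2f _] := f_C2; split.
- exact: is_derive_signed_flux.
- move=> x; have /andP[h1 h2] := f'_itv (S * x).
  by rewrite ger0_norm ltW.
- move=> x y.
  have -> : `|x - y| = `|S * x - S * y| by rewrite -mulrBr normrM norm_sign mul1r.
  move: (S * x) (S * y) => {x y} x y.
  wlog xy : x y / y <= x.
    move=> H; have [/H//|/ltW/H] := leP y x.
    by rewrite distrC (distrC y).
  have [z _ ->] := @MVT_segment R f^`() f^`()^`() y x xy
    (fun z _ => ltac:(by rewrite derive1E; apply: derivableP; exact: d2f))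
    (continuous_subspaceT (fun z => differentiable_continuous (ltac:(by apply/derivable1_diffP; exact: d2f)))).
  by rewrite normrM ler_wpM2r.
Qed.

Lemma signed_flux_lt x y : x < y -> g x < g y.
Proof.
move=> xy; have [z _] := flux_mvt admissible_signed_flux (ltW xy).
have /andP[h1 h2] := f'_itv (S * z).
by move=> E; rewrite -subr_gt0 E mulr_gt0// subr_gt0.
Qed.

Lemma signed_flux_lip x y : `|g x - g y| <= `|x - y|.
Proof. exact: flux_lipschitz admissible_signed_flux y x. Qed.

Lemma wave_slopeE ul ur w : S * ul < S * w <= S * ur ->
  (if S == 1 then derive_itv ul ur (conv_env ul ur f) w
   else derive_itv ur ul (conc_env ur ul f) w) =
  hull_slope g (S * ul) (S * ur) (S * w).
Proof.
move=> /andP[h1 h2]; have gK := admissible_signed_flux.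
case: S_sign gK h1 h2 => -> gK h1 h2.
  by rewrite eqxx signed_flux1 !mul1r.
rewrite ifF; last by apply/eqP => E; lra.
rewrite (derive_conc_env gK) ?mulN1r//; first lra.
by apply/andP; split; lra.
Qed.

(** The level [k] for [S * v] corresponds to the level [S * k] for [v], with the same integrand in
    the entropy production. *)
Lemma riemann_solution_signed ul ur v : riemann_solution f ul ur v ->
  riemann_solution g (S * ul) (S * ur) (fun t x => S * v t x).
Proof.
move=> [[[M vM] mv v0 vL ve] vrc]; split; last first.
  by move=> t t0 x; apply: cvgMr; exact: vrc.
split.
- by exists M => t x t0; rewrite normrM norm_sign mul1r vM.
- by apply: measurable_funM.
- apply/funext => x; rewrite v0 /riemann_data; by case: ifP.
- move=> t0 M' t00.
  rewrite (_ : (fun t => _) = fun t => L1_distance M' (v t) (v t0)); first exact: vL.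
  apply/funext => t; rewrite /L1_distance; apply: eq_integral => x _.
  by rewrite -mulrBr normrM norm_sign mul1r.
- move=> k phi tphi; have := ve (S * k) phi tphi.
  rewrite (_ : entropy_production _ _ _ _ = entropy_production f v (S * k) phi)//.
  apply: eq_integral => -[t x] _ /=.
  have E : S * v t x - k = S * (v t x - S * k) by rewrite mulrBr mulrA signK mul1r.
  have sgS : Num.sg S = S by case: S_sign => ->; rewrite ?sgrN sgr1.
  rewrite E normrM norm_sign mul1r sgrM sgS /signed_flux mulrA signK mul1r.
  congr ((_ + _)%:E); congr (_ * _); rewrite -mulrBr.
  by rewrite (mulrC S) -!mulrA; congr (_ * _); rewrite mulrA signK mul1r.
Qed.

End SignedFlux.

(** * Sampled values on the grid *)

Section Grid.
Context {R : realType}.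
Variables (f : R -> R) (ubar : R -> R) (eps : R) (theta : nat -> R) (u : R -> R -> R).
Variable K : R.
Hypothesis f_C2 : C2 f.
Hypothesis f'_itv : forall w : R, 0 < f^`() w < 1.
Hypothesis f''_le : forall w : R, `|f^`()^`() w| <= K.
Hypothesis eps_gt0 : 0 < eps.
Hypothesis theta_itv : forall n, (0 < n)%N -> 0 <= theta n <= 1.
Hypothesis u_glimm : glimm_solution f eps theta ubar u.
Local Notation x_ := (node eps).
Local Notation t_ := (time eps).
Local Notation G := (grid_value eps u).

Lemma at_left_shift (c e : R) : (t + c) @[t --> e^'-] --> (e + c)^'-.
Proof.
move=> A /nbhs_ballP[r /= r0 hA]; apply/nbhs_ballP; exists r => //= t tB te.
apply: hA; last by rewrite ltrD2r.
move: tB; rewrite /ball /=.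
have -> : e + c - (t + c) = e - t by ring.
by [].
Qed.

Lemma time0 : t_ 0 = 0. Proof. by rewrite /time mul0r. Qed.

Lemma timeS n : t_ n.+1 = eps + t_ n.
Proof. by rewrite /time -natr1 mulrDl mul1r addrC. Qed.

(** All points of a cell receive the limit at one and the same sampling point. *)
Lemma grid_cell n m x : x_ m <= x < x_ (m + 1) -> u (t_ n) x = G n m.
Proof.
have [u0 _ us] := u_glimm.
move=> xI; rewrite /grid_value; case: n => [|n].
  by rewrite time0 u0 (datumE ubar eps_gt0 xI) datum_node.
have nI : x_ m <= x_ m < x_ (m + 1) by rewrite lexx node_lt//; lia.
have mE : m = m + 1 - 1 by rewrite addrK.
have h1 := us n.+1 (m + 1) x isT; have h2 := us n.+1 (m + 1) (x_ m) isT.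
rewrite -mE in h1 h2.
by rewrite -(cvg_lim (@Rhausdorff R) (h1 xI)) -(cvg_lim (@Rhausdorff R) (h2 nI)).
Qed.

Lemma grid_left n m : left_limit (u (t_ n)) (x_ m) = G n (m - 1).
Proof.
apply: (@left_limit_const _ _ (x_ (m - 1))); first by rewrite node_lt//; lia.
by move=> x xi; apply: grid_cell; rewrite subrK.
Qed.

Lemma grid0 m : G 0 m = ubar (x_ m).
Proof. by have [u0 _ _] := u_glimm; rewrite /grid_value time0 u0 datum_node. Qed.

Lemma packet_limit n m (p l : R) : x_ m <= p < x_ (m + 1) ->
  u t p @[t --> (t_ n.+1)^'-] --> l ->
  exists2 v, riemann_solution f (G n (m - 1)) (G n m) v &
    v t (p - x_ m) @[t --> eps^'-] --> l.
Proof.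
move=> pI cv; have [_ uv _] := u_glimm.
have [v hv uE] := uv n m; rewrite grid_left in hv; exists v => //.
have := cvg_comp _ _ (@at_left_shift (t_ n) eps); rewrite -timeS => /(_ _ _ _ cv).
apply: cvg_trans; apply: near_eq_cvg; near=> t => /=.
have /andP[t0 te] : 0 < t < eps.
  apply/andP; split; near: t; first exact: nbhs_left_gt.
  exact: nbhs_left_lt.
by rewrite uE ?addrK// timeS; apply/andP; split; lra.
Unshelve. all: end_near. Qed.

Section Signed.
Variable S : R.
Hypothesis S_sign : S = 1 \/ S = -1.
Local Notation g := (signed_flux S f).

Lemma packet_sample n m th w p l : S * G n (m - 1) <= S * G n m ->
  x_ m <= p < x_ (m + 1) -> p = x_ m + th * eps -> 0 <= th ->
  u t p @[t --> (t_ n.+1)^'-] --> l ->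
  splits g (S * G n (m - 1)) (S * G n m) th w -> S * l = w.
Proof.
move=> yy pI pE th0 cv sp; have [v hv vl] := packet_limit pI cv.
rewrite pE addrC addKr in vl.
apply: (riemann_sample (riemann_solution_signed S_sign hv) _ _ yy eps_gt0 th0 sp).
- exact: signed_flux_lip f_C2 f'_itv f''_le S_sign.
- exact: signed_flux_lt f_C2 f'_itv f''_le S_sign.
- by apply: cvgMr.
Qed.

Lemma splits_right_end (a b : R) : a <= b -> splits g a b 1 b.
Proof.
move=> ab; split; last by move=> v /andP[bv /(lt_le_trans bv)]; rewrite ltxx.
split; first by rewrite ab lexx.
move=> v /andP[av vb]; have := signed_flux_lip f_C2 f'_itv f''_le S_sign b v.
have h1 : 0 <= b - v by lra.
by move=> /(le_trans (ler_norm _)); rewrite (ger0_norm h1); lra.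
Qed.

Lemma splits_left_end (a b : R) : a <= b -> splits g a b 0 a.
Proof.
move=> ab; have lt := signed_flux_lt f_C2 f'_itv f''_le S_sign.
split; last by move=> v /andP[av _]; rewrite mul0r subr_gt0 lt.
split; first by rewrite ab lexx.
move=> v /andP[av vb]; rewrite mul0r subr_ge0.
by move: av; rewrite le_eqVlt => /predU1P[->//|/lt/ltW].
Qed.

End Signed.

Lemma sign_total (a b : R) : exists2 S : R, S = 1 \/ S = -1 & S * a <= S * b.
Proof.
have [ab|/ltW ba] := leP a b; first by exists 1; [left|rewrite !mul1r].
by exists (-1); [right|rewrite !mulN1r lerN2].
Qed.

(** The cell that starts at node [m] is sampled at [x_ m + theta n.+1 * eps], in the fan issued from
    [m]; hence the new value at [m] cuts the old jump between [m - 1] and [m]. *)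
Lemma grid_split n m (S : R) : S = 1 \/ S = -1 -> S * G n (m - 1) <= S * G n m ->
  splits (signed_flux S f) (S * G n (m - 1)) (S * G n m) (theta n.+1)
    (S * G n.+1 m).
Proof.
move=> hS yy; have [_ _ us] := u_glimm.
have /andP[th0 th1] := theta_itv (ltn0Sn n).
have e0 := eps_gt0.
have xS : x_ (m + 1) = x_ m + eps by rewrite /node intrD mulrDl mul1r.
have := us n.+1 (m + 1) (x_ m) isT; rewrite addrK => /(_ ltac:(rewrite lexx node_lt//; lia)).
set p := _ + _ => cv.
have pE : p = x_ m + theta n.+1 * eps by rewrite /p xS; ring.
(* If theta = 1 the sample lies on the next node, where the fan starts with the
   left state u(n, m). *)
have [thE|th_lt] := eqVneq (theta n.+1) 1.
  have -> : G n.+1 m = G n m; last by rewrite thE; exact: splits_right_end.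
  have [S' hS' yy'] := sign_total (G n (m + 1 - 1)) (G n (m + 1)).
  have := @packet_sample S' hS' n (m + 1) 0 _ p _ yy' _ _ (lexx 0) cv
    (splits_left_end hS' yy').
  rewrite addrK pE thE mul1r mul0r addr0 xS -xS lexx node_lt//.
  move=> /(_ ltac:(lia) erefl) E.
  have S'0 : S' != 0 by case: hS' => ->; rewrite ?oppr_eq0 oner_eq0.
  by apply: (mulfI S'0).
have {}th_lt : theta n.+1 < 1 by rewrite lt_neqAle th_lt.
have pI : x_ m <= p < x_ (m + 1).
  rewrite pE xS lerDl ltrD2l mulr_ge0 ?(ltW e0)//=.
  by rewrite -[ltRHS]mul1r ltr_pM2r.
have [w sp] := exists_split (signed_flux_lip f_C2 f'_itv f''_le hS) (theta n.+1) yy.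
by rewrite (packet_sample hS yy pI pE th0 cv sp).
Qed.

Lemma grid_between n m (S : R) : S = 1 \/ S = -1 -> S * G n (m - 1) <= S * G n m ->
  S * G n (m - 1) <= S * G n.+1 m <= S * G n m.
Proof. by move=> hS /(grid_split hS)[[]]. Qed.

Lemma grid_between_ge n m (S : R) : S = 1 \/ S = -1 -> S * G n m <= S * G n (m - 1) ->
  S * G n m <= S * G n.+1 m <= S * G n (m - 1).
Proof.
move=> hS yy; have hS' : - S = 1 \/ - S = -1 by case: hS => ->; [right|left]; rewrite ?opprK.
have := @grid_between n m (- S) hS'; rewrite !mulNr !lerN2 => /(_ yy) /andP[h1 h2].
by rewrite h1 h2.
Qed.

End Grid.

Section EssSup.
Context {R : realType}.
Local Notation mu := (@lebesgue_measure R).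

Lemma continuous_ess_bound (h : R -> R) (k : R) : continuous h ->
  (\forall x \ae mu, h x <= k) -> forall x, h x <= k.
Proof.
move=> ch [A [mA A0 hA]] x; rewrite leNgt; apply/negP => kx.
have : \forall z \near x, k < h z by apply: (cvgr_gt (h x) (ch x)).
move=> /nbhs_ballP[r /= r0 hr].
pose I : set R := `[x, x + r / 2].
have sub : I `<=` A.
  move=> z; rewrite /I /= in_itv/= => /andP[z1 z2]; apply: hA => /=.
  apply/negP; rewrite -ltNge; apply: hr.
  by rewrite /ball /= distrC ger0_norm; lra.
have : (mu I <= mu A)%E.
  by apply: le_measure; rewrite ?inE//; exact: measurable_itv.
rewrite A0 /I lebesgue_measure_itv /= lte_fin ifT; last by rewrite ltrDl; lra.
by rewrite -EFinB lee_fin; lra.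
Qed.

Lemma ess_norm_bound (h : R -> R) : continuous h ->
  (exists M : R, forall x, `|h x| <= M) ->
  exists2 K, 'N[mu]_+oo[EFin \o h]%E = K%:E & forall x, `|h x| <= K.
Proof.
move=> ch [M hM].
have E : 'N[mu]_+oo[EFin \o h]%E = ess_sup mu (abse \o (EFin \o h)).
  have mT : (0 < mu [set: R])%E.
    by rewrite -set_itvNyy lebesgue_measure_itv /= ltry.
  by rewrite unlock ifT.
have fN : ('N[mu]_+oo[EFin \o h])%E \is a fin_num.
  rewrite ge0_fin_numE ?Lnorm_ge0// E; apply: (@le_lt_trans _ _ M%:E); last exact: ltry.
  by apply/ess_supP; apply: aeW => x /=; rewrite lee_fin.
exists (fine ('N[mu]_+oo[EFin \o h])%E); first by rewrite fineK.
apply: (@continuous_ess_bound (fun x => `|h x|)).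
  by move=> x; apply: cvg_norm; exact: ch.
have := ess_sup_ge mu (abse \o (EFin \o h)); rewrite -E.
by apply: filterS => x /=; rewrite -[X in (_ <= X)%E -> _](fineK fN) lee_fin.
Qed.

End EssSup.

(** * Positions and speeds of the waves *)

Section Waves.
Context {R : realType}.
Local Notation mu := (@lebesgue_measure R).
Variables (f : R -> R) (ubar : R -> R) (eps : R) (theta : nat -> R) (u : R -> R -> R).
Variable K : R.
Hypothesis f_C2 : C2 f.
Hypothesis f'_itv : forall w : R, 0 < f^`() w < 1.
Hypothesis f''_le : forall w : R, `|f^`()^`() w| <= K.
Hypothesis eps_gt0 : 0 < eps.
Hypothesis ubar_BV : (total_variation_line ubar < +oo)%E.
Hypothesis theta_itv : forall n, (0 < n)%N -> 0 <= theta n <= 1.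
Hypothesis u_glimm : glimm_solution f eps theta ubar u.
Local Notation x_ := (node eps).
Local Notation G := (grid_value eps u).
Local Notation Uf := (U eps ubar).
Local Notation pos := (position f eps theta ubar u).
Local Notation sgn := (wave_sign eps ubar).
Local Notation state := (wave_state eps ubar).
Local Notation TVD := (total_variation_line (discretized_datum eps ubar)).

Definition waves_at (S : R) (n : nat) (m : int) : set R :=
  [set s | [/\ waves eps ubar s, pos n s = (x_ m)%:E & sgn s = S]].

Lemma waves_at_inj S n m m' s : waves_at S n m s -> waves_at S n m' s -> m = m'.
Proof. by move=> [_ p1 _] [_ + _]; rewrite p1 => -[/(node_inj eps_gt0)]. Qed.

Lemma wave_sign_node s m : pos 0 s = (x_ m)%:E ->
  sgn s = Num.sg (ubar (x_ m) - ubar (x_ (m - 1))).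
Proof. by move=> /= E; rewrite /wave_sign E /= datum_node// datum_left. Qed.

Lemma wave_state_node s m : pos 0 s = (x_ m)%:E ->
  state s = ubar (x_ (m - 1)) + sgn s * (s - Uf (x_ (m - 1))).
Proof. by move=> /= E; rewrite /wave_state E /= datum_left// U_left. Qed.

Lemma waves_at0E S m : waves_at S 0 m =
  [set s | Uf (x_ (m - 1)) < s <= Uf (x_ m) /\
    Num.sg (ubar (x_ m) - ubar (x_ (m - 1))) = S].
Proof.
apply/seteqP; split => s.
  move=> [[s0 _] ps sS]; split; first exact: (position0_node eps_gt0 ubar_BV s0 ps).
  by rewrite -sS (wave_sign_node ps).
move=> [/[dup] sI /andP[s1 s2] hS].
have ps := position0_cell eps_gt0 ubar_BV sI.
split => //; last by rewrite (wave_sign_node ps).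
split; first exact: le_lt_trans (U_ge0 eps_gt0 ubar_BV _) s1.
by apply: (le_trans _ (U_le eps_gt0 ubar_BV (x_ m))); rewrite lee_fin.
Qed.

Section Signed.
Variable S : R.
Hypothesis S_sign : S = 1 \/ S = -1.
Local Notation g := (signed_flux S f).
Local Notation y n m := (S * G n m).
Local Notation w s := (S * state s).
Local Notation at_ := (waves_at S).

Let SS : S * S = 1. Proof. exact: signK S_sign. Qed.

Let sgS : Num.sg S = S.
Proof. by case: S_sign => ->; rewrite ?sgrN sgr1. Qed.

Let gK := admissible_signed_flux f_C2 f'_itv f''_le S_sign.

Lemma sg_eq_sign (d : R) : (Num.sg d = S) <-> 0 < S * d.
Proof.
split => [E|h]; first by rewrite -E -normrEsg normr_gt0 -sgr_eq0 E -sgr_eq0 sgS; case: S_sign => ->; rewrite ?oppr_eq0 oner_eq0.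
by move: h; rewrite -sgr_gt0 sgrM sgS; case: S_sign => ->; case: sgrP; lra.
Qed.

(** On the jump at [m] the signed state is the label [s] plus a constant, and the labels fill an
    interval as long as the jump. *)
Lemma waves_at0_transports m : transports (at_ 0%N m) (fun s => w s) (y 0%N (m - 1)) (y 0%N m).
Proof.
rewrite !(grid0 eps_gt0 u_glimm).
have [dS|/negP dS] := boolP (0 < S * (ubar (x_ m) - ubar (x_ (m - 1)))); last first.
  have E : at_ 0%N m = set0.
    by rewrite waves_at0E; apply/seteqP; split => // s [_ /sg_eq_sign].
  have le : S * ubar (x_ m) <= S * ubar (x_ (m - 1)).
    by rewrite -subr_ge0 -mulrBr; move/negP: dS; rewrite -leNgt; lra.
  rewrite E; split => // B mB; rewrite set0I; split => //.
  by rewrite set_itv_ge -?leNgt ?bnd_simp// set0I.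
set c := S * ubar (x_ (m - 1)) - Uf (x_ (m - 1)).
have aE : S * ubar (x_ (m - 1)) = Uf (x_ (m - 1)) + c by rewrite /c; ring.
have bE : S * ubar (x_ m) = Uf (x_ m) + c.
  rewrite (U_node eps_gt0 ubar_BV) /jump -[`|_|]mul1r.
  have -> : 1 = Num.norm S by case: S_sign => ->; rewrite ?normrN normr1.
  by rewrite -normrM gtr0_norm// /c; ring.
rewrite aE bE; apply: transports_translation.
  rewrite waves_at0E; apply/seteqP; split => s /=; rewrite in_itv/=; first by case.
  by move=> h; split => //; apply/sg_eq_sign.
move=> s [_ ps sS]; rewrite (wave_state_node ps) sS mulrDr mulrA SS mul1r /c; ring.
Qed.

(** Isolated from [waves_at_step] because the converse needs [slow_iff], which relies on the range
    of states obtained here. *)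
Lemma waves_at_step_sub n m s : at_ n.+1 m s ->
  moves_to f eps theta ubar u n (pos n) s m /\
  (at_ n (m - 1) s \/ at_ n m s) /\ y n.+1 (m - 1) < w s <= y n.+1 m.
Proof.
move=> [ws ps sS]; move: ps => /=; case: xgetP => // _ _ [m' hm' <-] [/(node_inj eps_gt0) mE].
rewrite -mE; split => //; case: hm' => [h _]; rewrite sS => wI; split => //.
by case: h => -[_ p _]; [left|right].
Qed.

Lemma waves_at_range n m s : at_ n m s -> y n (m - 1) < w s <= y n m.
Proof.
case: n => [|n]; last by move=> /waves_at_step_sub[_ []].
by have [_ h _] := waves_at0_transports m; exact: h.
Qed.

Lemma speed_at_node n m s : at_ n m s ->
  speed_at f eps ubar u n (pos n) s =
  (hull_slope g (y n (m - 1)) (y n m) (w s))%:E.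
Proof.
move=> /[dup] /waves_at_range wI [_ ps sS].
rewrite /speed_at ps (grid_left eps_gt0 u_glimm) sS.
by rewrite (wave_slopeE f_C2 f'_itv f''_le S_sign wI).
Qed.

Lemma grid_splits n m : y n (m - 1) < y n m ->
  splits g (y n (m - 1)) (y n m) (theta n.+1) (y n.+1 m).
Proof.
move=> /ltW; exact: (grid_split f_C2 f'_itv f''_le eps_gt0 theta_itv u_glimm S_sign).
Qed.

Lemma slow_iff n m s : at_ n m s ->
  (speed_at f eps ubar u n (pos n) s <= (theta n.+1)%:E)%E = (w s <= y n.+1 m).
Proof.
move=> hs; rewrite (speed_at_node hs) lee_fin.
have wI := waves_at_range hs; have /andP[w1 w2] := wI.
by have yy := lt_le_trans w1 w2; exact: (hull_slope_split gK yy (grid_splits yy) wI).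
Qed.

Lemma waves_at_step n m s : at_ n.+1 m s <->
  (at_ n (m - 1) s \/ at_ n m s) /\ y n.+1 (m - 1) < w s <= y n.+1 m.
Proof.
split=> [/waves_at_step_sub[]//|[hs /andP[w1 w2]]].
have [ws sS] : waves eps ubar s /\ sgn s = S by case: hs => -[].
have mv : moves_to f eps theta ubar u n (pos n) s m.
  split; last by rewrite sS w1 w2.
    case: hs => [h|h]; [left|right]; split; try by case: h.
      by rewrite ltNge (slow_iff h) -ltNge.
    by rewrite (slow_iff h).
  by rewrite sS; apply/esym/sg_eq_sign; rewrite mulrBr subr_gt0 (lt_le_trans w1).
split => //=; apply: xget_unique; first by exists m.
(* A wave is not both fast and slow at its node, so its target is unique. *)
move=> _ [m' [h' _ _] <-]; congr (x_ _)%:E; case: mv => [h _ _].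
case: h' => -[_ p1 c1]; case: h => -[_ p2 c2]; move: p2; rewrite p1 => -[/(node_inj eps_gt0)].
- lia.
- by move: c1; rewrite ltNge c2.
- by move: c2; rewrite ltNge c1.
- by [].
Qed.

Definition initial_waves := [set s | exists m, at_ 0%N m s].

Lemma waves_at_initial n m : at_ n m `<=` initial_waves.
Proof.
elim: n m => [|n IH] m s; first by exists m.
by move=> /waves_at_step[[/IH|/IH]].
Qed.

Let between_le n m := @grid_between R f ubar eps theta u K f_C2 f'_itv f''_le eps_gt0 theta_itv u_glimm n m S S_sign.
Let between_ge n m := @grid_between_ge R f ubar eps theta u K f_C2 f'_itv f''_le eps_gt0 theta_itv u_glimm n m S S_sign.

Lemma initial_waves_measurable : measurable initial_waves.
Proof.
rewrite /initial_waves -bigcup_int_family; apply: bigcupT_measurable.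
by apply: int_family_measurable => m; case: (waves_at0_transports m).
Qed.

Definition real_speed n s : R := fine (speed_at f eps ubar u n (pos n) s).

Lemma real_speedE n m s : at_ n m s ->
  real_speed n s = hull_slope g (y n (m - 1)) (y n m) (w s).
Proof. by move=> h; rewrite /real_speed (speed_at_node h). Qed.

Definition survivors n := [set s | exists m, at_ n m s].

Lemma survivors_measurable n : measurable (survivors n).
Proof.
exact: (alive_measurable (y := fun n m => y n m) (w := fun s => w s) between_le
  between_ge (@waves_at_inj S) waves_at_step waves_at0_transports n).
Qed.

Lemma initial_waves_sub : initial_waves `<=` `]0, fine TVD].
Proof.
move=> s [m [[s0 sV] _ _]]; rewrite /= in_itv/= s0 /=.
by rewrite -lee_fin fineK// TVD_fin.
Qed.

Lemma initial_waves_measure : mu initial_waves = (fine (mu initial_waves))%:E.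
Proof.
rewrite fineK// ge0_fin_numE//; apply: (@le_lt_trans _ _ (mu `]0, fine TVD])).
  apply: le_measure; rewrite ?inE//; last exact: initial_waves_sub.
  exact: initial_waves_measurable.
by rewrite lebesgue_measure_itv /=; case: ifP => _; rewrite ?ltry// -EFinB ltry.
Qed.

Let splits_ex n m : y n (m - 1) < y n m ->
  exists th, splits g (y n (m - 1)) (y n m) th (y n.+1 m).
Proof. by move=> /grid_splits; exists (theta n.+1). Qed.

Lemma survivors_speed_measurable n :
  measurable_fun (survivors n.+1) (speed_change real_speed n).
Proof.
exact: (speed_change_measurable (y := fun n m => y n m) (w := fun s => w s) (F := real_speed) gK splits_ex between_le between_ge (@waves_at_inj S)
  waves_at_step waves_at0_transports real_speedE initial_waves_measurable
  initial_waves_measure waves_at_initial).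
Qed.

Lemma signed_cost :
  (\sum_(0 <= n <oo) \int[mu]_(s in survivors n.+1) (speed_change real_speed n s)%:E
    <= (3 * K * fine (mu initial_waves) ^+ 2)%:E)%E.
Proof.
exact: (total_cost (y := fun n m => y n m) (w := fun s => w s) (F := real_speed) gK splits_ex between_le between_ge (@waves_at_inj S)
  waves_at_step waves_at0_transports real_speedE initial_waves_measurable
  initial_waves_measure waves_at_initial).
Qed.

Lemma survivors_speedE n s : survivors n.+1 s ->
  (`|speed f eps theta ubar u n.+1 s - speed f eps theta ubar u n s|)%E =
  (speed_change real_speed n s)%:E.
Proof.
move=> [m hm]; have [m' hm'] : exists m', at_ n m' s.
  by move/waves_at_step: hm => [[h|h] _]; [exists (m - 1)|exists m].
rewrite /speed (speed_at_node hm) (speed_at_node hm') /speed_change.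
by rewrite (real_speedE hm) (real_speedE hm').
Qed.

End Signed.

Let sign1 : (1 : R) = 1 \/ (1 : R) = -1. Proof. by left. Qed.
Let signN1 : (-1 : R) = 1 \/ (-1 : R) = -1. Proof. by right. Qed.

(** After a move the sign is 1 or -1: the strict inequality in [moves_to] excludes the sign 0. *)
Lemma remaining_wavesE n : remaining_waves f eps theta ubar u n.+1 =
  survivors 1 n.+1 `|` survivors (-1) n.+1.
Proof.
apply/seteqP; split => s; last by move=> [|] [m [ws ps _]]; split => //; rewrite ps ltry.
move=> [ws pfin].
have [m0 hm0] : exists m, moves_to f eps theta ubar u n (pos n) s m.
  apply: contrapT => h; move: pfin => /=; rewrite xgetPN ?ltxx// => x [m hm _].
  by apply: h; exists m.
have [m [hm sE ineq] ps] : [set (x_ m)%:E | m in moves_to f eps theta ubar u n (pos n) s] (pos n.+1 s).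
  by apply: xgetPex; exists (x_ m0)%:E, m0.
have s0 : sgn s != 0.
  by apply/eqP => z; move: ineq; rewrite z !mul0r ltxx.
case: (sgrP (G n.+1 m - G n.+1 (m - 1))) sE => _ sE.
- by rewrite sE eqxx in s0.
- by left; exists m.
- by right; exists m.
Qed.

Lemma survivors_disjoint n : [disjoint survivors 1 n & survivors (-1) n].
Proof.
apply/disj_setPRL => s [m [_ _ s1]] [m' [_ _ s2]].
have E : (1 : R) = -1 by rewrite -s1 -s2.
lra.
Qed.

Lemma speed_variationE n : speed_variation f eps theta ubar u n.+1 =
  (\int[mu]_(s in survivors 1 n.+1) (speed_change real_speed n s)%:E +
   \int[mu]_(s in survivors (-1) n.+1) (speed_change real_speed n s)%:E)%E.
Proof.
rewrite /speed_variation remaining_wavesE /=.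
have mA := survivors_measurable sign1 n.+1; have mB := survivors_measurable signN1 n.+1.
transitivity (\int[mu]_(s in survivors 1 n.+1 `|` survivors (-1) n.+1)
    (speed_change real_speed n s)%:E)%E.
  apply: eq_integral => s; rewrite inE => -[h|h].
    exact: survivors_speedE sign1 _ _ h.
  exact: survivors_speedE signN1 _ _ h.
rewrite ge0_integral_setU//.
- apply/measurable_EFinP; apply/measurable_funU => //; split.
    exact: survivors_speed_measurable sign1 n.
  exact: survivors_speed_measurable signN1 n.
- by move=> s _; rewrite lee_fin /speed_change.
- exact: survivors_disjoint.
Qed.

Lemma initial_waves_total :
  fine (mu (initial_waves 1)) + fine (mu (initial_waves (-1))) <= fine TVD.
Proof.
have m1 := initial_waves_measurable sign1; have m2 := initial_waves_measurable signN1.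
have V0 : 0 <= fine TVD.
  rewrite fine_ge0//; apply: ereal_sup_ubound; exists (0, 0) => //=.
  by rewrite total_variationxx.
rewrite -lee_fin EFinD -(initial_waves_measure sign1) -(initial_waves_measure signN1).
rewrite -measureU//; last first.
  by apply/eqP; rewrite -/(disj_set _ _); exact: (survivors_disjoint 0).
apply: (@le_trans _ _ (mu `]0, fine TVD])).
  apply: le_measure; rewrite ?inE//; first exact: measurableU.
  by move=> s [] /initial_waves_sub; apply.
rewrite lebesgue_measure_itv /=; case: ifP => _; last by rewrite lee_fin.
by rewrite -EFinB subr0.
Qed.

Lemma glimm_speed_variation :
  (\sum_(1 <= n <oo) speed_variation f eps theta ubar u n
    <= (3 * K * fine TVD ^+ 2)%:E)%E.
Proof.
have pos0 n : (0 <= speed_variation f eps theta ubar u n)%E.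
  by apply: integral_ge0 => s _; exact: abse_ge0.
rewrite -(nneseries_addn 1)//.
rewrite (eq_eseriesr (g := fun n =>
  (\int[mu]_(s in survivors 1 n.+1) (speed_change real_speed n s)%:E +
   \int[mu]_(s in survivors (-1) n.+1) (speed_change real_speed n s)%:E)%E)); last first.
  by move=> n _; rewrite addn1 speed_variationE.
rewrite nneseriesD; last 2 first.
- by move=> n _ _; apply: integral_ge0 => s _; rewrite lee_fin /speed_change.
- by move=> n _ _; apply: integral_ge0 => s _; rewrite lee_fin /speed_change.
apply: (le_trans (leeD (signed_cost sign1) (signed_cost signN1))).
rewrite -EFinD lee_fin.
have K0 : 0 <= K by exact: le_trans (f''_le 0).
have := initial_waves_total.
have : 0 <= fine (mu (initial_waves 1)) by rewrite fine_ge0.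
have : 0 <= fine (mu (initial_waves (-1))) by rewrite fine_ge0.
set a := fine _; set b := fine _; set V := fine TVD => a0 b0 abV.
rewrite -mulrDr ler_wpM2l ?mulr_ge0//.
have : (b + a) ^+ 2 <= V ^+ 2 by rewrite ler_sqr ?nnegrE//; lra.
have : 0 <= a * b by rewrite mulr_ge0.
by rewrite !expr2; lra.
Qed.

End Waves.

Theorem theorem1 (R : realType) (f : R -> R) (ubar : R -> R) (eps : R)
    (theta : nat -> R) (u : R -> R -> R)
    (f_C2 : C2 f)
    (f'_itv : forall w : R, 0 < f^`() w < 1)
    (f''_bounded : exists M : R, forall w : R, `|f^`()^`() w| <= M)
    (ubar_BV : (total_variation_line ubar < +oo)%E)
    (ubar_rc : right_continuous ubar)
    (eps_gt0 : 0 < eps)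
    (theta_ud : uniformly_distributed theta)
    (u_glimm : glimm_solution f eps theta ubar u) :
  (\sum_(1 <= n <oo) speed_variation f eps theta ubar u n
     <= (3 + 2 * ln 2)%:E
        * 'N[@lebesgue_measure R]_+oo [EFin \o f^`()^`()]
        * total_variation_line ubar ^+ 2)%E.
Proof.
have [_ _ f''_cont] := f_C2; have [theta_itv _] := theta_ud.
have [K -> f''_le] := ess_norm_bound f''_cont f''_bounded.
apply: (le_trans (glimm_speed_variation f_C2 f'_itv f''_le eps_gt0 ubar_BV theta_itv u_glimm)).
have V0 : (0 <= total_variation_line ubar)%E.
  by apply: ereal_sup_ubound; exists (0, 0) => //=; rewrite total_variationxx.
have VF : total_variation_line ubar \is a fin_num by rewrite ge0_fin_numE.
have DF := TVD_fin eps_gt0 ubar_BV.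
have := TVD_le ubar eps_gt0; rewrite -(fineK VF) -(fineK DF) lee_fin => DV.
have D0 : 0 <= fine (total_variation_line (discretized_datum eps ubar)).
  rewrite fine_ge0//; apply: ereal_sup_ubound; exists (0, 0) => //=.
  by rewrite total_variationxx.
rewrite -EFin_expe -!EFinM lee_fin.
have K0 : 0 <= K by exact: le_trans (f''_le 0).
(* The wave estimate has the constant 3, which is at most [3 + 2 * ln 2]. *)
have l0 : 0 <= ln 2 :> R by rewrite ln_ge0// ler1n.
apply: ler_pM.
- by rewrite mulr_ge0.
- by rewrite exprn_ge0.
- by rewrite ler_wpM2r// lerDl mulr_ge0.
- by rewrite ler_sqr ?nnegrE// (le_trans D0 DV).
Qed.
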